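(* Let $f\in L^\infty(\mathbb T^2)$ have mean zero and let $\omega$ be the solution of $$\partial_t\omega+\Pi_N(u\cdot\nabla\omega)=\Delta\omega\ \text{ on }(0,\infty)\times\mathbb T^2,\qquad \omega|_{t=0}=\omega^0=\Pi_Nf,$$ where $u=\nabla^\perp\Delta^{-1}\omega$. Then for all $N\ge2$, $$\sup_{t\ge0}\|\omega(t)\|_\infty\le\|\omega^0\|_\infty+\alpha\cdot N^{-\frac12},$$ where $\alpha>0$ depends only on $\|f\|_\infty$.
   Context: $\mathbb T^2=[0,1)^2$ periodic; functions are real-valued; $\omega$ has mean zero (preserved in time). $\Pi_N$ is the Fourier projection onto modes $e^{2\pi ik\cdot x}$, $k\in\mathbb Z^2$, with $|k|_\infty=\max(|k_1|,|k_2|)\le N$. $\nabla^\perp=(-\partial_{x_2},\partial_{x_1})$ and $\Delta^{-1}$ is the inverse Laplacian on mean-zero functions. $\|\cdot\|_\infty$ is the $L^\infty(\mathbb T^2)$ norm. *)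

(* Defs.v *)
From HB Require Import structures.
From mathcomp Require Import all_boot all_order all_algebra.
From mathcomp Require Import zify complex.
From mathcomp Require Import all_classical all_reals all_analysis.
Import Order.TTheory GRing.Theory Num.Theory.
Import numFieldNormedType.Exports.

Set Implicit Arguments.
Unset Strict Implicit.
Unset Printing Implicit Defensive.

Local Open Scope classical_set_scope.
Local Open Scope ring_scope.

(* Functions on the torus are represented by 1-periodic functions on R * R.
   The norm and the integral over the torus only see the cell [0,1)^2. *)

Section Torus.
Context {R : realType}.
Implicit Types (f g psi : R * R -> R) (x : R * R) (k : int * int).

Definition periodic f : Prop :=
  forall x, f (x.1 + 1, x.2) = f x /\ f (x.1, x.2 + 1) = f x.

(* R carries several measurable structures; measurableTypeR R is the one
   lebesgue_measure lives on. *)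
Definition unit_square : set (measurableTypeR R * measurableTypeR R) :=
  `[0, 1[ `*` `[0, 1[.

Lemma measurable_unit_square : measurable unit_square.
Proof. by apply: measurableX; exact: measurable_itv. Qed.

Definition torus_measure :
    {measure set (measurableTypeR R * measurableTypeR R) -> \bar R} :=
  mrestr (@lebesgue_measure R \x @lebesgue_measure R)%E measurable_unit_square.

Lemma torus_measureT : torus_measure setT = 1%E.
Proof.
rewrite /torus_measure /= /mrestr setTI product_measure1E //=;
  try exact: measurable_itv.
by rewrite !lebesgue_measure_itv /= !lte01 !sube0 mule1.
Qed.

Definition norm_inf f : \bar R := ('N[torus_measure]_+oo[EFin \o f])%E.

Definition Linfty f : Prop := periodic f /\ f \in Lfun torus_measure +oo%E.

Definition mean_zero f : Prop := \int[torus_measure]_x f x = 0.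

Definition phase k x : R := 2 * pi * (k.1%:~R * x.1 + k.2%:~R * x.2).

Definition fourier_mode k x : R[i] := (cos (phase k x) +i* sin (phase k x))%C.

Definition fourier_coef f k : R[i] :=
  (\int[torus_measure]_x (f x * cos (phase k x))
   -i* \int[torus_measure]_x (f x * sin (phase k x)))%C.

(* The frequencies k with |k|_oo <= N are the pairs (i - N, j - N) with
   0 <= i, j <= 2 N. *)
Definition freq (N : nat) (ij : 'I_(2 * N).+1 * 'I_(2 * N).+1) : int * int :=
  (ij.1%:Z - N%:Z, ij.2%:Z - N%:Z).

Definition fourier_proj_complex (N : nat) f x : R[i] :=
  \sum_(ij : 'I_(2 * N).+1 * 'I_(2 * N).+1)
    fourier_coef f (freq ij) * fourier_mode (freq ij) x.

Definition fourier_proj (N : nat) f x : R :=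
  complex.Re (fourier_proj_complex N f x).

Definition d1 f x : R := derive1 (fun s : R => f (s, x.2)) x.1.
Definition d2 f x : R := derive1 (fun s : R => f (x.1, s)) x.2.

Definition laplacian f x : R := d1 (d1 f) x + d2 (d2 f) x.

Definition C1 f : Prop :=
  [/\ continuous f,
      forall x, derivable (fun s : R => f (s, x.2)) x.1 1,
      forall x, derivable (fun s : R => f (x.1, s)) x.2 1,
      continuous (d1 f) & continuous (d2 f)].

Definition C2 f : Prop := [/\ C1 f, C1 (d1 f) & C1 (d2 f)].

Definition inv_laplacian g : R * R -> R :=
  xget (cst 0)
    [set psi | [/\ periodic psi, C2 psi, mean_zero psi & laplacian psi =1 g]].

(* u . grad g for the velocity u = (- d2 psi, d1 psi), psi = inv_laplacian g. *)
Definition velocity g x : R * R :=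
  (- d2 (inv_laplacian g) x, d1 (inv_laplacian g) x).

Definition advection g x : R :=
  (velocity g x).1 * d1 g x + (velocity g x).2 * d2 g x.

Definition dt (w : R -> R * R -> R) (t : R) x : R :=
  derive1 (fun s : R => w s x) t.

Definition continuous_pos (w : R -> R * R -> R) : Prop :=
  forall p : R * (R * R), 0 < p.1 ->
    {for p, continuous (fun q : R * (R * R) => w q.1 q.2)}.

Definition C12_pos (w : R -> R * R -> R) : Prop :=
  [/\ forall t x, 0 < t -> derivable (fun s : R => w s x) t 1,
      forall t, 0 < t -> C2 (w t),
      continuous_pos (dt w),
      continuous_pos (fun t => d1 (w t)) /\
      continuous_pos (fun t => d2 (w t)) &
      [/\ continuous_pos (fun t => d1 (d1 (w t))),
          continuous_pos (fun t => d1 (d2 (w t))),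
          continuous_pos (fun t => d2 (d1 (w t))) &
          continuous_pos (fun t => d2 (d2 (w t)))]].

(* Classical solutions; values of w at negative times are irrelevant.  That
   w t is a trigonometric polynomial is not assumed. *)
Record solution (N : nat) (w0 : R * R -> R) (w : R -> R * R -> R) : Prop :=
  Solution {
    solution_periodic : forall t, 0 <= t -> periodic (w t);
    solution_mean_zero : forall t, 0 <= t -> mean_zero (w t);
    solution_continuous :
      {within [set p : R * (R * R) | 0 <= p.1],
        continuous (fun p : R * (R * R) => w p.1 p.2)};
    solution_C12 : C12_pos w;
    solution_eq : forall t x, 0 < t ->
      dt w t x + fourier_proj N (advection (w t)) x = laplacian (w t) x;
    solution_init : w 0 =1 w0 }.

Lemma phaseN k x : phase (- k.1, - k.2) x = - phase k x.
Proof. by rewrite /phase /= !mulrNz !mulNr -opprD mulrN. Qed.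

Lemma Rintegral_torusN (h : R * R -> R) :
  \int[torus_measure]_x (- h x) = - \int[torus_measure]_x h x.
Proof.
rewrite /Rintegral.
have -> : (fun x => (- h x)%:E) = (\- (EFin \o h))%E by [].
rewrite [X in fine X]integralE [X in - fine X]integralE funeposN funenegN.
have p0 : (0 <= \int[torus_measure]_x (EFin \o h)^\+ x)%E.
  by apply: integral_ge0 => x _; exact: funepos_ge0.
have n0 : (0 <= \int[torus_measure]_x (EFin \o h)^\- x)%E.
  by apply: integral_ge0 => x _; exact: funeneg_ge0.
move: p0 n0; case: (integral _ _ _) => [a| |] //;
  case: (integral _ _ _) => [b| |] //= _ _; by rewrite ?oppr0 // opprB.
Qed.

Lemma fourier_coefN f k :
  fourier_coef f (- k.1, - k.2) = ((fourier_coef f k)^* )%C.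
Proof.
rewrite /fourier_coef /=; congr (_ +i* _)%C.
  by congr Rintegral; apply/funext => x; rewrite phaseN cosN.
congr (- _); rewrite -Rintegral_torusN.
by congr Rintegral; apply/funext => x; rewrite phaseN sinN mulrN.
Qed.

(* The sum defining the projection is already real. *)
Lemma fourier_projE N f x :
  fourier_proj_complex N f x = (fourier_proj N f x)%:C%C.
Proof.
rewrite /fourier_proj; set z := fourier_proj_complex N f x.
suff zJ : (z^* )%C = z.
  by case: z zJ => a b /= [] /eqP; rewrite eqNr => /eqP ->.
rewrite /z /fourier_proj_complex rmorph_sum.
pose r (ij : 'I_(2 * N).+1 * 'I_(2 * N).+1) := (rev_ord ij.1, rev_ord ij.2).
have rK : involutive r by case=> i j; rewrite /r /= !rev_ordK.
have freqr ij : freq (r ij) = (- (freq ij).1, - (freq ij).2).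
  case: ij => -[i iN] [j jN]; rewrite /freq /r /=.
  by congr (_, _); lia.
rewrite [RHS](reindex_inj (inv_inj rK)); apply: eq_bigr => ij _.
rewrite [LHS]rmorphM freqr fourier_coefN; congr (_ * _).
by rewrite /fourier_mode phaseN cosN sinN.
Qed.

End Torus.

(* Main.v *)
(* At a critical point of w(t) the transport term vanishes, so there
   dw/dt = laplacian w + g with the defect g = u.grad w - Pi_N (u.grad w), and by
   the maximum principle the sup norm of w grows at most by the time integral of
   the sup norm of g.  Write w = l + b, where l is the heat flow of Pi_N f, and
   S_j(b) = \sum_k |k|^(2j) |b_k|^2.  Up to time N^(-5/4), the contribution of b to
   g is controlled by the time integral of S_2(b), and that of l by Bernstein's
   inequality for the heat flow together with the logarithmic L^1 bound of the
   Dirichlet kernels: a frequency p of u only sees the truncation of l to the box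
   minus its translate by -p.  After that time, only frequencies >= N/2 matter:
   l is exponentially small there, and for b the gain 1/N is paid for by the time
   integral of t e^t S_3(b).  Altogether the sup norm grows by at most N^(-5/8)
   times a power of log N.

   That w(t) is a trigonometric polynomial comes from the maximum principle as
   well: w - Pi_N w solves the heat equation with zero initial data. *)

Require Import Defs.
From mathcomp Require Import all_boot all_order all_algebra.
From mathcomp Require Import zify ring lra complex.
From mathcomp Require Import all_classical all_reals all_analysis.
From mathcomp Require Import measurable_realfun ess_sup_inf.
Import Order.TTheory GRing.Theory Num.Theory.
Import numFieldNormedType.Exports.

Set Implicit Arguments.
Unset Strict Implicit.
Unset Printing Implicit Defensive.

Local Open Scope classical_set_scope.
Local Open Scope ring_scope.

(** The data are only bounded, so at time 0 only S_0 is controlled uniformly in N; the time integral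
    of S_2 is not, even for the heat flow. This is why l is split off: b starts from zero and its
    forcing has S_0 integrable in time, which makes S_2(b) integrable, while l is treated in the sup
    norm. In two dimensions, passing from S_j to l^1 sums of coefficients loses the logarithm
    [Lam N], and sharp truncations lose logarithms in the sup norm. Both are measured by the single
    quantity D = [dirichlet_bound N], which enters the final bound with power at most six. Splitting
    the time at d costs, up to powers of D, sqrt d before d, and N^-1 d^(-1/4) and N^-2 d^-1 after
    it. All three balance at d = N^(-4/3), with value N^(-2/3); d = N^(-5/4) is close to it and
    makes d and sqrt d integral powers of N^(1/8). The exponent 5/8 exceeds 1/2 by 1/8, which pays
    for D^6. Time integrals are never formed: a decreasing function whose derivative dominates the
    integrand takes their place inside a barrier. *)

Notation drv f x l := (is_derive (x : _) (1 : _) (f : _ -> _) l).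

(** * Derivatives and the maximum principle *)

Section RealDerivatives.
Context {R : realType}.
Implicit Types (f g : R -> R) (x a b c : R).

Lemma drv_eq f x a b : drv f x a -> a = b -> drv f x b.
Proof. by move=> + <-. Qed.

Lemma drv_ext f g x a : (forall s, f s = g s) -> drv f x a -> drv g x a.
Proof. by move=> /funext ->. Qed.

Lemma drv_derive1 f x a : drv f x a -> derive1 f x = a.
Proof. by move=> [_ <-]; rewrite derive1E. Qed.

Lemma drv_derivable f x a : drv f x a -> derivable f x 1.
Proof. by case. Qed.

Lemma drvP f x : derivable f x 1 -> drv f x (derive1 f x).
Proof. by move=> df; apply: DeriveDef => //; rewrite derive1E. Qed.

Lemma drv_cst x c : drv (fun=> c) x 0.
Proof. exact: is_derive_cst. Qed.

Lemma drv_id x : drv (fun s => s) x 1.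
Proof. exact: is_derive_id. Qed.

Lemma drvD f g x a b : drv f x a -> drv g x b ->
  drv (fun s => f s + g s) x (a + b).
Proof. by move=> hf hg; apply: is_deriveD. Qed.

Lemma drvN f x a : drv f x a -> drv (fun s => - f s) x (- a).
Proof. by move=> hf; apply: is_deriveN. Qed.

Lemma drvB f g x a b : drv f x a -> drv g x b ->
  drv (fun s => f s - g s) x (a - b).
Proof. by move=> hf hg; apply: is_deriveB. Qed.

Lemma drvM f g x a b : drv f x a -> drv g x b ->
  drv (fun s => f s * g s) x (a * g x + f x * b).
Proof.
move=> hf hg; apply: drv_eq (is_deriveM hf hg) _.
by rewrite addrC /GRing.scale /= (mulrC a).
Qed.

Lemma drvZ c f x a : drv f x a -> drv (fun s => c * f s) x (c * a).
Proof. by move=> hf; apply: is_deriveZ. Qed.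

Lemma drv_sqr f x a : drv f x a -> drv (fun s => f s ^+ 2) x (2 * f x * a).
Proof.
move=> hf; apply: drv_ext (drv_eq (drvM hf hf) _) => [s|]; first by rewrite expr2.
ring.
Qed.

Lemma drv_comp f g x a b : drv f (g x) a -> drv g x b ->
  drv (fun s => f (g s)) x (a * b).
Proof. by move=> hf hg; apply: is_derive1_comp. Qed.

Lemma drv_sum (I : Type) (r : seq I) (P : pred I) (F : I -> R -> R) (dF : I -> R) x :
  (forall i, P i -> drv (F i) x (dF i)) ->
  drv (fun s => \sum_(i <- r | P i) F i s) x (\sum_(i <- r | P i) dF i).
Proof.
move=> h; elim: r => [|i r IH].
  by rewrite big_nil; apply: drv_ext (drv_cst x 0) => s; rewrite big_nil.
rewrite big_cons; case: ifP => Pi.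
  by apply: drv_ext (drvD (h i Pi) IH) => s; rewrite big_cons Pi.
by apply: drv_ext IH => s; rewrite big_cons Pi.
Qed.

Lemma drv_exp f x a : drv f x a -> drv (fun s => expR (f s)) x (expR (f x) * a).
Proof. by move=> hf; apply: drv_comp hf; exact: is_derive_expR. Qed.

Lemma drv_cos f x a : drv f x a -> drv (fun s => cos (f s)) x (- sin (f x) * a).
Proof. by move=> hf; apply: drv_comp hf; exact: is_derive_cos. Qed.

Lemma drv_sin f x a : drv f x a -> drv (fun s => sin (f s)) x (cos (f x) * a).
Proof. by move=> hf; apply: drv_comp hf; exact: is_derive_sin. Qed.

Lemma drv_ln f x a : 0 < f x -> drv f x a -> drv (fun s => ln (f s)) x (a / f x).
Proof.
by move=> f0 hf; rewrite mulrC; apply: drv_comp hf; exact: is_derive1_ln.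
Qed.

Lemma drv_inv f x a : f x != 0 -> drv f x a ->
  drv (fun s => (f s)^-1) x (- a / f x ^+ 2).
Proof.
move=> f0 hf; apply: drv_eq (is_deriveV f0 hf) _.
by rewrite /GRing.scale /= mulrC mulrN mulNr -exprVn.
Qed.

Lemma drv_sqrt f x a : 0 < f x -> drv f x a ->
  drv (fun s => Num.sqrt (f s)) x (a / (2 * Num.sqrt (f x))).
Proof.
move=> f0 hf; rewrite mulrC; apply: drv_comp hf.
exact: is_derive1_sqrt.
Qed.

Lemma drv_continuous f x a : drv f x a -> {for x, continuous f}.
Proof.
by case=> df _; apply: differentiable_continuous; exact/derivable1_diffP.
Qed.

(** Mean value theorem for f - g, with derivatives only inside the interval: nothing has to be
    integrable. *)
Lemma drv_le f g (df dg : R -> R) a b : a <= b ->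
  {within `[a, b], continuous f} -> {within `[a, b], continuous g} ->
  (forall x, a < x < b -> drv f x (df x)) ->
  (forall x, a < x < b -> drv g x (dg x)) ->
  (forall x, a < x < b -> df x <= dg x) ->
  f b - f a <= g b - g a.
Proof.
rewrite le_eqVlt => /orP[/eqP <-|ab]; first by rewrite !subrr.
move=> cf cg hf hg le_d; rewrite -subr_le0.
have cfg : {within `[a, b], continuous (fun s => f s - g s)}.
  by move=> x; apply: cvgB; [exact: cf | exact: cg].
have hfg x : x \in `]a, b[ -> drv (fun s => f s - g s) x (df x - dg x).
  by rewrite in_itv => xab; apply: drvB; [exact: hf|exact: hg].
have [c] := MVT ab hfg cfg.
rewrite in_itv => cab E.
have -> : f b - f a - (g b - g a) = (f b - g b) - (f a - g a) by ring.
rewrite E; apply: mulr_le0_ge0; first by rewrite subr_le0; apply: le_d; exact: cab.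
by rewrite subr_ge0 ltW.
Qed.

End RealDerivatives.

Section OneVariable.
Context {R : realType}.
Implicit Types (h : R -> R) (x t s e : R).

Lemma derive1_quotient h t (e : R) : derivable h t 1 -> 0 < e ->
  exists2 d : R, 0 < d &
    forall s, s != 0 -> `|s| < d -> `|(h (t + s) - h t) / s - derive1 h t| < e.
Proof.
move=> ht e0; have := ht; rewrite /derivable => /cvg_ex [l hl].
have lE : derive1 h t = l.
  apply/cvg_lim => //; move: hl.
  by under eq_fun do rewrite scaler1.
move/cvgrPdist_lt: hl => /(_ e e0) [d /= d0 hd].
exists d => // s s0 sd; have := hd s; rewrite /= sub0r normrN => /(_ sd s0).
rewrite scaler1 -lE distrC (addrC s t).
by have -> : (h (t + s) - h t) / s = s^-1 *: (h (t + s) - h t) by rewrite mulrC.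
Qed.

(** One-sided, because in the maximum principle the maximum may be attained at the final time. *)
Lemma derive1_max_left h (a t : R) : a < t -> derivable h t 1 ->
  (forall s, a <= s <= t -> h s <= h t) -> 0 <= derive1 h t.
Proof.
move=> at_ ht hmax; rewrite leNgt; apply/negP => h0.
have [|d d0 hd] := derive1_quotient ht (e := - derive1 h t); first by rewrite oppr_gt0.
pose s := - Num.min (d / 2) (t - a).
have m0 : 0 < Num.min (d / 2) (t - a) by rewrite lt_min divr_gt0//= subr_gt0.
have s0 : s < 0 by rewrite oppr_lt0.
have sd : `|s| < d.
  rewrite normrN gtr0_norm//.
  have : Num.min (d / 2) (t - a) <= d / 2 by rewrite ge_min lexx.
  lra.
have := hd s (ltr0_neq0 s0) sd; rewrite ltr_norml => /andP[_].
rewrite ltrBlDr addNr.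
rewrite ltNge => /negP; apply.
rewrite nmulr_lge0 ?invr_lt0// subr_le0; apply: hmax.
rewrite -lerBlDl /s lerNr opprB ge_min lexx orbT /=.
by rewrite gerDl oppr_le0 ltW.
Qed.

Lemma derive1_max_global h x : derivable h x 1 -> (forall s, h s <= h x) ->
  derive1 h x = 0.
Proof.
move=> hx hmax; apply/eqP; rewrite eq_le; apply/andP; split; last first.
  by apply: (@derive1_max_left h (x - 1)) => //; rewrite ltrBlDr ltrDl.
(* The opposite inequality comes from the reflected function. *)
pose k s := h (- s).
have dh : drv h (- - x) (derive1 h x) by rewrite opprK; exact: drvP.
have dk : drv k (- x) (derive1 h x * -1) := drv_comp dh (drvN (drv_id (- x))).
have [dk1 dk2] := dk.
have : 0 <= derive1 k (- x).
  apply: (@derive1_max_left k (- x - 1)) => //; first by rewrite ltrBlDr ltrDl.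
  by move=> s _; rewrite /k opprK.
by rewrite derive1E dk2 mulrN1 oppr_ge0.
Qed.

(** If the second derivative were positive, the first one, zero at [x], would be positive just to
    the right of [x], and the mean value theorem would give a larger value there. *)
Lemma derive2_max_global h x : (forall s, derivable h s 1) ->
  derivable (derive1 h) x 1 -> (forall s, h s <= h x) -> derive1 (derive1 h) x <= 0.
Proof.
move=> dh d2h hmax; rewrite leNgt; apply/negP => h0.
have [d d0 hd] := derive1_quotient d2h h0.
have h'x : derive1 h x = 0 by apply: (@derive1_max_global h x) => //; exact: dh.
have pos s : 0 < s -> s < d -> 0 < derive1 h (x + s).
  move=> s0 sd; have := hd s (lt0r_neq0 s0).
  rewrite gtr0_norm// => /(_ sd); rewrite h'x subr0 ltr_norml => /andP[].
  by rewrite ltrBrDr addNr pmulr_lgt0// invr_gt0.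
have [|||c] := @MVT R h (derive1 h) x (x + d / 2).
- by rewrite ltrDl divr_gt0.
- by move=> y _; apply: drvP; exact: dh.
- by apply: derivable_within_continuous => y _; exact: dh.
rewrite in_itv/= => /andP[xc cd] E.
have := hmax (x + d / 2); rewrite -subr_le0 E leNgt => /negP; apply.
rewrite addrAC subrr add0r mulr_gt0 ?divr_gt0//.
have -> : c = x + (c - x) by rewrite addrC subrK.
by apply: pos; [rewrite subr_gt0 | lra].
Qed.

End OneVariable.

(** * The parabolic maximum principle for periodic functions *)

Section MaximumPrinciple.
Context {R : realType}.
Implicit Types (g : R * R -> R) (F : R -> R * R -> R) (x : R * R).

(** Just the derivatives that enter the gradient and the Laplacian: neither mixed derivatives nor
    continuity has to be checked for the auxiliary functions to which the maximum principle is
    applied. *)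
Definition C2slices g : Prop :=
  [/\ forall x, derivable (fun s : R => g (s, x.2)) x.1 1,
      forall x, derivable (fun s : R => g (x.1, s)) x.2 1,
      forall x, derivable (fun s : R => d1 g (s, x.2)) x.1 1 &
      forall x, derivable (fun s : R => d2 g (x.1, s)) x.2 1].

Lemma C2_slices g : C2 g -> C2slices g.
Proof. by move=> [[_ a b _ _] [_ c _ _ _] [_ _ d _ _]]; split. Qed.

Lemma periodic_int g (m n : int) x : Defs.periodic g ->
  g (x.1 + m%:~R, x.2 + n%:~R) = g x.
Proof.
move=> pg.
have p1 (k : nat) y : g (y.1 + k%:R, y.2) = g y.
  elim: k y => [|k IH] y; first by rewrite addr0; case: y.
  by rewrite -natr1 addrA (pg (y.1 + k%:R, y.2)).1 IH.
have p2 (k : nat) y : g (y.1, y.2 + k%:R) = g y.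
  elim: k y => [|k IH] y; first by rewrite addr0; case: y.
  by rewrite -natr1 addrA (pg (y.1, y.2 + k%:R)).2 IH.
have q1 (k : int) y : g (y.1 + k%:~R, y.2) = g y.
  case: k => k; first exact: p1.
  by rewrite NegzE mulrNz -(p1 k.+1 (y.1 - k.+1%:~R, y.2)) /= subrK; case: y.
have q2 (k : int) y : g (y.1, y.2 + k%:~R) = g y.
  case: k => k; first exact: p2.
  by rewrite NegzE mulrNz -(p2 k.+1 (y.1, y.2 - k.+1%:~R)) /= subrK; case: y.
by rewrite (q2 n (x.1 + m%:~R, x.2)) q1.
Qed.

Lemma periodic_cell g x : Defs.periodic g ->
  exists y, [/\ 0 <= y.1 < 1, 0 <= y.2 < 1 & g y = g x].
Proof.
move=> pg.
exists (x.1 - (Num.floor x.1)%:~R, x.2 - (Num.floor x.2)%:~R); split => /=.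
- by have /andP[a b] := floor_itv x.1; rewrite subr_ge0 a ltrBlDl -intrD1.
- by have /andP[a b] := floor_itv x.2; rewrite subr_ge0 a ltrBlDl -intrD1.
by rewrite -!mulrNz periodic_int.
Qed.

Lemma laplacian_max g x : C2slices g -> (forall y, g y <= g x) ->
  [/\ d1 g x = 0, d2 g x = 0 & laplacian g x <= 0].
Proof.
move=> [g1 g2 g11 g22] gmax; split.
- by apply: (derive1_max_global (g1 x)) => s; case: x gmax => ? ? /=.
- by apply: (derive1_max_global (g2 x)) => s; case: x gmax => ? ? /=.
- rewrite -(addr0 0); apply: lerD.
    apply: (@derive2_max_global R (fun s => g (s, x.2)) x.1) => [s||s].
    + exact: (g1 (s, x.2)).
    + exact: g11.
    + by case: x gmax => ? ? /=.
  apply: (@derive2_max_global R (fun s => g (x.1, s)) x.2) => [s||s].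
  + exact: (g2 (x.1, s)).
  + exact: g22.
  + by case: x gmax => ? ? /=.
Qed.

(* The differential inequality is only required at critical points in space. *)
Lemma parabolic_max_principle F (a T A : R) :
  {within [set p : R * (R * R) | a <= p.1 <= T],
     continuous (fun p : R * (R * R) => F p.1 p.2)} ->
  (forall t, a <= t <= T -> Defs.periodic (F t)) ->
  (forall t x, a < t <= T -> derivable (F ^~ x) t 1) ->
  (forall t, a < t <= T -> C2slices (F t)) ->
  (forall t x, a < t <= T -> d1 (F t) x = 0 -> d2 (F t) x = 0 ->
     dt F t x <= laplacian (F t) x) ->
  (forall x, F a x <= A) ->
  forall t x, a <= t <= T -> F t x <= A.
Proof.
move=> cF pF dF sF hF FA t x atT; rewrite leNgt; apply/negP => AF.
have at_ : a < t.
  case/andP: atT; rewrite le_eqVlt => /orP[/eqP E|//] _.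
  by move: AF; rewrite -E ltNge FA.
(* Subtracting e times the elapsed time removes half of the excess of [F] over [A] at time [t]: the
   tilted function [G] still exceeds [A] there, and the inequality becomes strict. *)
pose e := (F t x - A) / (2 * (t - a)).
have e0 : 0 < e by rewrite divr_gt0 ?subr_gt0// mulr_gt0// subr_gt0.
pose G (p : R * (R * R)) := F p.1 p.2 - e * (p.1 - a).
pose K : set (R * (R * R)) := `[a, T] `*` (`[0, 1] `*` `[0, 1]).
have cK : compact K by apply: compact_setX; [|apply: compact_setX]; exact: segment_compact.
have cG : {within K, continuous G}.
  move=> p; apply: (@cvgB _ R^o).
    apply: (continuous_subspaceW _ cF) => q [] /=.
    by rewrite in_itv.
  apply: (@cvgZr _ R^o).
  apply: cvgB; last exact: cvg_cst.
  apply: continuous_subspaceT => q; exact: cvg_fst.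
have cell01 (u : R * R) : 0 <= u.1 < 1 -> 0 <= u.2 < 1 ->
    (`[0, 1] `*` `[0, 1]) u.
  move=> /andP[a1 b1] /andP[a2 b2].
  by split; rewrite /= in_itv/= ?a1 ?a2 ltW.
have [y [y1 y2 yE]] := periodic_cell x (pF t atT).
have Ky : K (t, y).
  by split; [rewrite /= in_itv | exact: cell01].
have [|p pK pmax] := compact_EVT_max _ cK cG; first by exists (t, y).
case: p pK pmax => s z; rewrite inE => -[/= sI zI] pmax.
rewrite in_itv/= in sI.
have Gt : A < G (s, z).
  have := pmax (t, y); rewrite inE => /(_ Ky); apply: lt_le_trans.
  rewrite /G /= yE.
  have -> : e * (t - a) = (F t x - A) / 2.
    by rewrite /e; field; rewrite subr_eq0 gt_eqF.
  lra.
have as_ : a < s.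
  case/andP: sI; rewrite le_eqVlt => /orP[/eqP E|//] _.
  move: Gt; rewrite /G /= -E subrr mulr0 subr0 ltNge.
  by rewrite FA.
have asT : a < s <= T by rewrite as_; case/andP: sI.
have smax u : F s u <= F s z.
  have [v [v1 v2 vE]] := periodic_cell u (pF s sI).
  have := pmax (s, v); rewrite inE /G /= lerD2r vE; apply.
  by split; [rewrite /= in_itv | exact: cell01].
have [z1 z2 zL] := laplacian_max (sF s asT) smax.
(* At the maximum of [G] the equation makes the time derivative of [F] at most 0, while maximality
   over the times in [a, s] forces it to be at least [e]. *)
have := le_trans (hF s z asT z1 z2) zL.
apply/negP; rewrite -ltNge.
pose H r := F r z - e * (r - a).
have dH : drv H s (dt F s z - e).
  apply: drvB; first by apply: drvP; exact: dF.
  apply: drv_eq (drvZ e (drvB (drv_id s) (drv_cst s a))) _.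
  by rewrite subr0 mulr1.
have [dH1 dH2] := dH.
have : 0 <= derive1 H s.
  apply: (derive1_max_left as_ dH1) => r /andP[ar rs].
  have := pmax (r, z); rewrite inE; apply; split => //=.
  by rewrite in_itv/= ar (le_trans rs)//; case/andP: sI.
rewrite derive1E dH2 subr_ge0; exact: lt_le_trans.
Qed.

End MaximumPrinciple.

(** * Integration on the torus *)

Section RestrictedMeasure.
Context d (T : measurableType d) (R : realType) (mu : {measure set T -> \bar R}).
Variables (D : set T) (mD : measurable D).

(** On [D], the measure [mu] is the sum of its restrictions to [D] and to the complement. The second
    gives [D] no mass, and the first gives the complement none. *)
Lemma ge0_integral_mrestr (f : T -> \bar R) :
  (forall x, 0 <= f x)%E -> measurable_fun [set: T] f ->
  (\int[mrestr mu mD]_x f x = \int[mu]_(x in D) f x)%E.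
Proof.
move=> f0 mf; have mDC : measurable (~` D) by exact: measurableC.
pose m1 : {measure set T -> \bar R} := mrestr mu mD.
pose m2 : {measure set T -> \bar R} := mrestr mu mDC.
have -> : (\int[mu]_(x in D) f x = \int[measure_add m1 m2]_(x in D) f x)%E.
  apply: eq_measure_integral => A mA AD.
  have AE : (m1 A + m2 A)%E = mu A.
    by rewrite /m1 /m2 /= /mrestr (setIidl AD) -setDE (_ : A `\` D = set0) ?measure0 ?adde0// setD_eq0.
  by rewrite -AE -measure_addE.
rewrite ge0_integral_measure_add//; last exact: measurable_funTS.
rewrite [X in (_ = _ + X)%E]null_set_integral ?adde0//; last 2 first.
- exact: measurable_funTS.
- by rewrite /m2 /= /mrestr setICr measure0.
transitivity (\int[mrestr mu mD]_(x in setT `\` ~` D) f x)%E; last by rewrite setTD setCK.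
by apply: ge0_negligible_integral => //; rewrite /= /mrestr setICl measure0.
Qed.

Lemma integral_mrestr (f : T -> \bar R) : measurable_fun [set: T] f ->
  (\int[mrestr mu mD]_x f x = \int[mu]_(x in D) f x)%E.
Proof.
move=> mf.
transitivity (\int[mu]_(x in D) f^\+ x - \int[mu]_(x in D) f^\- x)%E; last first.
  by rewrite -integralE.
rewrite [LHS]integralE !ge0_integral_mrestr//.
- exact: measurable_funeneg.
- exact: measurable_funepos.
Qed.

End RestrictedMeasure.

Section TorusIntegral.
Context {R : realType}.
Local Notation mR := (measurableTypeR R).
Local Notation mu := (@lebesgue_measure R).
Local Notation tm := (@torus_measure R).
Implicit Types (f g : R * R -> R) (x : R * R) (c : R).

(** The preimage of an open half-line is a countable union of rational boxes, which are measurable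
    for the product structure that carries [torus_measure]. *)
Lemma continuous_measurable2 f : continuous f ->
  measurable_fun setT (f : mR * mR -> mR).
Proof.
move=> cf; apply: (measurability _ (RGenOInfty.measurableE R)).
move=> /= _ [_ [c ->]] <-; rewrite setTI.
pose box (q : rat * rat * (rat * rat)) : set (mR * mR) :=
  `]ratr q.1.1, ratr q.1.2[ `*` `]ratr q.2.1, ratr q.2.2[.
pose P q := box q `<=` f @^-1` `]c, +oo[.
have -> : f @^-1` `]c, +oo[ = \bigcup_(q in P) box q.
  apply/seteqP; split => [x /= xc|x [q Pq]]; last exact: Pq.
  have op : nbhs x (f @^-1` `]c, +oo[).
    by apply: cf; apply: open_nbhs_nbhs; split; [exact: interval_open|].
  case: op => -[A B] /= [nA nB] AB.
  have [[e1 /= e10 h1] [e2 /= e20 h2]] :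
     (exists2 e : R, 0 < e & ball x.1 e `<=` A) /\
     (exists2 e : R, 0 < e & ball x.2 e `<=` B).
    by split; [move/nbhs_ballP: nA|move/nbhs_ballP: nB] => -[e e0 h]; exists e.
  have rat2 (y e : R) : 0 < e -> exists p : rat * rat,
      ratr p.1 < y < ratr p.2 /\ `]ratr p.1, ratr p.2[ `<=` ball y e.
    move=> e0.
    have [|p] := @rat_in_itvoo R (y - e) y; first by rewrite ltrBlDr ltrDl.
    have [|q] := @rat_in_itvoo R y (y + e); first by rewrite ltrDl.
    rewrite !in_itv/= => /andP[q1 q2] /andP[p1 p2]; exists (p, q) => /=.
    split; first by rewrite p2 q1.
    move=> z /=; rewrite in_itv/= => /andP[z1 z2].
    by rewrite /ball/= ltr_norml; apply/andP; split; lra.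
  have [p1 [/andP[a1 b1] s1]] := rat2 x.1 _ e10.
  have [p2 [/andP[a2 b2] s2]] := rat2 x.2 _ e20.
  exists (p1, p2).
    by move=> z [/= z1 z2]; apply: AB; split => /=; [exact/h1/s1|exact/h2/s2].
  by split; rewrite /= in_itv/= ?a1 ?b1 ?a2 ?b2.
rewrite bigcup_mkcond; apply: countable_bigcupT_measurable.
  exact: countableP.
move=> q; case: ifP => // _.
by apply: measurableX; exact: measurable_itv.
Qed.

Lemma periodic_bounded f : continuous f -> Defs.periodic f ->
  exists2 M : R, 0 < M & forall x, `|f x| <= M.
Proof.
move=> cf pf.
have cK : compact (`[0, 1] `*` `[0, 1] : set (R * R)).
  by apply: compact_setX; exact: segment_compact.
have [||c _ cmax] := @compact_EVT_max _ R (fun x => `|f x|) _ _ cK.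
- by exists (0, 0); split; rewrite /= in_itv/= lexx ler01.
- apply: continuous_subspaceT => x; apply: continuous_comp; first exact: cf.
  exact: norm_continuous.
exists (`|f c| + 1) => [|x]; first by rewrite ltr_wpDl.
have [y [/andP[a1 b1] /andP[a2 b2] <-]] := periodic_cell x pf.
apply: (le_trans (cmax y _)); last by rewrite lerDl.
by rewrite inE; split; rewrite /= in_itv/= ?a1 ?a2 ltW.
Qed.

Lemma ae_imply (P Q : R * R -> Prop) : (forall x, P x -> Q x) ->
  {ae tm, forall x, P x} -> {ae tm, forall x, Q x}.
Proof.
move=> PQ; apply: filterS => //; exact: (ae_filter_ringOfSetsType tm).
Qed.

Lemma ae_imply2 (P1 P2 Q : R * R -> Prop) : (forall x, P1 x -> P2 x -> Q x) ->
  {ae tm, forall x, P1 x} -> {ae tm, forall x, P2 x} -> {ae tm, forall x, Q x}.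
Proof.
move=> PQ; apply: filterS2 => //; exact: (ae_filter_ringOfSetsType tm).
Qed.

Definition tint f : R := \int[tm]_x f x.

(** The working class of integrands: unlike integrability it is stable under products, and the
    merely bounded [f] belongs to it. *)
Definition essbounded f : Prop :=
  measurable_fun setT (f : mR * mR -> mR) /\
  exists M : R, {ae tm, forall x, `|f x| <= M}.

Lemma essbounded_integrable f : essbounded f ->
  tm.-integrable setT (EFin \o f).
Proof.
move=> [mf [M fM]]; apply/integrableP; split; first exact/measurable_EFinP.
apply: (@le_lt_trans _ _ (\int[tm]_x (`|M|)%:E)%E).
  apply: ae_ge0_le_integral => //.
  - by apply: measurableT_comp => //; exact/measurable_EFinP.
  - by apply: ae_imply fM => x h _; rewrite /= lee_fin (le_trans h)// ler_norm.
by rewrite integral_cst// torus_measureT mule1 ltry.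
Qed.

Lemma essbounded_bounded f M : measurable_fun setT (f : mR * mR -> mR) ->
  (forall x, `|f x| <= M) -> essbounded f.
Proof. by move=> mf fM; split => //; exists M; exact: aeW. Qed.

Lemma essbounded_continuous f : continuous f -> Defs.periodic f -> essbounded f.
Proof.
move=> cf pf; have [M _ fM] := periodic_bounded cf pf.
by apply: (@essbounded_bounded f M) => //; exact: continuous_measurable2.
Qed.

Lemma essbounded_cst c : essbounded (fun=> c).
Proof. by apply: (@essbounded_bounded _ `|c|). Qed.

Lemma essboundedD f g : essbounded f -> essbounded g ->
  essbounded (fun x => f x + g x).
Proof.
move=> [mf [A fA]] [mg [B gB]]; split; first exact: measurable_funD.
exists (A + B); apply: ae_imply2 fA gB => x fA gB.
by rewrite (le_trans (ler_normD _ _))// lerD.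
Qed.

Lemma essboundedM f g : essbounded f -> essbounded g ->
  essbounded (fun x => f x * g x).
Proof.
move=> [mf [A fA]] [mg [B gB]]; split; first exact: measurable_funM.
exists (A * B); apply: ae_imply2 fA gB => x fA gB.
by rewrite normrM ler_pM.
Qed.

Lemma essboundedZ c f : essbounded f -> essbounded (fun x => c * f x).
Proof. exact: (essboundedM (essbounded_cst c)). Qed.

Lemma essboundedN f : essbounded f -> essbounded (fun x => - f x).
Proof.
move=> [mf [A fA]]; split; first exact: measurableT_comp.
by exists A; apply: ae_imply fA => x; rewrite normrN.
Qed.

Lemma essboundedB f g : essbounded f -> essbounded g ->
  essbounded (fun x => f x - g x).
Proof. by move=> hf hg; apply: essboundedD => //; exact: essboundedN. Qed.

Lemma essbounded_sum (I : Type) (r : seq I) (P : pred I) (F : I -> R * R -> R) :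
  (forall i, P i -> essbounded (F i)) ->
  essbounded (fun x => \sum_(i <- r | P i) F i x).
Proof.
move=> h; elim: r => [|i r IH].
  by under eq_fun do rewrite big_nil; exact: essbounded_cst.
have [Pi|Pi] := boolP (P i).
  have -> : (fun x => \sum_(j <- i :: r | P j) F j x) =
            (fun x => F i x + \sum_(j <- r | P j) F j x).
    by apply/funext => x; rewrite big_cons Pi.
  by apply: essboundedD => //; exact: h.
by under eq_fun do rewrite big_cons (negbTE Pi).
Qed.

Lemma eq_tint f g : (forall x, f x = g x) -> tint f = tint g.
Proof. by move=> /funext ->. Qed.

Lemma tint_cst c : tint (fun=> c) = c.
Proof.
by rewrite /tint /Rintegral integral_cst// torus_measureT mule1.
Qed.

Lemma tintD f g : essbounded f -> essbounded g ->
  tint (fun x => f x + g x) = tint f + tint g.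
Proof. by move=> hf hg; apply: RintegralD => //; exact: essbounded_integrable. Qed.

Lemma tintB f g : essbounded f -> essbounded g ->
  tint (fun x => f x - g x) = tint f - tint g.
Proof. by move=> hf hg; apply: RintegralB => //; exact: essbounded_integrable. Qed.

Lemma tintZ c f : essbounded f -> tint (fun x => c * f x) = c * tint f.
Proof. by move=> hf; apply: RintegralZl => //; exact: essbounded_integrable. Qed.

Lemma tintN f : tint (fun x => - f x) = - tint f.
Proof. exact: Rintegral_torusN. Qed.

Lemma tint_sum (I : Type) (r : seq I) (P : pred I) (F : I -> R * R -> R) :
  (forall i, P i -> essbounded (F i)) ->
  tint (fun x => \sum_(i <- r | P i) F i x) = \sum_(i <- r | P i) tint (F i).
Proof.
move=> h; elim: r => [|i r IH].
  by rewrite big_nil -[RHS](tint_cst 0); apply: eq_tint => x; rewrite big_nil.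
rewrite big_cons; case: ifP => Pi.
  rewrite -IH -tintD; [|exact: h|exact: essbounded_sum].
  by apply: eq_tint => x; rewrite big_cons Pi.
by rewrite -IH; apply: eq_tint => x; rewrite big_cons Pi.
Qed.

Lemma tint_ge0 f : (forall x, 0 <= f x) -> 0 <= tint f.
Proof. by move=> f0; apply: Rintegral_ge0. Qed.

Lemma tint_ge0_ae f : essbounded f -> {ae tm, forall x, 0 <= f x} -> 0 <= tint f.
Proof.
move=> hf f0; rewrite (_ : tint f = tint (fun x => `|f x|)); last first.
  rewrite /tint /Rintegral; congr fine; apply: ae_eq_integral => //.
  - by apply/measurable_EFinP; case: hf.
  - by apply/measurable_EFinP; apply: measurableT_comp => //; case: hf.
  by apply: ae_imply f0 => x f0 _; rewrite /= ger0_norm.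
exact: tint_ge0.
Qed.

Lemma le_tint_ae f g : essbounded f -> essbounded g ->
  {ae tm, forall x, f x <= g x} -> tint f <= tint g.
Proof.
move=> hf hg fg; rewrite -subr_ge0 -tintB//; apply: tint_ge0_ae.
  exact: essboundedB.
by apply: ae_imply fg => x; rewrite subr_ge0.
Qed.

Lemma norm_tint_le f g : essbounded f -> essbounded g ->
  {ae tm, forall x, `|f x| <= g x} -> `|tint f| <= tint g.
Proof.
move=> hf hg fg; rewrite ler_norml; apply/andP; split.
  rewrite lerNl -tintN; apply: le_tint_ae => //; first exact: essboundedN.
  by apply: ae_imply fg => x; rewrite ler_norml => /andP[h _]; rewrite lerNl.
apply: le_tint_ae => //.
by apply: ae_imply fg => x; rewrite ler_norml => /andP[].
Qed.

End TorusIntegral.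

(** * Iterated integrals, and integrals of derivatives over a period *)

Section TorusFubini.
Context {R : realType}.
Local Notation mR := (measurableTypeR R).
Local Notation mu := (@lebesgue_measure R).
Local Notation tm := (@torus_measure R).
Implicit Types (f g : R * R -> R) (x : R * R) (c : R).

Lemma continuous_slice1 f (b : R) : continuous f -> continuous (fun a : R => f (a, b)).
Proof.
move=> cf a.
have ca : (fun a : R => (a, b)) r @[r --> a] --> (a, b).
  exact: (cvg_pair cvg_id (cvg_cst b)).
exact: (cvg_comp _ _ ca (cf (a, b))).
Qed.

Lemma continuous_slice2 f (a : R) : continuous f -> continuous (fun b : R => f (a, b)).
Proof.
move=> cf b.
have cb : (fun b : R => (a, b)) r @[r --> b] --> (a, b).
  exact: (cvg_pair (cvg_cst a) cvg_id).
exact: (cvg_comp _ _ cb (cf (a, b))).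
Qed.

(** Closed intervals replace the half-open cell, since the fundamental theorem of calculus is
    applied on them; the added endpoint is a null set. *)
Lemma tint_iterated f (M : R) : continuous f -> (forall x, `|f x| <= M) ->
  (tint f)%:E = (\int[mu]_(a in `[0%R, 1%R]) \int[mu]_(b in `[0%R, 1%R]) (f (a, b))%:E)%E /\
  (tint f)%:E = (\int[mu]_(b in `[0%R, 1%R]) \int[mu]_(a in `[0%R, 1%R]) (f (a, b))%:E)%E.
Proof.
move=> cf fM.
have mf := continuous_measurable2 cf.
have mI : measurable (`[0, 1[%classic : set mR) by exact: measurable_itv.
have mS : measurable (@unit_square R) := measurable_unit_square.
pose F : mR * mR -> \bar R := (EFin \o f) \_ unit_square.
have sq1 : ((mu \x mu)%E (@unit_square R) < +oo)%E.
  rewrite /unit_square product_measure1E //=.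
  by rewrite !lebesgue_measure_itv /= !lte01 !sube0 mule1 ltry.
have iF : (mu \x mu)%E.-integrable setT F.
  apply/integrable_restrict => //; rewrite setTI.
  apply: measurable_bounded_integrable => //.
  - exact: measurable_funTS.
  - by exists M; split; [exact: num_real|move=> B MB x _; rewrite /= (le_trans (fM x))// ltW].
have E : (tint f)%:E = (\int[mu \x mu]_z F z)%E.
  rewrite /tint /Rintegral fineK; last first.
    exact/integrable_fin_num/essbounded_integrable/(essbounded_bounded mf fM).
  rewrite integral_mrestr; last exact/measurable_EFinP.
  by rewrite integral_mkcond.
have sec (h : R -> \bar R) : measurable_fun [set: mR] h ->
    (\int[mu]_(x in `[0%R, 1%R]) h x = \int[mu]_x (h \_ `[0%R, 1%R[) x)%E.
  move=> mh; rewrite -integral_itv_bndo_bndc; last exact: measurable_funTS.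
  by rewrite integral_mkcond.
have FE a b : F (a, b) =
    (if a \in `[0, 1[%classic then ((fun b => (f (a, b))%:E) \_ `[0%R, 1%R[) b else 0%E).
  rewrite /F !patchE /unit_square /=.
  by have [|] := boolP (a \in _) => ha; have [|] := boolP (b \in `[0, 1[%classic) => hb;
    rewrite ?in_setX/= ?ha ?(negbTE ha) ?hb ?(negbTE hb).
have inner1 a : (\int[mu]_(b in `[0%R, 1%R]) (f (a, b))%:E =
    \int[mu]_b ((fun b => (f (a, b))%:E) \_ `[0%R, 1%R[) b)%E.
  apply: sec; apply/measurable_EFinP.
  by apply: continuous_measurable_fun; exact: continuous_slice2.
have inner2 b : (\int[mu]_(a in `[0%R, 1%R]) (f (a, b))%:E =
    \int[mu]_a ((fun a => (f (a, b))%:E) \_ `[0%R, 1%R[) a)%E.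
  apply: sec; apply/measurable_EFinP.
  by apply: continuous_measurable_fun; exact: continuous_slice1.
split.
- pose g a := (\int[mu]_(b in `[0%R, 1%R]) (f (a, b))%:E)%E.
  have gE : fubini_F mu F = g \_ `[0%R, 1%R[.
    apply/funext => a; rewrite /fubini_F patchE /g inner1.
    under eq_integral do rewrite FE.
    by case: ifP => // _; rewrite integral0.
  have mg : measurable_fun (`[0%R, 1%R[ : set mR) g.
    by have := measurable_fubini_F iF; rewrite gE => /(measurable_restrictT g mI).
  by rewrite E -(integral12_prod_meas1 iF) gE -integral_mkcond integral_itv_bndo_bndc.
- pose g b := (\int[mu]_(a in `[0%R, 1%R]) (f (a, b))%:E)%E.
  have gE : fubini_G mu F = g \_ `[0%R, 1%R[.
    apply/funext => b; rewrite /fubini_G patchE /g inner2.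
    under eq_integral do rewrite FE patchE.
    case: ifP => hb; first by apply: eq_integral => a _; rewrite patchE.
    by rewrite -[RHS](integral0 mu setT); apply: eq_integral => a _; case: ifP.
  have mg : measurable_fun (`[0%R, 1%R[ : set mR) g.
    by have := measurable_fubini_G iF; rewrite gE => /(measurable_restrictT g mI).
  by rewrite E -(integral21_prod_meas1 iF) gE -integral_mkcond integral_itv_bndo_bndc.
Qed.

Lemma integral01_derive (h dh : R -> R) : (forall s : R, drv h s (dh s)) ->
  continuous dh -> (\int[mu]_(s in `[0%R, 1%R]) (dh s)%:E = (h 1 - h 0)%:E)%E.
Proof.
move=> hd cd; rewrite (@continuous_FTC2 R dh h)//.
- exact: continuous_subspaceT.
- split.
  + by move=> s _; exact: drv_derivable (hd s).
  + by apply: cvg_at_right_filter; exact: drv_continuous (hd 0).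
  + by apply: cvg_at_left_filter; exact: drv_continuous (hd 1).
- by move=> s _; exact: drv_derive1.
Qed.

Lemma tint_derive1 f g : Defs.periodic f -> continuous g -> Defs.periodic g ->
  (forall x, drv (fun s : R => f (s, x.2)) x.1 (g x)) -> tint g = 0.
Proof.
move=> pf cg pg fg; have [M _ gM] := periodic_bounded cg pg.
apply: EFin_inj; rewrite (tint_iterated cg gM).2.
rewrite -[RHS](integral0 mu `[0%R, 1%R]); apply: eq_integral => b _.
rewrite (@integral01_derive (fun s => f (s, b)) (fun s => g (s, b)) (fun s => fg (s, b)))
  ; last exact: continuous_slice1.
by rewrite /= -(add0r 1) (pf (0, b)).1 subrr.
Qed.

Lemma tint_derive2 f g : Defs.periodic f -> continuous g -> Defs.periodic g ->
  (forall x, drv (fun s : R => f (x.1, s)) x.2 (g x)) -> tint g = 0.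
Proof.
move=> pf cg pg fg; have [M _ gM] := periodic_bounded cg pg.
apply: EFin_inj; rewrite (tint_iterated cg gM).1.
rewrite -[RHS](integral0 mu `[0%R, 1%R]); apply: eq_integral => a _.
rewrite (@integral01_derive (fun s => f (a, s)) (fun s => g (a, s)) (fun s => fg (a, s)))
  ; last exact: continuous_slice2.
by rewrite /= -(add0r 1) (pf (a, 0)).2 subrr.
Qed.

Lemma tint_prod_le (A B : R -> R) (CA CB M1 M2 : R) :
  continuous A -> continuous B ->
  (forall s, `|A s| <= M1) -> (forall s, `|B s| <= M2) ->
  (forall s, 0 <= A s) -> (forall s, 0 <= B s) ->
  (\int[mu]_(s in `[0%R, 1%R]) (A s)%:E <= CA%:E)%E ->
  (\int[mu]_(s in `[0%R, 1%R]) (B s)%:E <= CB%:E)%E ->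
  tint (fun x => A x.1 * B x.2) <= CA * CB.
Proof.
move=> cA cB bA bB A0 B0 hA hB.
have cAB : continuous (fun x : R * R => A x.1 * B x.2).
  move=> x; apply: continuousM.
    by apply: continuous_comp; [exact: cvg_fst|exact: cA].
  by apply: continuous_comp; [exact: cvg_snd|exact: cB].
have bAB x : `|A x.1 * B x.2| <= M1 * M2 by rewrite normrM ler_pM.
have mA : measurable_fun [set: mR] (fun s => (A s)%:E).
  by apply/measurable_EFinP; exact: continuous_measurable_fun.
have mB : measurable_fun [set: mR] (fun s => (B s)%:E).
  by apply/measurable_EFinP; exact: continuous_measurable_fun.
have CB0 : (0 <= CB%:E)%E.
  by apply: le_trans hB; apply: integral_ge0 => s _; rewrite lee_fin.
rewrite -lee_fin (tint_iterated cAB bAB).1 /=.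
have inner a : (\int[mu]_(b in `[0%R, 1%R]) (A a * B b)%:E =
    (A a)%:E * \int[mu]_(b in `[0%R, 1%R]) (B b)%:E)%E.
  rewrite -ge0_integralZl//.
  - exact: measurable_funTS.
  - by move=> b _; rewrite lee_fin.
  - by rewrite lee_fin.
have -> : (\int[mu]_(a in `[0%R, 1%R]) \int[mu]_(b in `[0%R, 1%R]) (A a * B b)%:E =
    \int[mu]_(a in `[0%R, 1%R]) ((A a)%:E * \int[mu]_(b in `[0%R, 1%R]) (B b)%:E))%E.
  by apply: eq_integral => a _; exact: inner.
have B1 : (0 <= \int[mu]_(b in `[0%R, 1%R]) (B b)%:E)%E.
  by apply: integral_ge0 => s _; rewrite lee_fin.
rewrite ge0_integralZr//; last 2 first.
- exact: measurable_funTS.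
- by move=> a _; rewrite lee_fin.
rewrite EFinM; apply: lee_pmul => //.
by apply: integral_ge0 => s _; rewrite lee_fin.
Qed.

(** If [f] exceeded [c] at a point of the cell, it would do so on a small box with that point as
    lower left corner. Such a box stays in the half-open cell and has positive measure. *)
Lemma ae_everywhere f c : continuous f -> Defs.periodic f ->
  {ae tm, forall x, f x <= c} -> forall x, f x <= c.
Proof.
move=> cf pf [N [mN N0 fN]] x0.
have [x [/andP[a1 b1] /andP[a2 b2] <-]] := periodic_cell x0 pf.
rewrite leNgt; apply/negP => cx.
have : nbhs x (f @^-1` `]c, +oo[).
  apply: cf; apply: open_nbhs_nbhs; split; first exact: interval_open.
  by rewrite /= in_itv/= cx.
case=> -[A B] /= [nA nB] AB.
have side (s : R) (S : set R) : 0 <= s -> s < 1 -> nbhs s S ->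
    exists2 e : R, 0 < e & `]s, s + e[ `<=` S `&` `[0, 1[.
  move=> s0 s1 /nbhs_ballP [e /= e0 h]; exists (Num.min e (1 - s)).
    by rewrite lt_min e0 subr_gt0.
  move=> t; rewrite /= in_itv/= => /andP[st].
  rewrite -ltrBlDl lt_min => /andP[t1 t2]; split; last by rewrite in_itv/=; lra.
  by apply: h; rewrite /ball/= ltr_norml; lra.
have [e1 e10 h1] := side _ _ a1 b1 nA.
have [e2 e20 h2] := side _ _ a2 b2 nB.
pose Bx : set (mR * mR) := `]x.1, x.1 + e1[ `*` `]x.2, x.2 + e2[.
have mBx : measurable Bx by apply: measurableX; exact: measurable_itv.
have sub : Bx `<=` N.
  move=> y [/= /h1[y1 y1'] /h2[y2 y2']]; apply: fN => /=.
  apply/negP; rewrite -ltNge.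
  by have := AB y (conj y1 y2); rewrite /= in_itv/= andbT.
have : (tm Bx <= tm N)%E by apply: le_measure => //; rewrite inE.
rewrite N0 /torus_measure /= /mrestr.
have -> : Bx `&` unit_square = Bx.
  by apply: setIidl => y [/= /h1[_ y1'] /h2[_ y2']].
rewrite product_measure1E //=; try exact: measurable_itv.
rewrite !lebesgue_measure_itv /= !lte_fin !ltrDl e10 e20 -!EFinD -EFinM lee_fin.
rewrite !(addrAC _ _ (- _)) !subrr !add0r.
by rewrite leNgt mulr_gt0.
Qed.

Lemma tint_eq0 f : continuous f -> Defs.periodic f -> (forall x, 0 <= f x) ->
  tint f = 0 -> forall x, f x = 0.
Proof.
move=> cf pf f0 If0 x; apply/eqP; rewrite eq_le f0 andbT.
apply: ae_everywhere => //.
have ef := essbounded_continuous cf pf.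
have : (\int[tm]_x `|(f x)%:E| = 0)%E.
  have -> : (\int[tm]_x `|(f x)%:E| = \int[tm]_x (f x)%:E)%E.
    by apply: eq_integral => y _; rewrite gee0_abs ?lee_fin.
  rewrite -[RHS]/(0%:E) -If0 /tint /Rintegral fineK//.
  exact/integrable_fin_num/essbounded_integrable.
move/(ae_eq_integral_abs tm measurableT).
have mf : measurable_fun [set: mR * mR] (fun x => (f x)%:E).
  by apply/measurable_EFinP; case: ef.
move=> /(_ mf); apply: ae_imply => y /= /(_ I) [->] //.
Qed.

End TorusFubini.

(** * Fourier modes and trigonometric polynomials *)

Section Modes.
Context {R : realType}.
Local Notation Re := complex.Re.
Local Notation Im := complex.Im.
Local Notation tm := (@torus_measure R).
Implicit Types (f g : R * R -> R) (x y : R * R) (k m : int * int) (z : R[i]).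

Lemma phase0 x : phase 0 x = 0 :> R.
Proof. by rewrite /phase /= !mul0r addr0 mulr0. Qed.

Lemma phaseD k m x : phase (k + m) x = phase k x + phase m x :> R.
Proof. by rewrite /phase /= !intrD; ring. Qed.

Lemma phaseB k m x : phase (k - m) x = phase k x - phase m x :> R.
Proof. by rewrite phaseD phaseN. Qed.

Lemma phase_sub k x y : phase k (x - y) = phase k x - phase k y :> R.
Proof. by rewrite /phase /=; ring. Qed.

Lemma sin_add_int (a : R) (n : int) :
  sin (a + 2 * pi * n%:~R) = sin a /\ cos (a + 2 * pi * n%:~R) = cos a.
Proof.
have nat_case (b : R) (j : nat) : sin (b + 2 * pi * j%:R) = sin b /\ cos (b + 2 * pi * j%:R) = cos b.
  have -> : 2 * pi * j%:R = (pi *+ 2 : R) *+ j by rewrite -[RHS]mulr_natr -(mulr_natl pi).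
  by split; [rewrite (periodicn (@sinD2pi R)) | rewrite (periodicn (@cosD2pi R))].
case: n => n; first exact: nat_case.
rewrite NegzE mulrNz mulrN.
have [h1 h2] := nat_case (a - 2 * pi * n.+1%:R) n.+1.
by split; rewrite -?h1 -?h2 subrK.
Qed.

Lemma phase_shift1 k x : phase k (x.1 + 1, x.2) = phase k x + 2 * pi * k.1%:~R :> R.
Proof. by rewrite /phase /=; ring. Qed.

Lemma phase_shift2 k x : phase k (x.1, x.2 + 1) = phase k x + 2 * pi * k.2%:~R :> R.
Proof. by rewrite /phase /=; ring. Qed.

Lemma periodic_cos k : Defs.periodic (fun x => cos (phase k x) : R).
Proof.
by move=> x; rewrite phase_shift1 phase_shift2 !(sin_add_int _ _).2.
Qed.

Lemma periodic_sin k : Defs.periodic (fun x => sin (phase k x) : R).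
Proof.
by move=> x; rewrite phase_shift1 phase_shift2 !(sin_add_int _ _).1.
Qed.

Lemma continuous_phase k : continuous (fun x => phase k x : R).
Proof.
move=> x; rewrite /phase; apply: cvgM; first exact: cvg_cst.
by apply: cvgD; apply: cvgM; (exact: cvg_cst || exact: cvg_fst || exact: cvg_snd).
Qed.

Lemma continuous_cos_phase k : continuous (fun x => cos (phase k x) : R).
Proof.
by move=> x; apply: continuous_comp; [exact: continuous_phase|exact: continuous_cos].
Qed.

Lemma continuous_sin_phase k : continuous (fun x => sin (phase k x) : R).
Proof.
by move=> x; apply: continuous_comp; [exact: continuous_phase|exact: continuous_sin].
Qed.

Lemma essbounded_cos k : essbounded (fun x => cos (phase k x) : R).
Proof. by apply: essbounded_continuous; [exact: continuous_cos_phase|exact: periodic_cos]. Qed.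

Lemma essbounded_sin k : essbounded (fun x => sin (phase k x) : R).
Proof. by apply: essbounded_continuous; [exact: continuous_sin_phase|exact: periodic_sin]. Qed.

Definition wave1 k : R := 2 * pi * k.1%:~R.
Definition wave2 k : R := 2 * pi * k.2%:~R.

Lemma drv_phase1 k x : drv (fun s : R => phase k (s, x.2)) x.1 (wave1 k).
Proof.
apply: (@drv_ext R (fun s => wave1 k * s + 2 * pi * (k.2%:~R * x.2))).
  by move=> s; rewrite /phase /wave1 /=; ring.
apply: drv_eq (drvD (drvZ _ (drv_id _)) (drv_cst _ _)) _.
by rewrite mulr1 addr0.
Qed.

Lemma drv_phase2 k x : drv (fun s : R => phase k (x.1, s)) x.2 (wave2 k).
Proof.
apply: (@drv_ext R (fun s => wave2 k * s + 2 * pi * (k.1%:~R * x.1))).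
  by move=> s; rewrite /phase /wave2 /=; ring.
apply: drv_eq (drvD (drvZ _ (drv_id _)) (drv_cst _ _)) _.
by rewrite mulr1 addr0.
Qed.

Lemma wave_neq0 k : k != 0 -> wave1 k != 0 \/ wave2 k != 0.
Proof.
case: k => a b; rewrite /wave1 /wave2 /= => /eqP k0.
have tp : 2 * pi != 0 :> R by rewrite mulf_neq0// lt0r_neq0// pi_gt0.
have [a0|a0] := eqVneq a 0.
  right; rewrite mulf_neq0// intr_eq0; apply/eqP => b0; apply: k0.
  by rewrite a0 b0.
by left; rewrite mulf_neq0// intr_eq0.
Qed.

(** A nonzero frequency has a nonzero component, and in that direction both functions are
    derivatives of periodic functions. *)
Lemma tint_trig_neq0 k : k != 0 ->
  tint (fun x => cos (phase k x) : R) = 0 /\ tint (fun x => sin (phase k x) : R) = 0.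
Proof.
have der1 w x : drv (fun s : R => phase k (s, x.2)) x.1 w -> w != 0 ->
    drv (fun s : R => w^-1 * sin (phase k (s, x.2))) x.1 (cos (phase k x)) /\
    drv (fun s : R => w^-1 * - cos (phase k (s, x.2))) x.1 (sin (phase k x)).
  move=> h w0; case: x h => x1 x2 /= h; split.
    by apply: drv_eq (drvZ _ (drv_sin h)) _; rewrite mulrCA mulVf ?mulr1.
  by apply: drv_eq (drvZ _ (drvN (drv_cos h))) _; rewrite mulNr opprK mulrCA mulVf ?mulr1.
have der2 w x : drv (fun s : R => phase k (x.1, s)) x.2 w -> w != 0 ->
    drv (fun s : R => w^-1 * sin (phase k (x.1, s))) x.2 (cos (phase k x)) /\
    drv (fun s : R => w^-1 * - cos (phase k (x.1, s))) x.2 (sin (phase k x)).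
  move=> h w0; case: x h => x1 x2 /= h; split.
    by apply: drv_eq (drvZ _ (drv_sin h)) _; rewrite mulrCA mulVf ?mulr1.
  by apply: drv_eq (drvZ _ (drvN (drv_cos h))) _; rewrite mulNr opprK mulrCA mulVf ?mulr1.
have pZ f (w : R) : Defs.periodic f -> Defs.periodic (fun x => w * f x).
  by move=> pf x; rewrite (pf x).1 (pf x).2.
have pN f : Defs.periodic f -> Defs.periodic (fun x => - f x).
  by move=> pf x; rewrite (pf x).1 (pf x).2.
have cc := @continuous_cos_phase k; have cs := @continuous_sin_phase k.
have pc := @periodic_cos k; have ps := @periodic_sin k.
case/wave_neq0 => w0; split.
- apply: (@tint_derive1 R _ _ (pZ _ (wave1 k)^-1 ps) cc pc) => x.
  exact: (der1 _ x (drv_phase1 k x) w0).1.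
- apply: (@tint_derive1 R _ _ (pZ _ (wave1 k)^-1 (pN _ pc)) cs ps) => x.
  exact: (der1 _ x (drv_phase1 k x) w0).2.
- apply: (@tint_derive2 R _ _ (pZ _ (wave2 k)^-1 ps) cc pc) => x.
  exact: (der2 _ x (drv_phase2 k x) w0).1.
- apply: (@tint_derive2 R _ _ (pZ _ (wave2 k)^-1 (pN _ pc)) cs ps) => x.
  exact: (der2 _ x (drv_phase2 k x) w0).2.
Qed.

Lemma tint_cos k : tint (fun x => cos (phase k x) : R) = (k == 0)%:R.
Proof.
have [->|k0] := eqVneq k 0; last exact: (tint_trig_neq0 k0).1.
rewrite -[RHS](tint_cst 1); apply: eq_tint => x; by rewrite phase0 cos0.
Qed.

Lemma tint_sin k : tint (fun x => sin (phase k x) : R) = 0.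
Proof.
have [->|k0] := eqVneq k 0; last exact: (tint_trig_neq0 k0).2.
rewrite -[RHS](tint_cst 0); apply: eq_tint => x; by rewrite phase0 sin0.
Qed.

Lemma fourier_modeD k m x : fourier_mode (k + m) x = fourier_mode k x * fourier_mode m x :> R[i].
Proof.
rewrite /fourier_mode phaseD cosD sinD; apply/eqP; rewrite eq_complex /=.
by apply/andP; split; apply/eqP; ring.
Qed.

Lemma fourier_modeN k x : fourier_mode (- k) x = ((fourier_mode k x)^*)%C :> R[i].
Proof. by rewrite /fourier_mode -[- k]/(- k.1, - k.2) phaseN cosN sinN. Qed.

Lemma fourier_mode_sub k x y :
  fourier_mode k (x - y) = fourier_mode k x * ((fourier_mode k y)^*)%C :> R[i].
Proof. by rewrite /fourier_mode phase_sub cosB sinB; simpc; congr (_ +i* _)%C; ring. Qed.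

(** Keeping a complex amplitude for a real function turns differentiation into multiplication of [z]
    by [ci (wave1 k)] or [ci (wave2 k)]. *)
Definition rmode z k x : R := Re (z * fourier_mode k x).

Lemma rmodeE z k x : rmode z k x = Re z * cos (phase k x) - Im z * sin (phase k x).
Proof. by rewrite /rmode; case: z. Qed.

Lemma periodic_rmode z k : Defs.periodic (rmode z k).
Proof.
move=> x; rewrite !rmodeE (periodic_cos k x).1 (periodic_cos k x).2.
by rewrite (periodic_sin k x).1 (periodic_sin k x).2.
Qed.

Lemma continuous_rmode z k : continuous (rmode z k).
Proof.
have -> : rmode z k = (fun x => Re z * cos (phase k x) - Im z * sin (phase k x)).
  by apply/funext => x; exact: rmodeE.
move=> x; apply: cvgB; apply: cvgM; try exact: cvg_cst.
  exact: continuous_cos_phase.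
exact: continuous_sin_phase.
Qed.

Lemma essbounded_rmode z k : essbounded (rmode z k).
Proof. by apply: essbounded_continuous; [exact: continuous_rmode|exact: periodic_rmode]. Qed.

Definition ci (a : R) : R[i] := (0 +i* a)%C.

Lemma drv_rmode1 z k x :
  drv (fun s : R => rmode z k (s, x.2)) x.1 (rmode (ci (wave1 k) * z) k x).
Proof.
apply: (@drv_ext R (fun s => Re z * cos (phase k (s, x.2)) - Im z * sin (phase k (s, x.2)))).
  by move=> s; rewrite rmodeE.
have h := drv_phase1 k x.
apply: drv_eq (drvB (drvZ _ (drv_cos h)) (drvZ _ (drv_sin h))) _.
by rewrite rmodeE; case: z; case: x {h} => x1 x2 a b; simpc => /=; ring.
Qed.

Lemma drv_rmode2 z k x :
  drv (fun s : R => rmode z k (x.1, s)) x.2 (rmode (ci (wave2 k) * z) k x).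
Proof.
apply: (@drv_ext R (fun s => Re z * cos (phase k (x.1, s)) - Im z * sin (phase k (x.1, s)))).
  by move=> s; rewrite rmodeE.
have h := drv_phase2 k x.
apply: drv_eq (drvB (drvZ _ (drv_cos h)) (drvZ _ (drv_sin h))) _.
by rewrite rmodeE; case: z; case: x {h} => x1 x2 a b; simpc => /=; ring.
Qed.

Lemma fourier_coefE f k : fourier_coef f k =
  (tint (fun x => f x * cos (phase k x)) -i* tint (fun x => f x * sin (phase k x)))%C.
Proof. by []. Qed.

Lemma essbounded_mulcos f k : essbounded f -> essbounded (fun x => f x * cos (phase k x)).
Proof. by move=> hf; apply: essboundedM => //; exact: essbounded_cos. Qed.

Lemma essbounded_mulsin f k : essbounded f -> essbounded (fun x => f x * sin (phase k x)).
Proof. by move=> hf; apply: essboundedM => //; exact: essbounded_sin. Qed.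

Lemma eq_fourier_coef f g k : (forall x, f x = g x) -> fourier_coef f k = fourier_coef g k.
Proof. by move=> /funext ->. Qed.

Lemma fourier_coefD f g k : essbounded f -> essbounded g ->
  fourier_coef (fun x => f x + g x) k = fourier_coef f k + fourier_coef g k.
Proof.
move=> hf hg; rewrite !fourier_coefE; simpc; congr (_ +i* _)%C.
  rewrite -tintD; try exact: essbounded_mulcos.
  by apply: eq_tint => x; rewrite mulrDl.
rewrite -opprD -tintD; try exact: essbounded_mulsin.
by congr (- _); apply: eq_tint => x; rewrite mulrDl.
Qed.

Lemma fourier_coef_opp f k : essbounded f ->
  fourier_coef (fun x => - f x) k = - fourier_coef f k.
Proof.
move=> hf; rewrite !fourier_coefE; simpc; congr (_ +i* _)%C.
  by rewrite -tintN; apply: eq_tint => x; rewrite mulNr.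
by rewrite -tintN; apply: eq_tint => x; rewrite mulNr opprK.
Qed.

Lemma fourier_coef0 k : fourier_coef (fun=> 0 : R) k = 0.
Proof.
rewrite fourier_coefE; congr (_ +i* _)%C; rewrite -?tintN -[RHS](tint_cst 0);
  by apply: eq_tint => x; rewrite mul0r ?oppr0.
Qed.

Lemma fourier_coefB f g k : essbounded f -> essbounded g ->
  fourier_coef (fun x => f x - g x) k = fourier_coef f k - fourier_coef g k.
Proof.
move=> hf hg; rewrite fourier_coefD//; last exact: essboundedN.
by rewrite fourier_coef_opp.
Qed.

Lemma fourier_coef_sum (I : Type) (r : seq I) (P : pred I) (F : I -> R * R -> R) k :
  (forall i, P i -> essbounded (F i)) ->
  fourier_coef (fun x => \sum_(i <- r | P i) F i x) k =
  \sum_(i <- r | P i) fourier_coef (F i) k.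
Proof.
move=> h; elim: r => [|i r IH].
  by rewrite big_nil -[RHS](fourier_coef0 k); apply: eq_fourier_coef => x; rewrite big_nil.
rewrite big_cons; case: ifP => Pi.
  rewrite -IH -fourier_coefD; [|exact: h|exact: essbounded_sum].
  by apply: eq_fourier_coef => x; rewrite big_cons Pi.
by rewrite -IH; apply: eq_fourier_coef => x; rewrite big_cons Pi.
Qed.

Ltac ebd := repeat first [exact: essbounded_cos | exact: essbounded_sin
  | apply: essboundedB | apply: essboundedD | apply: essboundedZ].

(** A real mode is half the sum of the modes m and - m with conjugate amplitudes, hence the two
    contributions; both are present when m = k = 0. *)
Lemma fourier_coef_rmode z m k : fourier_coef (rmode z m) k =
  2^-1 * ((m == k)%:R * z + (m == - k)%:R * (z^*)%C).
Proof.
have h2 : (2 : R) != 0 by rewrite pnatr_eq0.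
have eqk : (m == k) = (m - k == 0) by rewrite subr_eq0.
have eqNk : (m == - k) = (m + k == 0) by rewrite addr_eq0.
have E1 : tint (fun x => rmode z m x * cos (phase k x)) =
    2^-1 * (Re z * (m == - k)%:R + Re z * (m == k)%:R).
  transitivity (tint (fun x => 2^-1 * (Re z * cos (phase (m + k) x) + Re z * cos (phase (m - k) x)
     - (Im z * sin (phase (m + k) x) + Im z * sin (phase (m - k) x))))).
    apply: eq_tint => x; rewrite rmodeE phaseB phaseD cosB sinB cosD sinD.
    by field.
  rewrite tintZ; last by ebd.
  rewrite tintB ?tintD ?tintZ ?tint_cos ?tint_sin -?eqk -?eqNk ?mulr0; try ebd.
  by rewrite addr0 subr0.
have E2 : tint (fun x => rmode z m x * sin (phase k x)) =
    2^-1 * (Im z * (m == - k)%:R - Im z * (m == k)%:R).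
  transitivity (tint (fun x => 2^-1 * (Im z * cos (phase (m + k) x) - Im z * cos (phase (m - k) x)
     + (Re z * sin (phase (m + k) x) - Re z * sin (phase (m - k) x))))).
    apply: eq_tint => x; rewrite rmodeE phaseB phaseD cosB sinB cosD sinD.
    by field.
  rewrite tintZ; last by ebd.
  rewrite tintD ?tintB ?tintZ ?tint_cos ?tint_sin -?eqk -?eqNk ?mulr0; try ebd.
  by rewrite subr0 addr0.
rewrite fourier_coefE E1 E2.
have -> : 2^-1 = ((2^-1)%:C)%C :> R[i] by rewrite fmorphV rmorph_nat.
have bC (b : bool) : b%:R = (b%:R%:C)%C :> R[i] by rewrite rmorph_nat.
by rewrite !bC; case: z {E1 E2} => a b /=; simpc; congr (_ +i* _)%C; ring.
Qed.

End Modes.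

(** * Trigonometric polynomials, the projection and Bessel's inequality *)

Section Projection.
Context {R : realType}.
Local Notation Re := complex.Re.
Local Notation Im := complex.Im.
Local Notation tm := (@torus_measure R).
Implicit Types (f g : R * R -> R) (x y : R * R) (k m : int * int) (z : int * int -> R[i]).

Lemma ReD (u v : R[i]) : Re (u + v) = Re u + Re v.
Proof. by case: u v => a b []. Qed.

Lemma ImD (u v : R[i]) : Im (u + v) = Im u + Im v.
Proof. by case: u v => a b []. Qed.

Lemma Re_sum (I : Type) (r : seq I) (P : pred I) (F : I -> R[i]) :
  Re (\sum_(i <- r | P i) F i) = \sum_(i <- r | P i) Re (F i).
Proof. by apply: (big_morph _ ReD). Qed.

Lemma Im_sum (I : Type) (r : seq I) (P : pred I) (F : I -> R[i]) :
  Im (\sum_(i <- r | P i) F i) = \sum_(i <- r | P i) Im (F i).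
Proof. by apply: (big_morph _ ImD). Qed.

Definition box (N : nat) : seq (int * int) :=
  [seq @freq N ij | ij in {: 'I_(2 * N).+1 * 'I_(2 * N).+1}].

Lemma mem_box N k : (k \in box N) = (`|k.1| <= N)%N && (`|k.2| <= N)%N.
Proof.
apply/mapP/idP => [[[i j] _ ->]|].
  by rewrite /freq /=; have := ltn_ord i; have := ltn_ord j; lia.
case: k => a b /= /andP[ha hb].
have ia : (absz (a + N%:Z)%R < (2 * N).+1)%N by lia.
have ib : (absz (b + N%:Z)%R < (2 * N).+1)%N by lia.
exists (Ordinal ia, Ordinal ib); first by rewrite mem_enum.
by rewrite /freq /=; congr (_, _); lia.
Qed.

Lemma box_uniq N : uniq (box N).
Proof.
rewrite map_inj_uniq ?enum_uniq// => -[i j] [i' j'] [] E1 E2.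
by congr (_, _); apply/val_inj => /=; lia.
Qed.

Lemma box_opp N k : (- k \in box N) = (k \in box N).
Proof. by rewrite !mem_box /= !abszN. Qed.

Lemma perm_box_opp N : perm_eq (map -%R (box N)) (box N).
Proof.
apply: uniq_perm; rewrite ?(map_inj_uniq oppr_inj) ?box_uniq//.
move=> k; apply/mapP/idP => [[m hm ->]|hk]; first by rewrite box_opp.
by exists (- k); rewrite ?box_opp ?opprK.
Qed.

Lemma sum_box (V : nmodType) N (F : int * int -> V) :
  \sum_(ij : 'I_(2 * N).+1 * 'I_(2 * N).+1) F (freq ij) = \sum_(k <- box N) F k.
Proof. by rewrite /box big_image. Qed.

Lemma sum_box_opp (V : nmodType) N (F : int * int -> V) :
  \sum_(k <- box N) F (- k) = \sum_(k <- box N) F k.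
Proof. transitivity (\sum_(k <- map -%R (box N)) F k); first by rewrite [RHS]big_map.
exact: perm_big (perm_box_opp N). Qed.

Lemma sum_delta (S : pzRingType) (s : seq (int * int)) m (F : int * int -> S) : uniq s ->
  \sum_(k <- s) (m == k)%:R * F k = (m \in s)%:R * F m.
Proof.
move=> us; have [ms|ms] := boolP (m \in s).
  rewrite (bigD1_seq m)//= eqxx mul1r big1 ?addr0// => k km.
  by rewrite eq_sym (negbTE km) mul0r.
rewrite mul0r big_seq big1// => k ks.
by have -> : (m == k) = false; [apply/eqP => E; move: ms; rewrite E ks | rewrite mul0r].
Qed.

Lemma rmodeD (u v : R[i]) k x : rmode (u + v) k x = rmode u k x + rmode v k x.
Proof. by rewrite !rmodeE; case: u v => a b [c d] /=; ring. Qed.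

Lemma rmodeN (u : R[i]) k x : rmode (- u) k x = - rmode u k x.
Proof. by rewrite !rmodeE; case: u => a b /=; ring. Qed.

Lemma rmodeB (u v : R[i]) k x : rmode (u - v) k x = rmode u k x - rmode v k x.
Proof. by rewrite rmodeD rmodeN. Qed.

Lemma rmode0 k x : rmode (0 : R[i]) k x = 0.
Proof. by rewrite rmodeE /= !mul0r subr0. Qed.

Lemma rmodeZ (c : R) (u : R[i]) k x : rmode (c%:C%C * u) k x = c * rmode u k x.
Proof. by rewrite !rmodeE; case: u => a b /=; ring. Qed.

Lemma rmode_sum (I : Type) (r : seq I) (P : pred I) (F : I -> R[i]) k x :
  rmode (\sum_(i <- r | P i) F i) k x = \sum_(i <- r | P i) rmode (F i) k x.
Proof.
elim: r => [|i r IH]; first by rewrite !big_nil rmode0.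
by rewrite !big_cons; case: ifP => _; rewrite ?rmodeD IH.
Qed.

Lemma rmode_conj (u : R[i]) k x : rmode ((u^*)%C) (- k) x = rmode u k x.
Proof.
by rewrite !rmodeE -[- k]/(- k.1, - k.2) phaseN cosN sinN; case: u => a b /=; ring.
Qed.

Definition tpoly (s : seq (int * int)) z x : R := \sum_(k <- s) rmode (z k) k x.

Lemma fourier_proj_tpoly N f x :
  fourier_proj N f x = tpoly (box N) (fourier_coef f) x.
Proof.
rewrite /fourier_proj /fourier_proj_complex /tpoly.
rewrite (sum_box N (fun k => fourier_coef f k * fourier_mode k x)).
by rewrite Re_sum.
Qed.

Lemma eq_tpoly s z z' x : (forall k, k \in s -> z k = z' k) -> tpoly s z x = tpoly s z' x.
Proof. by move=> h; rewrite /tpoly big_seq [RHS]big_seq; apply: eq_bigr => k /h ->. Qed.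

Lemma periodic_tpoly s z : Defs.periodic (tpoly s z).
Proof.
by move=> x; split; apply: eq_bigr => k _; case: (periodic_rmode (z k) k x).
Qed.

Lemma continuous_tpoly s z : continuous (tpoly s z).
Proof.
elim: s => [|k s IH] x.
  have -> : tpoly [::] z = fun=> 0 by apply/funext => y; rewrite /tpoly big_nil.
  exact: cvg_cst.
have -> : tpoly (k :: s) z = (fun y => rmode (z k) k y + tpoly s z y).
  by apply/funext => y; rewrite /tpoly big_cons.
by apply: cvgD; [exact: continuous_rmode | exact: IH].
Qed.

Lemma essbounded_tpoly s z : essbounded (tpoly s z).
Proof. by apply: essbounded_continuous; [exact: continuous_tpoly|exact: periodic_tpoly]. Qed.

Lemma drv_tpoly1 s z x : drv (fun t : R => tpoly s z (t, x.2)) x.1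
  (tpoly s (fun k => ci (wave1 k) * z k) x).
Proof. by apply: drv_sum => k _; exact: drv_rmode1. Qed.

Lemma drv_tpoly2 s z x : drv (fun t : R => tpoly s z (x.1, t)) x.2
  (tpoly s (fun k => ci (wave2 k) * z k) x).
Proof. by apply: drv_sum => k _; exact: drv_rmode2. Qed.

Lemma d1_tpoly s z : d1 (tpoly s z) = tpoly s (fun k => ci (wave1 k) * z k).
Proof. by apply/funext => x; apply: drv_derive1; exact: drv_tpoly1. Qed.

Lemma d2_tpoly s z : d2 (tpoly s z) = tpoly s (fun k => ci (wave2 k) * z k).
Proof. by apply/funext => x; apply: drv_derive1; exact: drv_tpoly2. Qed.

Lemma C1_tpoly s z : C1 (tpoly s z).
Proof.
split; first exact: continuous_tpoly.
- by move=> x; exact: drv_derivable (drv_tpoly1 s z x).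
- by move=> x; exact: drv_derivable (drv_tpoly2 s z x).
- by rewrite d1_tpoly; exact: continuous_tpoly.
- by rewrite d2_tpoly; exact: continuous_tpoly.
Qed.

Lemma C2_tpoly s z : C2 (tpoly s z).
Proof. by split; rewrite ?d1_tpoly ?d2_tpoly; exact: C1_tpoly. Qed.

Definition lam k : R := wave1 k ^+ 2 + wave2 k ^+ 2.

Lemma laplacian_tpoly s z x :
  laplacian (tpoly s z) x = tpoly s (fun k => (- lam k)%:C%C * z k) x.
Proof.
rewrite /laplacian !(d1_tpoly, d2_tpoly) /tpoly -big_split.
by apply: eq_bigr => k _ /=; rewrite !rmodeE /lam /=; case: (z k) => a b /=; ring.
Qed.

Lemma fourier_coef_sym f k : fourier_coef f (- k) = ((fourier_coef f k)^*)%C.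
Proof. exact: fourier_coefN. Qed.

(** Lets a product of real polynomials be expanded mode by mode over the complex numbers, as in
    [advection_tpoly]. *)
Lemma tpoly_real N z x : (forall k, z (- k) = ((z k)^*)%C) ->
  \sum_(k <- box N) z k * fourier_mode k x = ((tpoly (box N) z x)%:C)%C.
Proof.
move=> zs; set S := \sum_(k <- _) _.
have SJ : (S^*)%C = S.
  rewrite /S rmorph_sum -[RHS]sum_box_opp; apply: eq_bigr => k _.
  by rewrite zs fourier_modeN rmorphM.
have -> : tpoly (box N) z x = Re S.
  by rewrite /S Re_sum.
by case: S SJ => a b /= [] /eqP; rewrite eqNr => /eqP ->.
Qed.

Lemma fourier_proj_rmode N (u : R[i]) m x :
  fourier_proj N (rmode u m) x = (m \in box N)%:R * rmode u m x.
Proof.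
rewrite fourier_proj_tpoly /tpoly.
have E k : rmode (fourier_coef (rmode u m) k) k x =
    2^-1 * ((m == k)%:R * rmode u k x + (- m == k)%:R * rmode (u^*)%C k x).
  rewrite fourier_coef_rmode (_ : 2^-1 = ((2^-1)%:C)%C :> R[i]) ?fmorphV ?rmorph_nat//.
  rewrite -(rmorph_nat (real_complex R) 2) -fmorphV rmodeZ rmodeD.
  rewrite -!(rmorph_nat (real_complex R)) !rmodeZ.
  by rewrite (_ : (m == - k) = (- m == k)) // eqr_oppLR.
under eq_bigr => k _ do rewrite E.
rewrite -mulr_sumr big_split /= !sum_delta ?box_uniq// box_opp rmode_conj.
by field.
Qed.

Lemma fourier_coef_tpoly N z k : (forall k, z (- k) = ((z k)^*)%C) ->
  fourier_coef (tpoly (box N) z) k = (k \in box N)%:R * z k.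
Proof.
move=> zs; rewrite fourier_coef_sum; last by move=> *; exact: essbounded_rmode.
under eq_bigr => m _ do rewrite fourier_coef_rmode (eq_sym m) (eq_sym m (- k)).
rewrite -mulr_sumr big_split /= !sum_delta ?box_uniq// box_opp zs conjcK.
by field.
Qed.

Lemma fourier_coef_proj N f k :
  fourier_coef (fourier_proj N f) k = (k \in box N)%:R * fourier_coef f k.
Proof.
rewrite (_ : fourier_proj N f = tpoly (box N) (fourier_coef f)).
  by apply: fourier_coef_tpoly => m; exact: fourier_coef_sym.
by apply/funext => x; exact: fourier_proj_tpoly.
Qed.

Lemma fourier_proj_sum N (I : Type) (r : seq I) (P : pred I) (F : I -> R * R -> R) x :
  (forall i, P i -> essbounded (F i)) ->
  fourier_proj N (fun y => \sum_(i <- r | P i) F i y) x =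
  \sum_(i <- r | P i) fourier_proj N (F i) x.
Proof.
move=> h; rewrite fourier_proj_tpoly /tpoly.
under eq_bigr do rewrite fourier_coef_sum// rmode_sum.
by rewrite exchange_big; apply: eq_bigr => i _; rewrite fourier_proj_tpoly.
Qed.

Definition nsq (u : R[i]) : R := Re u ^+ 2 + Im u ^+ 2.

Lemma tint_mul_rmode f (u : R[i]) k : essbounded f ->
  tint (fun x => f x * rmode u k x) =
  Re u * Re (fourier_coef f k) + Im u * Im (fourier_coef f k).
Proof.
move=> hf; rewrite fourier_coefE /= mulrN.
rewrite -tintZ; last exact: essbounded_mulcos.
rewrite -tintZ; last exact: essbounded_mulsin.
rewrite -tintB; last 2 first.
- by apply: essboundedZ; exact: essbounded_mulcos.
- by apply: essboundedZ; exact: essbounded_mulsin.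
by apply: eq_tint => x; rewrite rmodeE; ring.
Qed.

Lemma tint_mul_tpoly f s z : essbounded f ->
  tint (fun x => f x * tpoly s z x) =
  \sum_(k <- s) (Re (z k) * Re (fourier_coef f k) + Im (z k) * Im (fourier_coef f k)).
Proof.
move=> hf.
under eq_tint do rewrite mulr_sumr.
rewrite tint_sum; last by move=> k _; apply: essboundedM => //; exact: essbounded_rmode.
by apply: eq_bigr => k _; exact: tint_mul_rmode.
Qed.

(** Expand the integral of the square of f - P: the cross integral and the integral of P^2 both
    equal the sum of the squared coefficients. *)
Lemma bessel N f M : essbounded f -> {ae tm, forall x, `|f x| <= M} ->
  \sum_(k <- box N) nsq (fourier_coef f k) <= M ^+ 2.
Proof.
move=> hf fM; pose P := tpoly (box N) (fourier_coef f).
have hP : essbounded P by exact: essbounded_tpoly.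
have E1 : tint (fun x => f x * P x) = \sum_(k <- box N) nsq (fourier_coef f k).
  by rewrite tint_mul_tpoly//; apply: eq_bigr => k _; rewrite /nsq !expr2.
have E2 : tint (fun x => P x * P x) = \sum_(k <- box N) nsq (fourier_coef f k).
  rewrite tint_mul_tpoly// big_seq [RHS]big_seq; apply: eq_bigr => k kb.
  rewrite fourier_coef_tpoly; last by move=> m; exact: fourier_coef_sym.
  by rewrite kb mul1r /nsq !expr2.
have h0 : 0 <= tint (fun x => (f x - P x) ^+ 2) by apply: tint_ge0 => x; exact: sqr_ge0.
have E3 : tint (fun x => (f x - P x) ^+ 2) =
    tint (fun x => f x * f x) - \sum_(k <- box N) nsq (fourier_coef f k).
  transitivity (tint (fun x => (f x * f x - 2 * (f x * P x)) + P x * P x)).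
    by apply: eq_tint => x; ring.
  have hfP : essbounded (fun x => 2 * (f x * P x)) by apply: essboundedZ; exact: essboundedM.
  have hff : essbounded (fun x => f x * f x) by exact: essboundedM.
  rewrite tintD ?tintB ?tintZ ?E1 ?E2//; first by ring.
  - exact: essboundedM.
  - exact: essboundedB.
  - exact: essboundedM.
have : tint (fun x => f x * f x) <= M ^+ 2.
  rewrite -[leRHS]tint_cst; apply: le_tint_ae.
  - exact: essboundedM.
  - exact: essbounded_cst.
  apply: ae_imply fM => x fM; rewrite -expr2 -real_normK ?num_real//.
  by rewrite ler_sqr ?nnegrE// (le_trans _ fM).
rewrite E3 in h0; lra.
Qed.

End Projection.

(** * Green's formula and the inverse Laplacian *)

Section Green.
Context {R : realType}.
Local Notation Re := complex.Re.
Local Notation Im := complex.Im.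
Implicit Types (f g h : R * R -> R) (x y : R * R) (k m : int * int) (z : int * int -> R[i]).

Lemma C1_drv1 f x : C1 f -> drv (fun s : R => f (s, x.2)) x.1 (d1 f x).
Proof. by move=> [_ h _ _ _]; apply: drvP. Qed.

Lemma C1_drv2 f x : C1 f -> drv (fun s : R => f (x.1, s)) x.2 (d2 f x).
Proof. by move=> [_ _ h _ _]; apply: drvP. Qed.

Lemma d1E f x : d1 f x = derive1 (fun s : R => f (s, x.2)) x.1.
Proof. by []. Qed.

Lemma d2E f x : d2 f x = derive1 (fun s : R => f (x.1, s)) x.2.
Proof. by []. Qed.

Opaque tint d1 d2.

Lemma periodic_d1 f : Defs.periodic f -> C1 f -> Defs.periodic (d1 f).
Proof.
move=> pf cf [a b]; split => /=; rewrite [LHS](d1E, d2E); apply: drv_derive1; rewrite /=.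
- have h := C1_drv1 (a, b) cf.
  apply: (@drv_ext R (fun s => f (s - 1, b))).
    by move=> s; rewrite -[RHS](pf (s, b)).1 /= -(pf (s - 1, b)).1 subrK (pf (s, b)).1.
  have h1 : drv (fun s : R => s - 1) (a + 1) (1 - 0).
    exact: (drvB (drv_id _) (drv_cst _ _)).
  have h2 : drv (fun s : R => f (s, b)) (a + 1 - 1) (d1 f (a, b)) by rewrite addrK.
  have h3 : drv (fun s : R => f (s - 1, b)) (a + 1) (d1 f (a, b) * (1 - 0)) :=
    @drv_comp R (fun s => f (s, b)) (fun s => s - 1) _ _ _ h2 h1.
  by rewrite subr0 mulr1 in h3.
- apply: (@drv_ext R (fun s => f (s, b))); last exact: (C1_drv1 (a, b) cf).
  by move=> s; rewrite (pf (s, b)).2.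
Qed.

Lemma periodic_d2 f : Defs.periodic f -> C1 f -> Defs.periodic (d2 f).
Proof.
move=> pf cf [a b]; split => /=; rewrite [LHS](d1E, d2E); apply: drv_derive1; rewrite /=.
- apply: (@drv_ext R (fun s => f (a, s))); last exact: (C1_drv2 (a, b) cf).
  by move=> s; rewrite (pf (a, s)).1.
- have h := C1_drv2 (a, b) cf.
  apply: (@drv_ext R (fun s => f (a, s - 1))).
    by move=> s; rewrite -(pf (a, s - 1)).2 subrK.
  have h1 : drv (fun s : R => s - 1) (b + 1) (1 - 0).
    exact: (drvB (drv_id _) (drv_cst _ _)).
  have h2 : drv (fun s : R => f (a, s)) (b + 1 - 1) (d2 f (a, b)) by rewrite addrK.
  have h3 : drv (fun s : R => f (a, s - 1)) (b + 1) (d2 f (a, b) * (1 - 0)) :=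
    @drv_comp R (fun s => f (a, s)) (fun s => s - 1) _ _ _ h2 h1.
  by rewrite subr0 mulr1 in h3.
Qed.

Lemma periodicM f g : Defs.periodic f -> Defs.periodic g -> Defs.periodic (fun x => f x * g x).
Proof. by move=> pf pg x; rewrite !(pf x).1 !(pf x).2 !(pg x).1 !(pg x).2. Qed.

Lemma periodicB f g : Defs.periodic f -> Defs.periodic g -> Defs.periodic (fun x => f x - g x).
Proof. by move=> pf pg x; rewrite !(pf x).1 !(pf x).2 !(pg x).1 !(pg x).2. Qed.

Lemma periodicD f g : Defs.periodic f -> Defs.periodic g -> Defs.periodic (fun x => f x + g x).
Proof. by move=> pf pg x; rewrite !(pf x).1 !(pf x).2 !(pg x).1 !(pg x).2. Qed.

Lemma green1 f g : Defs.periodic f -> Defs.periodic g -> C2 f -> C2 g ->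
  tint (fun x => d1 (d1 f) x * g x) = - tint (fun x => d1 f x * d1 g x).
Proof.
move=> pf pg [cf cf1 _] [cg cg1 _].
have p1 := periodic_d1 pf cf; have p11 := periodic_d1 p1 cf1.
have q1 := periodic_d1 pg cg.
have [c0 _ _ _ _] := cf; have [c1 _ _ c11 _] := cf1.
have [e0 _ _ e1 _] := cg.
have cA : continuous (fun x => d1 (d1 f) x * g x) by move=> x; apply: cvgM; [exact: c11|exact: e0].
have cB : continuous (fun x => d1 f x * d1 g x) by move=> x; apply: cvgM; [exact: c1|exact: e1].
have pA := periodicM p11 pg; have pB := periodicM p1 q1.
apply/eqP; rewrite -addr_eq0 -tintD; try exact: essbounded_continuous.
apply/eqP; apply: (tint_derive1 (periodicM p1 pg)).
- by move=> x; apply: cvgD; [exact: cA|exact: cB].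
- exact: periodicD.
by case=> a b; exact: (drvM (C1_drv1 (a, b) cf1) (C1_drv1 (a, b) cg)).
Qed.

Lemma green2 f g : Defs.periodic f -> Defs.periodic g -> C2 f -> C2 g ->
  tint (fun x => d2 (d2 f) x * g x) = - tint (fun x => d2 f x * d2 g x).
Proof.
move=> pf pg [cf _ cf2] [cg _ cg2].
have p2 := periodic_d2 pf cf; have p22 := periodic_d2 p2 cf2.
have q2 := periodic_d2 pg cg.
have [c0 _ _ _ _] := cf; have [c2 _ _ _ c22] := cf2.
have [e0 _ _ _ e2] := cg.
have cA : continuous (fun x => d2 (d2 f) x * g x) by move=> x; apply: cvgM; [exact: c22|exact: e0].
have cB : continuous (fun x => d2 f x * d2 g x) by move=> x; apply: cvgM; [exact: c2|exact: e2].
have pA := periodicM p22 pg; have pB := periodicM p2 q2.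
apply/eqP; rewrite -addr_eq0 -tintD; try exact: essbounded_continuous.
apply/eqP; apply: (tint_derive2 (periodicM p2 pg)).
- by move=> x; apply: cvgD; [exact: cA|exact: cB].
- exact: periodicD.
by case=> a b; exact: (drvM (C1_drv2 (a, b) cf2) (C1_drv2 (a, b) cg)).
Qed.

Lemma essbounded_d11 f : Defs.periodic f -> C2 f -> essbounded (d1 (d1 f)).
Proof.
move=> pf [cf cf1 _]; apply: essbounded_continuous; first by case: cf1.
by apply: periodic_d1 => //; exact: periodic_d1.
Qed.

Lemma essbounded_d22 f : Defs.periodic f -> C2 f -> essbounded (d2 (d2 f)).
Proof.
move=> pf [cf _ cf2]; apply: essbounded_continuous; first by case: cf2.
by apply: periodic_d2 => //; exact: periodic_d2.
Qed.

Lemma essbounded_laplacian f : Defs.periodic f -> C2 f -> essbounded (laplacian f).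
Proof.
by move=> pf cf; apply: essboundedD; [exact: essbounded_d11|exact: essbounded_d22].
Qed.

Lemma essbounded_C2 f : Defs.periodic f -> C2 f -> essbounded f.
Proof. by move=> pf [[cf _ _ _ _] _ _]; exact: essbounded_continuous. Qed.

Lemma green f g : Defs.periodic f -> Defs.periodic g -> C2 f -> C2 g ->
  tint (fun x => laplacian f x * g x) =
  - (tint (fun x => d1 f x * d1 g x) + tint (fun x => d2 f x * d2 g x)).
Proof.
move=> pf pg cf cg; have eg := essbounded_C2 pg cg.
have G1 := green1 pf pg cf cg; have G2 := green2 pf pg cf cg.
transitivity (tint (fun x => d1 (d1 f) x * g x) + tint (fun x => d2 (d2 f) x * g x)).
  have e1 := essboundedM (essbounded_d11 pf cf) eg.
  have e2 := essboundedM (essbounded_d22 pf cf) eg.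
  rewrite -(tintD e1 e2); apply: eq_tint => x; exact: mulrDl.
by rewrite opprD; congr (_ + _); [exact: G1|exact: G2].
Qed.

Lemma laplacian_sym f g : Defs.periodic f -> Defs.periodic g -> C2 f -> C2 g ->
  tint (fun x => laplacian f x * g x) = tint (fun x => f x * laplacian g x).
Proof.
move=> pf pg cf cg; transitivity (tint (fun x => laplacian g x * f x)); last first.
  by apply: eq_tint => x; rewrite mulrC.
apply: (etrans (green pf pg cf cg)); apply: esym; apply: (etrans (green pg pf cg cf)).
have E1 : tint (fun x => d1 g x * d1 f x) = tint (fun x => d1 f x * d1 g x) :=
  eq_tint (fun x => mulrC _ _).
have E2 : tint (fun x => d2 g x * d2 f x) = tint (fun x => d2 f x * d2 g x) :=
  eq_tint (fun x => mulrC _ _).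
exact: (congr1 -%R (congr2 +%R E1 E2)).
Qed.

Lemma fourier_coef_laplacian f k : Defs.periodic f -> C2 f ->
  fourier_coef (laplacian f) k = (- lam k)%:C%C * fourier_coef f k.
Proof.
move=> pf cf.
have key (u : R[i]) : tint (fun x => laplacian f x * rmode u k x) =
    - lam k * tint (fun x => f x * rmode u k x).
  have gE : rmode u k = tpoly [:: k] (fun=> u).
    by apply/funext => x; rewrite /tpoly big_seq1.
  rewrite gE (laplacian_sym pf (periodic_tpoly _ _) cf (C2_tpoly _ _)).
  rewrite -tintZ; last by apply: essboundedM; [exact: essbounded_C2|exact: essbounded_tpoly].
  apply: eq_tint => x; rewrite laplacian_tpoly /tpoly !big_seq1 rmodeZ.
  by rewrite mulrCA.
(* Testing with u = 1 and u = i isolates the real and the imaginary part of the coefficient. *)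
have c1 := key 1; have c2 := key 'i%C.
have e1 := essbounded_C2 pf cf; have e2 := essbounded_laplacian pf cf.
rewrite (tint_mul_rmode _ _ e1) (tint_mul_rmode _ _ e2) in c1.
rewrite (tint_mul_rmode _ _ e1) (tint_mul_rmode _ _ e2) in c2.
move: (fourier_coef (laplacian f) k) (fourier_coef f k) c1 c2 => [a b] [c e] /=.
by rewrite !(mul1r, mul0r, addr0, add0r) => -> ->; simpc.
Qed.

Lemma C1B f g : C1 f -> C1 g -> C1 (fun x => f x - g x) /\
  (d1 (fun x => f x - g x) = (fun x => d1 f x - d1 g x)) /\
  (d2 (fun x => f x - g x) = (fun x => d2 f x - d2 g x)).
Proof.
move=> cf cg.
have E1 : d1 (fun x => f x - g x) = (fun x => d1 f x - d1 g x).
  by apply/funext => x; rewrite [LHS]d1E; exact: (drv_derive1 (drvB (C1_drv1 x cf) (C1_drv1 x cg))).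
have E2 : d2 (fun x => f x - g x) = (fun x => d2 f x - d2 g x).
  by apply/funext => x; rewrite [LHS]d2E; exact: (drv_derive1 (drvB (C1_drv2 x cf) (C1_drv2 x cg))).
have [f0 _ _ f1 f2] := cf; have [g0 _ _ g1 g2] := cg.
split; last by split; [exact: E1|exact: E2].
split.
- by move=> x; apply: cvgB; [exact: f0|exact: g0].
- by move=> x; apply: drv_derivable (drvB (C1_drv1 x cf) (C1_drv1 x cg)).
- by move=> x; apply: drv_derivable (drvB (C1_drv2 x cf) (C1_drv2 x cg)).
- by rewrite E1 => x; apply: cvgB; [exact: f1|exact: g1].
- by rewrite E2 => x; apply: cvgB; [exact: f2|exact: g2].
Qed.

Lemma C2B f g : C2 f -> C2 g -> C2 (fun x => f x - g x) /\
  (forall x, laplacian (fun x => f x - g x) x = laplacian f x - laplacian g x).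
Proof.
move=> [cf cf1 cf2] [cg cg1 cg2].
have [c [E1 E2]] := C1B cf cg.
have [c1 [E11 E12]] := C1B cf1 cg1.
have [c2 [E21 E22]] := C1B cf2 cg2.
split; first by split; [exact: c|rewrite E1; exact: c1|rewrite E2; exact: c2].
by move=> x; rewrite /laplacian E1 E2 E11 E22 opprD addrACA.
Qed.

(** By Green's formula the gradient has zero mean square, so it vanishes, and a constant of mean
    zero is zero. This is the uniqueness that determines [inv_laplacian]. *)
Lemma harmonic_mean_zero h : Defs.periodic h -> C2 h -> tint h = 0 ->
  (forall x, laplacian h x = 0) -> forall x, h x = 0.
Proof.
move=> ph ch h0 lh.
have [c _ _] := ch; have p1 := periodic_d1 ph c; have p2 := periodic_d2 ph c.
have [c0 _ _ c1 c2] := c.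
have G := green ph ph ch ch.
have G0 : tint (fun x => laplacian h x * h x) = 0.
  by rewrite -[RHS](tint_cst 0); apply: eq_tint => x; rewrite lh mul0r.
have sq0 (g : R * R -> R) : 0 <= tint (fun x => g x * g x).
  by apply: tint_ge0 => x; rewrite -expr2 sqr_ge0.
have [z1 z2] : tint (fun x => d1 h x * d1 h x) = 0 /\ tint (fun x => d2 h x * d2 h x) = 0.
  rewrite G0 in G; have := sq0 (d1 h); have := sq0 (d2 h); move: G.
  move: (tint (fun x => d1 h x * d1 h x)) (tint (fun x => d2 h x * d2 h x)) => A B G a1 a2.
  by split; lra.
have e1 x : d1 h x = 0.
  apply/eqP; rewrite -sqrf_eq0 expr2; apply/eqP; move: x.
  apply: (tint_eq0 _ (periodicM p1 p1) _ z1).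
  - by move=> x; apply: cvgM; exact: c1.
  - by move=> x; rewrite -expr2 sqr_ge0.
have e2 x : d2 h x = 0.
  apply/eqP; rewrite -sqrf_eq0 expr2; apply/eqP; move: x.
  apply: (tint_eq0 _ (periodicM p2 p2) _ z2).
  - by move=> x; apply: cvgM; exact: c2.
  - by move=> x; rewrite -expr2 sqr_ge0.
have hc x : h x = h (0, 0).
  case: x => a b; transitivity (h (0, b)).
    by apply: (@is_derive_0_is_cst R (fun s => h (s, b))) => s; have := C1_drv1 (s, b) c; rewrite e1.
  by apply: (@is_derive_0_is_cst R (fun s => h (0, s))) => s; have := C1_drv2 (0, s) c; rewrite e2.
move=> x; rewrite hc -[RHS]h0 -[LHS]tint_cst.
by apply: eq_tint => y; exact: (esym (hc y)).
Qed.

Lemma lam0 : lam 0 = 0 :> R.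
Proof. by rewrite /lam /wave1 /wave2 /= mulr0 expr0n addr0. Qed.

Lemma lam_neq0 k : k != 0 -> lam k != 0 :> R.
Proof.
rewrite /lam => /(@wave_neq0 R)[] w0.
  by rewrite gt_eqF// ltr_pwDl ?sqr_ge0// exprn_even_gt0.
by rewrite gt_eqF// ltr_wpDl ?sqr_ge0// exprn_even_gt0.
Qed.

Lemma tint_tpoly s z : z 0 = 0 -> tint (tpoly s z) = 0.
Proof.
move=> z0; rewrite tint_sum; last by move=> *; exact: essbounded_rmode.
rewrite big1// => k _.
under eq_tint do rewrite rmodeE.
rewrite tintB ?tintZ ?tint_cos ?tint_sin ?mulr0 ?subr0; try exact: essbounded_cos;
  try exact: essbounded_sin; try (apply: essboundedZ; exact: essbounded_cos);
  try (apply: essboundedZ; exact: essbounded_sin).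
by case: eqVneq => [->|_]; rewrite ?z0 /= ?mul0r ?mulr0.
Qed.

(** The choice made by [xget] is identified by uniqueness: its difference with the explicit solution
    is harmonic and of mean zero. At k = 0 the multiplier is the default value 0 of the inverse. *)
Lemma inv_laplacian_tpoly N z : z 0 = 0 ->
  inv_laplacian (tpoly (box N) z) = tpoly (box N) (fun k => (- (lam k)^-1)%:C%C * z k).
Proof.
move=> z0; pose psi0 := tpoly (box N) (fun k => (- (lam k)^-1)%:C%C * z k).
have P0 : [/\ Defs.periodic psi0, C2 psi0, mean_zero psi0 & laplacian psi0 =1 tpoly (box N) z].
  split; [exact: periodic_tpoly | exact: C2_tpoly | by apply: tint_tpoly; cbv beta; rewrite z0 mulr0 |].
  move=> x; rewrite laplacian_tpoly; apply: eq_tpoly => k _.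
  have [->|k0] := eqVneq k 0; first by rewrite z0 !mulr0.
  by rewrite mulrA -rmorphM mulrNN divff ?lam_neq0// rmorph1 mul1r.
rewrite /inv_laplacian; case: xgetP => [psi _ [p1 c1 m1 l1]|/(_ psi0)//].
have [p2 c2 m2 l2] := P0.
have [cB lB] := C2B c1 c2.
rewrite -/psi0; apply/funext => x; apply/eqP; rewrite -subr_eq0; apply/eqP; move: x.
apply: (harmonic_mean_zero (periodicB p1 p2) cB).
- have e1 := essbounded_C2 p1 c1; have e2 := essbounded_C2 p2 c2.
  by rewrite tintB; [rewrite [tint psi]m1 [tint psi0]m2 subrr|exact: e1|exact: e2].
- by move=> x; rewrite lB l1 l2 subrr.
Qed.

End Green.

(** * Dirichlet kernels *)

Section ComplexAbs.
Context {R : realType}.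
Local Notation Re := complex.Re.
Local Notation Im := complex.Im.
Implicit Types (u v : R[i]).

(** The modulus as an element of [R]; the norm of [R[i]] takes its values in [R[i]]. *)
Definition cabs u : R := Num.sqrt (nsq u).

Lemma nsq_ge0 u : 0 <= nsq u.
Proof. by rewrite addr_ge0 ?sqr_ge0. Qed.

Lemma cabs_ge0 u : 0 <= cabs u.
Proof. exact: sqrtr_ge0. Qed.

Lemma cabs_sqr u : cabs u ^+ 2 = nsq u.
Proof. by rewrite sqr_sqrtr// nsq_ge0. Qed.

Lemma cabsE u : cabs u = ComplexField.Normc.normc u.
Proof. by case: u. Qed.

Lemma cabsM u v : cabs (u * v) = cabs u * cabs v.
Proof. by rewrite !cabsE ComplexField.Normc.normcM. Qed.

Lemma cabsD u v : cabs (u + v) <= cabs u + cabs v.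
Proof. by rewrite !cabsE; exact: le_normcD. Qed.

Lemma cabs0 : cabs 0 = 0.
Proof. by rewrite /cabs /nsq /= expr0n addr0 sqrtr0. Qed.

Lemma cabsN u : cabs (- u) = cabs u.
Proof. by rewrite /cabs /nsq; case: u => a b /=; rewrite !sqrrN. Qed.

Lemma cabs_real (a : R) : cabs (a%:C)%C = `|a|.
Proof. by rewrite /cabs /nsq /= expr0n addr0 sqrtr_sqr. Qed.

Lemma cabs_ci (a : R) : cabs (ci a) = `|a|.
Proof. by rewrite /cabs /nsq /= expr0n add0r sqrtr_sqr. Qed.

Lemma cabs_sum (I : Type) (r : seq I) (P : pred I) (F : I -> R[i]) :
  cabs (\sum_(i <- r | P i) F i) <= \sum_(i <- r | P i) cabs (F i).
Proof.
elim: r => [|i r IH]; first by rewrite !big_nil cabs0.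
rewrite !big_cons; case: ifP => // _.
by apply: le_trans (cabsD _ _) _; rewrite lerD2l.
Qed.

Lemma Re_le_cabs u : `|Re u| <= cabs u.
Proof. by rewrite -sqrtr_sqr ler_wsqrtr// lerDl sqr_ge0. Qed.

Lemma Im_le_cabs u : `|Im u| <= cabs u.
Proof. by rewrite -sqrtr_sqr ler_wsqrtr// lerDr sqr_ge0. Qed.

Lemma cabs_mode k x : cabs (fourier_mode k x : R[i]) = 1.
Proof. by rewrite /cabs /nsq /= cos2Dsin2 sqrtr1. Qed.

Lemma rmode_le u k x : `|rmode u k x| <= cabs u.
Proof. by apply: le_trans (Re_le_cabs _) _; rewrite cabsM cabs_mode mulr1. Qed.

End ComplexAbs.

Section Dirichlet.
Context {R : realType}.
Local Notation Re := complex.Re.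
Local Notation Im := complex.Im.
Local Notation mR := (measurableTypeR R).
Local Notation mu := (@lebesgue_measure R).
Local Notation tm := (@torus_measure R).
Implicit Types (s t c : R).

(** With u = pi s / 2, at most pi / 4, sin (pi s) = 2 sin u cos u and sin u = u cos c for some c
    below u. The product of the two cosines is at least 1/2, and u >= s because pi >= 2. *)
Lemma sin_pi_ge s : 0 <= s <= 2^-1 -> s <= sin (pi * s).
Proof.
move=> /andP[s0 s1]; have p2 := @pi_ge2 R; have p0 := @pi_gt0 R.
pose u := pi * s / 2.
have u0 : 0 <= u by rewrite /u; apply: mulr_ge0; [apply: mulr_ge0; lra|lra].
have u1 : u <= pi / 4.
  have : pi * s <= pi * 2^-1 by rewrite ler_pM2l.
  by rewrite /u; lra.
have [->|un0] := eqVneq s 0; first by rewrite mulr0 sin0.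
have u_gt0 : 0 < u by rewrite /u; rewrite !mulr_gt0// lt_neqAle eq_sym un0.
have half (c : R) : 0 <= c -> c <= pi / 4 -> 0 <= cos c /\ 2^-1 <= cos c ^+ 2.
  move=> c0 c1; split; first by apply: cos_ge0_pihalf; apply/andP; split; lra.
  have : 0 <= cos (c *+ 2) by apply: cos_ge0_pihalf; rewrite (mulr2n c); apply/andP; split; lra.
  by rewrite cos_mulr2n mulr2n; lra.
have [||c] := @MVT R sin cos 0 u.
- exact: u_gt0.
- by apply: continuous_subspaceT => y; exact: continuous_sin.
rewrite in_itv /= => /andP[c0 cu]; rewrite sin0 !subr0 => su.
have [cc0 cc1] := half c (ltW c0) (le_trans (ltW cu) u1).
have [cu0 cu1] := half u u0 u1.
have -> : pi * s = u *+ 2 by rewrite /u mulr2n; field.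
rewrite sin_mulr2n su mulr2n.
have prod : 2^-1 <= cos c * cos u.
  have : 2^-1 ^+ 2 <= (cos c * cos u) ^+ 2.
    rewrite exprMn expr2; apply: ler_pM; [lra|lra|exact: cc1|exact: cu1].
  by rewrite ler_sqr ?nnegrE ?mulr_ge0 ?invr_ge0.
have : u <= (cos u * (cos c * u)) + (cos u * (cos c * u)).
  have -> : cos u * (cos c * u) + cos u * (cos c * u) = 2 * (cos c * cos u) * u by ring.
  by rewrite ler_pMl//; lra.
apply: le_trans; rewrite /u; nra.
Qed.

(** The sine is bounded below by the distance from [t] to an integer. A difference of two points of
    [0, 1] only involves the integers 0, 1 and -1. *)
Lemma sin_pi_dist t : -1 <= t <= 1 ->
  exists2 j : int, j \in [:: 0; 1; -1] & `|t + j%:~R| <= `|sin (pi * t)|.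
Proof.
have pos s : 0 <= s <= 1 -> s <= `|sin (pi * s)| \/ 1 - s <= `|sin (pi * s)|.
  move=> /andP[s0 s1]; have [h|h] := leP s 2^-1.
    by left; apply: le_trans (ler_norm _); apply: sin_pi_ge; rewrite s0.
  right; have -> : pi * s = pi * (s - 1) + pi by ring.
  rewrite sinDpi normrN; have -> : pi * (s - 1) = - (pi * (1 - s)) by ring.
  rewrite sinN normrN; apply: le_trans (ler_norm _); apply: sin_pi_ge; lra.
move=> /andP[t0 t1]; have [h|h] := leP 0 t.
  have [H|H] := pos t (introT andP (conj h t1)).
    by exists 0 => //; rewrite addr0 ger0_norm.
  exists (-1) => //; rewrite mulrN1z ler0_norm ?opprB//; lra.
have [|H|H] := pos (- t); first lra.
  by exists 0 => //; rewrite addr0 ltr0_norm//; move: H; rewrite mulrN sinN normrN.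
exists 1 => //; rewrite mulr1z ger0_norm; last lra.
by move: H; rewrite mulrN sinN normrN opprK addrC.
Qed.

Definition cis s : R[i] := (cos (2 * pi * s) +i* sin (2 * pi * s))%C.

Lemma cisD s t : cis (s + t) = cis s * cis t.
Proof.
rewrite /cis mulrDr cosD sinD; apply/eqP; rewrite eq_complex /=.
by apply/andP; split; apply/eqP; ring.
Qed.

Lemma cabs_cis s : cabs (cis s) = 1.
Proof. by rewrite /cabs /nsq /= cos2Dsin2 sqrtr1. Qed.

Lemma cabs_cis_sub1 s : cabs (cis s - 1) = 2 * `|sin (pi * s)|.
Proof.
have -> : 2 * `|sin (pi * s)| = `|2 * sin (pi * s)| by rewrite normrM ger0_norm.
rewrite -sqrtr_sqr /cabs /nsq /cis /=; congr Num.sqrt.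
have -> : 2 * pi * s = (pi * s) *+ 2 by rewrite mulr2n; ring.
rewrite cos_mulr2n sin_mulr2n !mulr2n.
have := cos2Dsin2 (pi * s); set c := cos _; set d := sin _ => h.
have -> : c ^+ 2 = 1 - d ^+ 2 by rewrite -h; ring.
rewrite oppr0 addr0.
have -> : (c * d + c * d) ^+ 2 = 4 * c ^+ 2 * d ^+ 2 by ring.
have -> : c ^+ 2 = 1 - d ^+ 2 by rewrite -h; ring.
ring.
Qed.

(** The window of indices is arbitrary because a box cut by a translate of itself is a product of
    such windows. *)
Definition dirichlet (N a b : nat) t : R[i] :=
  \sum_(a <= i < b) cis ((i%:Z - N%:Z)%:~R * t).

Lemma dirichlet_le_size N a b t : cabs (dirichlet N a b t) <= (b - a)%:R.
Proof.
apply: le_trans (cabs_sum _ _ _) _.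
under eq_bigr do rewrite cabs_cis.
by rewrite sumr_const_nat.
Qed.

(** Multiplied by [cis t - 1], of modulus 2 |sin (pi t)|, the geometric sum telescopes to a
    difference of two complex numbers of modulus one. *)
Lemma dirichlet_sin N a b t : cabs (dirichlet N a b t) * `|sin (pi * t)| <= 1.
Proof.
have [ab|ba] := leqP a b; last first.
  by rewrite /dirichlet big_geq 1?ltnW// cabs0 mul0r.
have tel : dirichlet N a b t * (cis t - 1) =
    cis ((b%:Z - N%:Z)%:~R * t) - cis ((a%:Z - N%:Z)%:~R * t).
  rewrite /dirichlet mulr_suml -(telescope_sumr (fun i => cis ((i%:Z - N%:Z)%:~R * t)))//.
  apply: eq_bigr => i _; rewrite mulrBr mulr1 -cisD; congr (cis _ - _).
  have -> : i.+1%:Z = i%:Z + 1 by lia.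
  by rewrite !intrD; ring.
have : cabs (dirichlet N a b t * (cis t - 1)) <= 2.
  rewrite tel; apply: le_trans (cabsD _ _) _; rewrite cabsN !cabs_cis; lra.
rewrite cabsM cabs_cis_sub1; lra.
Qed.

(* Comparable to min(n, 1/|t|), the size of a Dirichlet kernel of degree n, with
   the explicit primitive asinh (n t). *)
Definition majorant (n : R) t : R := n / Num.sqrt (1 + (n * t) ^+ 2).

(** After squaring, c^2 + n^2 c^2 d^2 has to be at most 4 n^2, and the hypotheses bound each of its
    two terms by n^2. *)
Lemma majorant_ge (n d c : R) : 0 < n -> 0 <= c -> c <= n -> c * `|d| <= 1 ->
  c <= 2 * majorant n d.
Proof.
move=> n0 c0 cn cd; rewrite /majorant mulrA ler_pdivlMr ?sqrtr_gt0 ?ltr_pwDl ?sqr_ge0//.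
rewrite -(ler_pXn2r (n := 2))// ?nnegrE ?mulr_ge0 ?sqrtr_ge0// ?(ltW n0)//.
rewrite exprMn sqr_sqrtr ?addr_ge0 ?sqr_ge0// mulrDr mulr1.
have h1 : c ^+ 2 <= n ^+ 2 by rewrite ler_sqr ?nnegrE// (ltW n0).
have h2 : c ^+ 2 * d ^+ 2 <= 1.
  have -> : c ^+ 2 * d ^+ 2 = (c * `|d|) ^+ 2 by rewrite exprMn real_normK ?num_real.
  by rewrite expr_le1// mulr_ge0.
have -> : c ^+ 2 * (n * d) ^+ 2 = n ^+ 2 * (c ^+ 2 * d ^+ 2) by ring.
have : n ^+ 2 * (c ^+ 2 * d ^+ 2) <= n ^+ 2 by rewrite ler_piMr ?sqr_ge0.
rewrite exprMn; have := sqr_ge0 n; lra.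
Qed.

Definition asinh t : R := ln (t + Num.sqrt (1 + t ^+ 2)).

Lemma asinh_arg t : 0 < t + Num.sqrt (1 + t ^+ 2).
Proof.
rewrite -ltrBlDl sub0r; apply: le_lt_trans (ler_norm _) _.
by rewrite normrN -sqrtr_sqr ltr_sqrt ?ltr_pwDl ?sqr_ge0// ltrDr.
Qed.

Lemma drv_asinh t : drv asinh t (Num.sqrt (1 + t ^+ 2))^-1.
Proof.
have p1 : 0 < 1 + t ^+ 2 by rewrite ltr_pwDl ?sqr_ge0.
have h1 : drv (fun s : R => 1 + s ^+ 2) t (0 + 2 * t * 1) :=
  drvD (drv_cst _ _) (drv_sqr (drv_id t)).
have h2 := drvD (drv_id t) (drv_sqrt (f := fun s => 1 + s ^+ 2) p1 h1).
apply: drv_eq (drv_ln (f := fun s => s + Num.sqrt (1 + s ^+ 2)) (asinh_arg t) h2) _.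
have := asinh_arg t; have : 0 < Num.sqrt (1 + t ^+ 2) by rewrite sqrtr_gt0.
by set q := Num.sqrt _ => q0 tq; field; rewrite !gt_eqF.
Qed.

(** The arguments of the logarithm at [t] and [- t] are inverse to each other, so [asinh] is odd and
    one upper bound serves for both signs. *)
Lemma asinh_le (n t : R) : 0 < n -> `|t| <= 2 * n -> `|asinh t| <= ln (4 * n + 1).
Proof.
move=> n0 tn; have q0 : 0 <= Num.sqrt (1 + t ^+ 2) by exact: sqrtr_ge0.
have q1 : Num.sqrt (1 + t ^+ 2) <= 1 + `|t|.
  rewrite -[leRHS]ger0_norm ?addr_ge0// -sqrtr_sqr ler_wsqrtr//.
  by rewrite sqrrD expr1n mul1r real_normK ?num_real// -addrA lerD2l lerDr mulrn_wge0.
have ap := asinh_arg t.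
have up (s : R) : `|s| <= 2 * n -> s + Num.sqrt (1 + s ^+ 2) <= 4 * n + 1.
  move=> sn.
  have : Num.sqrt (1 + s ^+ 2) <= 1 + `|s|.
    rewrite -[leRHS]ger0_norm ?addr_ge0// -sqrtr_sqr ler_wsqrtr//.
    by rewrite sqrrD expr1n mul1r real_normK ?num_real// -addrA lerD2l lerDr mulrn_wge0.
  have := ler_norm s; lra.
have inv : (t + Num.sqrt (1 + t ^+ 2))^-1 = - t + Num.sqrt (1 + (- t) ^+ 2).
  rewrite sqrrN; apply: (mulfI (lt0r_neq0 ap)); rewrite divff ?lt0r_neq0//.
  have := sqr_sqrtr (_ : 0 <= 1 + t ^+ 2); rewrite addr_ge0 ?sqr_ge0// => /(_ isT).
  move: (Num.sqrt _) => q qE; transitivity (q ^+ 2 - t ^+ 2); last by ring.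
  by rewrite qE addrK.
have n1 : 0 < 4 * n + 1 by lra.
rewrite /asinh ler_norml; apply/andP; split.
  rewrite lerNl -lnV ?posrE// inv ler_ln ?posrE// ?up ?normrN//.
  by rewrite -inv invr_gt0.
by rewrite ler_ln ?posrE ?up.
Qed.

Lemma continuous_majorant n t : continuous (fun s => majorant n (s + t)).
Proof.
move=> s; rewrite /majorant; apply: cvgM; first exact: cvg_cst.
apply: cvgV; first by rewrite gt_eqF// sqrtr_gt0 ltr_pwDl ?sqr_ge0.
apply: continuous_comp; last exact: sqrt_continuous.
apply: cvgD; first exact: cvg_cst.
apply: (continuous_comp (f := fun s => n * (s + t)) (g := fun u => u ^+ 2)); last exact: exprn_continuous.
by apply: cvgM; [exact: cvg_cst | apply: cvgD; [exact: cvg_id|exact: cvg_cst]].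
Qed.

End Dirichlet.

Section KernelBound.
Context {R : realType}.
Local Notation Re := complex.Re.
Local Notation Im := complex.Im.
Local Notation mR := (measurableTypeR R).
Local Notation mu := (@lebesgue_measure R).
Local Notation tm := (@torus_measure R).
Implicit Types (s t : R).

Lemma drv_majorant (n c t : R) : 0 < n ->
  drv (fun s => - asinh (n * (c - s))) t (majorant n (c - t)).
Proof.
move=> n0.
have h : drv (fun s => n * (c - s)) t (n * (0 - 1)) :=
  drvZ n (drvB (drv_cst t c) (drv_id t)).
have h2 : drv (fun s => - asinh (n * (c - s))) t
    (- ((Num.sqrt (1 + (n * (c - t)) ^+ 2))^-1 * (n * (0 - 1)))) :=
  drvN (@drv_comp R asinh (fun s => n * (c - s)) t _ _ (drv_asinh (n * (c - t))) h).
have -> : majorant n (c - t) =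
    - ((Num.sqrt (1 + (n * (c - t)) ^+ 2))^-1 * (n * (0 - 1))).
  by rewrite /majorant; ring.
exact: h2.
Qed.

Lemma continuous_majorantB (n c : R) : continuous (fun s => majorant n (c - s)).
Proof.
move=> s; apply: (continuous_comp (f := fun s => c - s) (g := majorant n)).
  by apply: cvgB; [exact: cvg_cst|exact: cvg_id].
have -> : majorant n = (fun u => majorant n (u + 0)) by apply/funext => u; rewrite addr0.
exact: continuous_majorant.
Qed.

Lemma integral_majorant (n c : R) : 0 < n -> `|c| <= 2 -> `|c - 1| <= 2 ->
  (\int[mu]_(s in `[0%R, 1%R]) (majorant n (c - s))%:E <= (2 * ln (4 * n + 1))%:E)%E.
Proof.
move=> n0 c1 c2.
rewrite (@integral01_derive R (fun s => - asinh (n * (c - s))) _ (fun t => drv_majorant c t n0)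
  (continuous_majorantB (n := n) (c := c))).
rewrite lee_fin opprK subr0.
have b u : `|u| <= 2 -> `|asinh (n * u)| <= ln (4 * n + 1).
  move=> hu; apply: asinh_le => //.
  by rewrite normrM (gtr0_norm n0) mulrC ler_pM2r.
have := b _ c1; have := b _ c2; rewrite !ler_norml => /andP[? ?] /andP[? ?]; lra.
Qed.

(** The factor 12 is 2 from [majorant_ge], times three translates, times 2 from [integral_majorant];
    the argument is 4 n + 1 with n = 2 N + 1. *)
Definition dirichlet_bound (N : nat) : R := 12 * ln (8 * N%:R + 5).

Lemma continuous_bigsum (T : topologicalType) (I : Type) (r : seq I) (P : pred I)
    (F : I -> T -> R) :
  (forall i, P i -> continuous (F i)) ->
  continuous (fun x => \sum_(i <- r | P i) F i x).
Proof.
move=> h; elim: r => [|i r IH].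
  have -> : (fun x => \sum_(i <- [::] | P i) F i x) = fun=> 0.
    by apply/funext => x; rewrite big_nil.
  by move=> x; exact: cvg_cst.
have [Pi|Pi] := boolP (P i); last first.
  have -> : (fun x => \sum_(i <- i :: r | P i) F i x) = (fun x => \sum_(i <- r | P i) F i x).
    by apply/funext => x; rewrite big_cons (negbTE Pi).
  exact: IH.
have -> : (fun x => \sum_(i <- i :: r | P i) F i x) =
    (fun x => F i x + \sum_(i <- r | P i) F i x).
  by apply/funext => x; rewrite big_cons Pi.
by move=> x; apply: cvgD; [exact: h|exact: IH].
Qed.

Lemma continuous_dirichlet N a b (c : R) : continuous (fun s => cabs (dirichlet N a b (c - s))).
Proof.
have cc (F : R -> R) : continuous F -> continuous (fun s => Num.sqrt (F s)).
  by move=> cF s; apply: continuous_comp; [exact: cF|exact: sqrt_continuous].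
apply: cc.
have trig (g : R -> R) i : continuous g ->
    continuous (fun s => g (2 * pi * ((i%:Z - N%:Z)%:~R * (c - s)))).
  move=> cg s; apply: (continuous_comp (f := fun s => 2 * pi * ((i%:Z - N%:Z)%:~R * (c - s)))); last exact: cg.
  apply: cvgM; first exact: cvg_cst.
  apply: cvgM; first exact: cvg_cst.
  by apply: cvgB; [exact: cvg_cst|exact: cvg_id].
have sq (F : R -> R) : continuous F -> continuous (fun s => F s ^+ 2).
  move=> cF s; apply: (continuous_comp (f := F) (g := fun u => u ^+ 2)); first exact: cF.
  exact: exprn_continuous.
rewrite /nsq; move=> s; apply: cvgD; apply: sq => {}s.
  under eq_fun do rewrite Re_sum.
  by apply: continuous_bigsum => i _; apply: trig; exact: continuous_cos.
under eq_fun do rewrite Im_sum.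
by apply: continuous_bigsum => i _; apply: trig; exact: continuous_sin.
Qed.

(** The kernel can peak at every integer and [c - s] ranges in [-1, 1], so three translates of
    [majorant] are summed. *)
Lemma integral_dirichlet N a b (c : R) : (b <= (2 * N).+1)%N -> 0 <= c <= 1 ->
  (\int[mu]_(s in `[0%R, 1%R]) (cabs (dirichlet N a b (c - s)))%:E <= (dirichlet_bound N)%:E)%E.
Proof.
move=> bN /andP[c0 c1]; pose n : R := (2 * N).+1%:R.
have n0 : 0 < n by rewrite ltr0n.
have maj t : 0 <= t <= 1 -> cabs (dirichlet N a b (c - t)) <=
    2 * (majorant n (c - t) + (majorant n (c + 1 - t) + majorant n (c - 1 - t))).
  move=> /andP[t0 t1].
  have [|j jI jle] := @sin_pi_dist R (c - t); first by apply/andP; split; lra.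
  have m0 (x : R) : 0 <= majorant n x by rewrite divr_ge0 ?sqrtr_ge0// ltW.
  have : cabs (dirichlet N a b (c - t)) <= 2 * majorant n (c - t + j%:~R).
    apply: majorant_ge => //; first exact: cabs_ge0.
      by apply: le_trans (dirichlet_le_size _ _ _ _) _; rewrite ler_nat; lia.
    apply: le_trans (dirichlet_sin N a b (c - t)).
    by apply: ler_wpM2l => //; exact: cabs_ge0.
  have := m0 (c - t); have := m0 (c + 1 - t); have := m0 (c - 1 - t).
  have e1 : c + 1 - t = c - t + 1 by ring.
  have e2 : c - 1 - t = c - t - 1 by ring.
  rewrite e1 e2; move: jI; rewrite !inE => /or3P[] /eqP ->; rewrite ?addr0 ?mulrN1z ?mulr1z; lra.
have meas (F : R -> R) : continuous F -> measurable_fun (`[0%R, 1%R] : set mR) (fun s => (F s)%:E).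
  by move=> cF; apply/measurable_EFinP; apply: measurable_funTS; exact: continuous_measurable_fun.
have cm (x : R) := continuous_majorantB (n := n) (c := x).
have m0 (x s : R) : 0 <= majorant n (x - s) by rewrite divr_ge0 ?sqrtr_ge0// ltW.
apply: (@le_trans _ _ (\int[mu]_(s in `[0%R, 1%R])
    (2 * (majorant n (c - s) + (majorant n (c + 1 - s) + majorant n (c - 1 - s))))%:E)%E).
  apply: ge0_le_integral => //.
  - by move=> s _; rewrite lee_fin cabs_ge0.
  - by apply: meas; exact: continuous_dirichlet.
  - apply: meas => s; apply: cvgM; first exact: cvg_cst.
    by apply: cvgD; [exact: cm|apply: cvgD; exact: cm].
have -> : (\int[mu]_(s in `[0%R, 1%R])
    (2 * (majorant n (c - s) + (majorant n (c + 1 - s) + majorant n (c - 1 - s))))%:E =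
  2%:E * (\int[mu]_(s in `[0%R, 1%R]) (majorant n (c - s))%:E +
   (\int[mu]_(s in `[0%R, 1%R]) (majorant n (c + 1 - s))%:E +
    \int[mu]_(s in `[0%R, 1%R]) (majorant n (c - 1 - s))%:E)))%E.
  rewrite -ge0_integralD//; try (by move=> s _; rewrite lee_fin m0); try (by apply: meas; exact: cm).
  rewrite -ge0_integralD//; last 4 first.
  - by move=> s _; rewrite lee_fin m0.
  - by apply: meas; exact: cm.
  - by move=> s _; rewrite -EFinD lee_fin addr_ge0 ?m0.
  - apply: (meas (fun s => majorant n (c + 1 - s) + majorant n (c - 1 - s))) => s.
    by apply: cvgD; exact: cm.
  rewrite -ge0_integralZl//.
  - apply: (meas (fun s => majorant n (c - s) + (majorant n (c + 1 - s) + majorant n (c - 1 - s)))) => s.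
    by apply: cvgD; [exact: cm|apply: cvgD; exact: cm].
  - by move=> s _; rewrite -!EFinD lee_fin !addr_ge0 ?m0.
have h1 : (\int[mu]_(s in `[0%R, 1%R]) (majorant n (c - s))%:E <= (2 * ln (4 * n + 1))%:E)%E.
  by apply: integral_majorant => //; rewrite ler_norml; apply/andP; split; lra.
have h2 : (\int[mu]_(s in `[0%R, 1%R]) (majorant n (c + 1 - s))%:E <= (2 * ln (4 * n + 1))%:E)%E.
  by apply: integral_majorant => //; rewrite ler_norml; apply/andP; split; lra.
have h3 : (\int[mu]_(s in `[0%R, 1%R]) (majorant n (c - 1 - s))%:E <= (2 * ln (4 * n + 1))%:E)%E.
  by apply: integral_majorant => //; rewrite ler_norml; apply/andP; split; lra.
apply: (@le_trans _ _ (2%:E * ((2 * ln (4 * n + 1))%:E + ((2 * ln (4 * n + 1))%:E + (2 * ln (4 * n + 1))%:E)))%E).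
  by apply: lee_wpmul2l; rewrite ?lee_fin//; apply: leeD => //; apply: leeD.
rewrite -!EFinD -EFinM lee_fin /dirichlet_bound.
have -> : 4 * n + 1 = 8 * N%:R + 5 by rewrite /n -(addn1 (2 * N)) natrD natrM; ring.
lra.
Qed.

Lemma dirichlet_bound_ge0 N : 0 <= dirichlet_bound N.
Proof. by rewrite /dirichlet_bound mulr_ge0// ln_ge0// ler_wpDl ?mulr_ge0 ?ler0n// ler1n. Qed.

(** A shift by p >= 0 cuts the range on the right, a negative one on the left; for large p truncated
    subtraction makes the window empty. *)
Lemma shift_interval (N : nat) (p : int) : exists a b : nat, (b <= (2 * N).+1)%N /\
  forall i : nat, (i < (2 * N).+1)%N ->
    (`|(i%:Z - N%:Z + p)%R| <= N)%N = (a <= i < b)%N.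
Proof.
case: p => q.
  by exists 0%N, ((2 * N).+1 - q)%N; split => [|i iN]; lia.
by exists q.+1, (2 * N).+1; split => [|i iN]; lia.
Qed.

Lemma dirichletE N a b t : (b <= (2 * N).+1)%N -> dirichlet N a b t =
  \sum_(i < (2 * N).+1 | (a <= i < b)%N) cis ((i%:Z - N%:Z)%:~R * t) :> R[i].
Proof.
move=> bN; rewrite /dirichlet (big_nat_widen _ _ _ _ _ bN) big_geq_mkord.
by apply: eq_bigl => i /=; rewrite andbC.
Qed.

(** The intersection of the box with a translate is a rectangle, so its exponential sum factors into
    two one-dimensional kernels. *)
Lemma sum_shifted_box N p : exists a1 b1 a2 b2 : nat,
  [/\ (b1 <= (2 * N).+1)%N, (b2 <= (2 * N).+1)%N & forall z : R * R,
   \sum_(k <- box N | k + p \in box N) fourier_mode k z =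
   dirichlet N a1 b1 z.1 * dirichlet N a2 b2 z.2].
Proof.
have [a1 [b1 [h1 H1]]] := shift_interval N p.1.
have [a2 [b2 [h2 H2]]] := shift_interval N p.2.
exists a1, b1, a2, b2; split => // z.
rewrite /box big_image_cond !dirichletE// big_distrlr pair_big /=.
apply: eq_big => [[i j]|[i j] _].
  rewrite -/(box N) mem_box /freq /= H1 ?ltn_ord// H2 ?ltn_ord//.
by rewrite -cisD /= /freq /fourier_mode /phase /cis /=.
Qed.

Lemma rmode_coef_convolution f (u : R[i]) k x : essbounded f ->
  rmode (u * fourier_coef f k) k x = tint (fun y => f y * rmode u k (x - y)).
Proof.
move=> hf; pose v := u * fourier_mode k x.
have E y : rmode u k (x - y) = Re v * cos (phase k y) + Im v * sin (phase k y).
  rewrite /rmode fourier_mode_sub mulrA -/v; case: v => a b /=; ring.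
have -> : rmode (u * fourier_coef f k) k x =
    Re v * tint (fun y => f y * cos (phase k y)) + Im v * tint (fun y => f y * sin (phase k y)).
  by rewrite /rmode mulrAC -/v fourier_coefE; case: v {E} => a b /=; ring.
have e1 := essbounded_mulcos k hf; have e2 := essbounded_mulsin k hf.
rewrite -(tintZ (Re v) e1) -(tintZ (Im v) e2) -tintD; try exact: essboundedZ.
by apply: eq_tint => y; rewrite E; ring.
Qed.

(** The truncation is the convolution of [f] with a kernel dominated by a product of two Dirichlet
    kernels, each of L^1 norm at most [dirichlet_bound N]. The factor [u] gives access to imaginary
    parts as well. *)
Lemma shifted_projection_bound N f (M : R) p (u : R[i]) x : essbounded f ->
  {ae tm, forall y, `|f y| <= M} -> 0 <= M -> cabs u <= 1 ->
  `|\sum_(k <- box N | k + p \in box N) rmode (u * fourier_coef f k) k x| <=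
  M * dirichlet_bound N ^+ 2.
Proof.
move=> hf fM M0 u1.
have [a1 [b1 [a2 [b2 [h1 h2 H]]]]] := sum_shifted_box N p.
pose S y := \sum_(k <- box N | k + p \in box N) rmode (u * fourier_coef f k) k y.
have pS : Defs.periodic S.
  by move=> y; split; apply: eq_bigr => k _; case: (periodic_rmode (u * fourier_coef f k) k y).
(* With the base point in the cell, the kernels are only integrated over differences of points of
   [0, 1], as [integral_dirichlet] requires. *)
have [z [z1 z2 zE]] := periodic_cell x pS; rewrite -/(S x) -zE.
pose K y := \sum_(k <- box N | k + p \in box N) rmode u k (z - y).
pose A s := cabs (dirichlet N a1 b1 (z.1 - s)); pose B s := cabs (dirichlet N a2 b2 (z.2 - s)).
have KE y : `|K y| <= A y.1 * B y.2.
  have -> : K y = Re (u * \sum_(k <- box N | k + p \in box N) fourier_mode k (z - y)).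
    by rewrite mulr_sumr Re_sum.
  apply: le_trans (Re_le_cabs _) _; rewrite cabsM H cabsM /=.
  by apply: ler_piMl; rewrite ?mulr_ge0 ?cabs_ge0.
have cK : continuous K.
  apply: continuous_bigsum => k _ y.
  apply: (continuous_comp (f := fun y : R * R => z - y) (g := rmode u k)).
    by apply: cvgB; [exact: cvg_cst|exact: cvg_id].
  exact: continuous_rmode.
have bA s : `|A s| <= (b1 - a1)%:R by rewrite ger0_norm ?cabs_ge0//; exact: dirichlet_le_size.
have bB s : `|B s| <= (b2 - a2)%:R by rewrite ger0_norm ?cabs_ge0//; exact: dirichlet_le_size.
have cA : continuous A by exact: continuous_dirichlet.
have cB : continuous B by exact: continuous_dirichlet.
have cAB : continuous (fun y : R * R => A y.1 * B y.2).
  move=> y; apply: cvgM.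
    by apply: continuous_comp; [exact: cvg_fst|exact: cA].
  by apply: continuous_comp; [exact: cvg_snd|exact: cB].
have bAB y : `|A y.1 * B y.2| <= (b1 - a1)%:R * (b2 - a2)%:R by rewrite normrM ler_pM.
have eAB : essbounded (fun y : R * R => A y.1 * B y.2).
  by apply: (essbounded_bounded _ bAB); exact: continuous_measurable2.
have eK : essbounded K.
  apply: (@essbounded_bounded R K ((b1 - a1)%:R * (b2 - a2)%:R)).
    exact: continuous_measurable2.
  by move=> y; apply: le_trans (KE y) _; apply: le_trans (ler_norm _) _.
have -> : S z = tint (fun y => f y * K y).
  rewrite /S; under eq_bigr do rewrite (rmode_coef_convolution _ _ _ hf).
  rewrite -tint_sum; first by apply: eq_tint => y; rewrite mulr_sumr.
  move=> k _; apply: essboundedM => //.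
  apply: (@essbounded_bounded R _ (cabs u)); last by move=> y; exact: rmode_le.
  apply: continuous_measurable2 => y.
  apply: (continuous_comp (f := fun y : R * R => z - y) (g := rmode u k)).
    by apply: cvgB; [exact: cvg_cst|exact: cvg_id].
  exact: continuous_rmode.
apply: (@le_trans _ _ (tint (fun y : R * R => M * (A y.1 * B y.2)))).
  apply: norm_tint_le; [exact: essboundedM|exact: essboundedZ|].
  by apply: ae_imply fM => y fM; rewrite normrM ler_pM.
rewrite (tintZ _ eAB); apply: ler_wpM2l => //; rewrite expr2.
move: z1 z2 => /andP[z10 z11] /andP[z20 z21].
apply: (tint_prod_le cA cB bA bB); try (by move=> s; exact: cabs_ge0).
  by apply: integral_dirichlet => //; rewrite z10 ltW.
by apply: integral_dirichlet => //; rewrite z20 ltW.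
Qed.

End KernelBound.

(** * The Galerkin nonlinearity in Fourier space *)

Section FiniteSums.
Context {R : realType}.
Implicit Types (I : Type).

(** Lagrange's identity: the double sum of squares is twice the difference of the two sides. *)
Lemma cauchy_schwarz I (r : seq I) (x y : I -> R) :
  (\sum_(i <- r) x i * y i) ^+ 2 <= (\sum_(i <- r) x i ^+ 2) * (\sum_(i <- r) y i ^+ 2).
Proof.
have h : 0 <= \sum_(i <- r) \sum_(j <- r) (x i * y j - x j * y i) ^+ 2.
  by apply: sumr_ge0 => i _; apply: sumr_ge0 => j _; exact: sqr_ge0.
have E : \sum_(i <- r) \sum_(j <- r) (x i * y j - x j * y i) ^+ 2 =
    2 * ((\sum_(i <- r) x i ^+ 2) * (\sum_(i <- r) y i ^+ 2))
    - 2 * (\sum_(i <- r) x i * y i) ^+ 2.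
  transitivity (\sum_(i <- r) \sum_(j <- r) (x i ^+ 2 * y j ^+ 2)
     + \sum_(i <- r) \sum_(j <- r) (y i ^+ 2 * x j ^+ 2)
     - 2 * \sum_(i <- r) \sum_(j <- r) (x i * y i) * (x j * y j)).
    rewrite mulr_sumr -big_split -sumrB /=; apply: eq_bigr => i _.
    rewrite mulr_sumr -big_split -sumrB /=; apply: eq_bigr => j _; ring.
  by rewrite -!big_distrlr /= expr2; ring.
rewrite E in h; lra.
Qed.

Lemma cauchy_schwarz_weighted I (r : seq I) (w y : I -> R) : (forall i, 0 <= w i) ->
  (\sum_(i <- r) w i * y i) ^+ 2 <= (\sum_(i <- r) w i) * (\sum_(i <- r) w i * y i ^+ 2).
Proof.
move=> w0; have := cauchy_schwarz r (fun i => Num.sqrt (w i)) (fun i => Num.sqrt (w i) * y i).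
have -> : \sum_(i <- r) Num.sqrt (w i) * (Num.sqrt (w i) * y i) = \sum_(i <- r) w i * y i.
  by apply: eq_bigr => i _; rewrite mulrA -expr2 sqr_sqrtr.
have -> : \sum_(i <- r) Num.sqrt (w i) ^+ 2 = \sum_(i <- r) w i.
  by apply: eq_bigr => i _; rewrite sqr_sqrtr.
have -> // : \sum_(i <- r) (Num.sqrt (w i) * y i) ^+ 2 = \sum_(i <- r) w i * y i ^+ 2.
by apply: eq_bigr => i _; rewrite exprMn sqr_sqrtr.
Qed.

Definition conv (s : seq (int * int)) (x y : int * int -> R) k : R :=
  \sum_(p <- s) \sum_(q <- s) (p + q == k)%:R * (x p * y q).

Lemma conv_ge0 s x y k : (forall p, 0 <= x p) -> (forall q, 0 <= y q) -> 0 <= conv s x y k.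
Proof. by move=> x0 y0; do 2!(apply: sumr_ge0 => ? _); rewrite !mulr_ge0. Qed.

Lemma convC s x y k : conv s x y k = conv s y x k.
Proof.
rewrite /conv exchange_big; apply: eq_bigr => q _; apply: eq_bigr => p _.
by rewrite addrC (mulrC (x _)).
Qed.

(** Cauchy-Schwarz with weight [x], then exchange of the sums: for fixed p, each q contributes to at
    most one k. *)
Lemma young s (x y : int * int -> R) : uniq s -> (forall p, 0 <= x p) ->
  \sum_(k <- s) conv s x y k ^+ 2 <= (\sum_(p <- s) x p) ^+ 2 * \sum_(q <- s) y q ^+ 2.
Proof.
move=> us x0.
(* [Y k p] is y (k - p) cut off to [s], so squaring it only squares [y]. *)
pose Y (k p : int * int) : R := \sum_(q <- s) (p + q == k)%:R * y q.
have YE k p : Y k p = (k - p \in s)%:R * y (k - p).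
  rewrite /Y -(sum_delta (k - p) y us); apply: eq_bigr => q _.
  by rewrite [p + q]addrC -(inj_eq (addIr (- p))) addrK eq_sym.
have Y2E k p : Y k p ^+ 2 = \sum_(q <- s) (p + q == k)%:R * y q ^+ 2.
  transitivity ((k - p \in s)%:R * y (k - p) ^+ 2).
    by rewrite YE exprMn; case: (_ \in _); rewrite ?expr1n ?expr0n.
  rewrite -(sum_delta (k - p) (fun q => y q ^+ 2) us); apply: eq_bigr => q _.
  by rewrite [p + q]addrC -[in RHS](inj_eq (addIr (- p))) addrK eq_sym.
have step k : conv s x y k ^+ 2 <= (\sum_(p <- s) x p) * (\sum_(p <- s) x p * Y k p ^+ 2).
  have -> : conv s x y k = \sum_(p <- s) x p * Y k p.
    apply: eq_bigr => p _; rewrite /Y mulr_sumr; apply: eq_bigr => q _; ring.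
  exact: cauchy_schwarz_weighted.
apply: (@le_trans _ _ (\sum_(k <- s) (\sum_(p <- s) x p) * (\sum_(p <- s) x p * Y k p ^+ 2))).
  by apply: ler_sum => k _; exact: step.
rewrite -mulr_sumr expr2 -mulrA; apply: ler_wpM2l; first by apply: sumr_ge0.
rewrite exchange_big mulr_suml; apply: ler_sum => p _ /=.
rewrite -mulr_sumr; apply: ler_wpM2l => //.
rewrite (eq_bigr _ (fun k _ => Y2E k p)).
rewrite exchange_big; apply: ler_sum => q _ /=.
rewrite -mulr_suml; apply: ler_piMl; first exact: sqr_ge0.
rewrite (eq_bigr (fun i => (p + q == i)%:R * 1)); last by move=> *; rewrite mulr1.
by rewrite (sum_delta _ (fun=> 1) us) mulr1; case: (_ \in _).
Qed.

End FiniteSums.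

(** * Sobolev sums and estimates of the bilinear term *)

Section SpectralSums.
Context {R : realType}.
Local Notation Re := complex.Re.
Local Notation Im := complex.Im.
Implicit Types (k p q : int * int) (a b : int * int -> R[i]).

Definition ksq k : R := k.1%:~R ^+ 2 + k.2%:~R ^+ 2.
(** Written as a complex modulus to inherit the triangle inequality. *)
Definition kn k : R := cabs (k.1%:~R +i* k.2%:~R)%C.

Lemma ksq_ge0 k : 0 <= ksq k.
Proof. by rewrite addr_ge0 ?sqr_ge0. Qed.

Lemma kn_ge0 k : 0 <= kn k.
Proof. exact: cabs_ge0. Qed.

Lemma kn_sqr k : kn k ^+ 2 = ksq k.
Proof. exact: cabs_sqr. Qed.

Lemma knD p q : kn (p + q) <= kn p + kn q.
Proof.
rewrite /kn (_ : (_ +i* _)%C = (p.1%:~R +i* p.2%:~R)%C + (q.1%:~R +i* q.2%:~R)%C).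
  exact: cabsD.
by rewrite /= !intrD.
Qed.

Lemma ksq0 : ksq 0 = 0.
Proof. by rewrite /ksq /= expr0n addr0. Qed.

Lemma ksq_ge1 k : k != 0 -> 1 <= ksq k.
Proof.
case: k => m n; rewrite /ksq /= => k0.
have h : (1 <= m ^+ 2 + n ^+ 2)%R.
  case: (eqVneq m 0) k0 => [->|m0] k0; last by nia.
  case: (eqVneq n 0) k0 => [->|n0] k0; last by nia.
  by move/eqP: k0.
by move: h; rewrite -(ler_int R) intrD !rmorphXn.
Qed.

Lemma kn_ge1 k : k != 0 -> 1 <= kn k.
Proof.
move=> /ksq_ge1; rewrite -kn_sqr => h; rewrite leNgt; apply/negP => k1.
by move: h; rewrite leNgt expr_lt1 ?kn_ge0// k1.
Qed.

Lemma kn0 : kn 0 = 0.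
Proof. by apply/eqP; rewrite -sqrf_eq0 kn_sqr ksq0. Qed.

Lemma lamE k : lam k = 4 * pi ^+ 2 * ksq k :> R.
Proof. by rewrite /lam /wave1 /wave2 /ksq; ring. Qed.

Lemma lam_ge k : 16 * ksq k <= lam k.
Proof.
rewrite lamE; apply: ler_wpM2r; first exact: ksq_ge0.
have : 2 ^+ 2 <= (pi : R) ^+ 2 by rewrite ler_sqr ?nnegrE ?pi_ge2// pi_ge0.
lra.
Qed.

Definition Sob (N j : nat) a : R := \sum_(k <- box N) ksq k ^+ j * nsq (a k).

Lemma Sob_ge0 N j a : 0 <= Sob N j a.
Proof. by apply: sumr_ge0 => k _; rewrite mulr_ge0 ?exprn_ge0 ?ksq_ge0 ?nsq_ge0. Qed.

Lemma Sob_le_succ N j a : a 0 = 0 -> Sob N j a <= Sob N j.+1 a.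
Proof.
move=> a0; apply: ler_sum => k _; have [->|k0] := eqVneq k 0.
  by rewrite a0 /nsq /= expr0n addr0 !mulr0.
apply: ler_wpM2r; first exact: nsq_ge0.
by rewrite exprS ler_peMl ?exprn_ge0 ?ksq_ge0 ?ksq_ge1.
Qed.

(** Of order log N: the price of passing from square sums to l^1 sums in two dimensions. The zero
    frequency contributes the default value 0. *)
Definition Lam N : R := \sum_(k <- box N) (ksq k)^-1.

(** Up to factors 2 pi, [velo] and [gradl1] are the l^1 norms of the Fourier coefficients of the
    velocity and of the gradient. *)
Definition velo N a : R := \sum_(p <- box N) cabs (a p) / kn p.
Definition gradl1 N a : R := \sum_(q <- box N) kn q * cabs (a q).

Lemma Lam_ge0 N : 0 <= Lam N.
Proof. by apply: sumr_ge0 => k _; rewrite invr_ge0 ksq_ge0. Qed.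

Lemma velo_ge0 N a : 0 <= velo N a.
Proof. by apply: sumr_ge0 => k _; rewrite divr_ge0 ?cabs_ge0 ?kn_ge0. Qed.

Lemma gradl1_ge0 N a : 0 <= gradl1 N a.
Proof. by apply: sumr_ge0 => k _; rewrite mulr_ge0 ?cabs_ge0 ?kn_ge0. Qed.

Lemma velo_le N a : velo N a ^+ 2 <= Sob N 0 a * Lam N.
Proof.
apply: le_trans (cauchy_schwarz _ (fun p => cabs (a p)) (fun p => (kn p)^-1)) _.
rewrite le_eqVlt; apply/orP; left; apply/eqP; congr (_ * _); apply: eq_bigr => k _.
  by rewrite cabs_sqr expr0 mul1r.
by rewrite exprVn kn_sqr.
Qed.

Lemma kn_split k : kn k = ksq k / kn k.
Proof.
have [->|k0] := eqVneq k 0; first by rewrite kn0 ksq0 mul0r.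
by rewrite -kn_sqr expr2 mulfK// gt_eqF// (lt_le_trans ltr01)// kn_ge1.
Qed.

(** Writing |q| as |q|^2 / |q| leaves the weights 1/|q|, which are square summable up to a
    logarithm. *)
Lemma gradl1_le N a : gradl1 N a ^+ 2 <= Sob N 2 a * Lam N.
Proof.
have -> : gradl1 N a = \sum_(q <- box N) (ksq q * cabs (a q)) * (kn q)^-1.
  by apply: eq_bigr => q _; rewrite {1}kn_split; ring.
apply: le_trans (cauchy_schwarz _ _ _) _.
rewrite le_eqVlt; apply/orP; left; apply/eqP; congr (_ * _); apply: eq_bigr => k _.
  by rewrite exprMn cabs_sqr.
by rewrite exprVn kn_sqr.
Qed.

(* The coefficient of a_p a_q e_(p+q) in u.grad w. *)
Definition bs p q : R := (p.1%:~R * q.2%:~R - p.2%:~R * q.1%:~R) / ksq p.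

(** The cross product of p and q is at most |p| |q|. For p = 0 both sides are 0 by the convention on
    inverses. *)
Lemma bs_le p q : `|bs p q| <= kn q / kn p.
Proof.
have [->|p0] := eqVneq p 0.
  by rewrite /bs ksq0 invr0 mulr0 normr0 kn0 invr0 mulr0.
have kp : 0 < kn p by rewrite (lt_le_trans ltr01)// kn_ge1.
rewrite /bs -kn_sqr normrM normfV (ger0_norm (sqr_ge0 _)) ler_pdivrMr ?exprn_gt0//.
have -> : kn q / kn p * kn p ^+ 2 = kn p * kn q by field; rewrite gt_eqF.
rewrite -ler_sqr ?nnegrE ?mulr_ge0 ?kn_ge0// real_normK ?num_real//.
rewrite exprMn !kn_sqr /ksq.
set x1 := p.1%:~R; set x2 := p.2%:~R; set y1 := q.1%:~R; set y2 := q.2%:~R.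
have := sqr_ge0 (x1 * y1 + x2 * y2).
have -> : (x1 ^+ 2 + x2 ^+ 2) * (y1 ^+ 2 + y2 ^+ 2) =
  (x1 * y2 - x2 * y1) ^+ 2 + (x1 * y1 + x2 * y2) ^+ 2 by ring.
by rewrite lerDl.
Qed.

Lemma bsD p q r : bs p (q + r) = bs p q + bs p r.
Proof. by rewrite /bs /= !intrD; ring. Qed.

Lemma bs_opp p : bs p (- p) = 0.
Proof. by rewrite /bs /= !mulrNz; ring. Qed.

Definition nonlin N a k : R[i] :=
  \sum_(p <- box N) \sum_(q <- box N) (p + q == k)%:R * ((bs p q)%:C%C * a p * a q).

Lemma nonlin_le N a k :
  cabs (nonlin N a k) <= conv (box N) (fun p => cabs (a p) / kn p) (fun q => kn q * cabs (a q)) k.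
Proof.
apply: le_trans (cabs_sum _ _ _) _; apply: ler_sum => p _.
apply: le_trans (cabs_sum _ _ _) _; apply: ler_sum => q _.
case: (_ == _); last by rewrite !mul0r cabs0.
rewrite !mul1r !cabsM cabs_real.
have -> : cabs (a p) / kn p * (kn q * cabs (a q)) = kn q / kn p * (cabs (a p) * cabs (a q)) by ring.
by rewrite -mulrA; apply: ler_wpM2r; rewrite ?mulr_ge0 ?cabs_ge0 ?bs_le.
Qed.

(** Young's inequality with the velocity in l^1 and the gradient in l^2. *)
Lemma Sob0_nonlin N a : Sob N 0 (nonlin N a) <= velo N a ^+ 2 * Sob N 1 a.
Proof.
have x0 p : 0 <= cabs (a p) / kn p by rewrite divr_ge0 ?cabs_ge0 ?kn_ge0.
have y0 q : 0 <= kn q * cabs (a q) by rewrite mulr_ge0 ?cabs_ge0 ?kn_ge0.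
have -> : Sob N 1 a = \sum_(q <- box N) (kn q * cabs (a q)) ^+ 2.
  by apply: eq_bigr => q _; rewrite exprMn kn_sqr cabs_sqr expr1.
apply: le_trans (young (fun q => kn q * cabs (a q)) (box_uniq N) x0).
apply: ler_sum => k _; rewrite expr0 mul1r -cabs_sqr.
by rewrite ler_sqr ?nnegrE ?cabs_ge0 ?conv_ge0// nonlin_le.
Qed.

(** The extra derivative is distributed by |k| <= |p| + |q|. When it falls on the velocity it
    cancels the factor 1/|p|, and Young's inequality is used with the gradient in l^1 instead. *)
Lemma Sob1_nonlin N a :
  Sob N 1 (nonlin N a) <= 2 * (gradl1 N a ^+ 2 * Sob N 0 a) + 2 * (velo N a ^+ 2 * Sob N 2 a).
Proof.
pose x p := cabs (a p) / kn p; pose y q := kn q * cabs (a q).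
have x0 p : 0 <= x p by rewrite divr_ge0 ?cabs_ge0 ?kn_ge0.
have y0 q : 0 <= y q by rewrite mulr_ge0 ?cabs_ge0 ?kn_ge0.
have ky0 q : 0 <= kn q * y q by rewrite mulr_ge0 ?kn_ge0.
have Y1 := young (fun p => cabs (a p)) (box_uniq N) y0.
have Y2 := young (fun q => kn q * y q) (box_uniq N) x0.
have -> : Sob N 2 a = \sum_(q <- box N) (kn q * y q) ^+ 2.
  by apply: eq_bigr => q _; rewrite /y !exprMn !kn_sqr cabs_sqr expr2; ring.
have -> : Sob N 0 a = \sum_(q <- box N) cabs (a q) ^+ 2.
  by apply: eq_bigr => q _; rewrite cabs_sqr expr0 mul1r.
have pt k : ksq k ^+ 1 * nsq (nonlin N a k) <=
    2 * conv (box N) y (fun p => cabs (a p)) k ^+ 2 +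
    2 * conv (box N) x (fun q => kn q * y q) k ^+ 2.
  have c1 : 0 <= conv (box N) y (fun p => cabs (a p)) k by apply: conv_ge0 => // p; exact: cabs_ge0.
  have c2 : 0 <= conv (box N) x (fun q => kn q * y q) k by exact: conv_ge0.
  have key : kn k * cabs (nonlin N a k) <= conv (box N) y (fun p => cabs (a p)) k +
      conv (box N) x (fun q => kn q * y q) k.
    apply: (@le_trans _ _ (kn k * conv (box N) x y k)).
      by apply: ler_wpM2l; [exact: kn_ge0|exact: nonlin_le].
    rewrite (convC _ y) /conv -big_split mulr_sumr; apply: ler_sum => p _ /=.
    rewrite -big_split mulr_sumr; apply: ler_sum => q _ /=.
    have [E|_] := eqVneq (p + q) k; last by rewrite !mul0r mulr0 addr0.
    rewrite !mul1r -E.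
    apply: (@le_trans _ _ ((kn p + kn q) * (x p * y q))).
      by apply: ler_wpM2r; [rewrite mulr_ge0|exact: knD].
    rewrite mulrDl; apply: lerD; last by rewrite mulrCA.
    rewrite mulrA; apply: ler_wpM2r => //; rewrite /x.
    have [->|p0] := eqVneq p 0; first by rewrite kn0 mul0r cabs_ge0.
    by rewrite mulrC mulfVK// gt_eqF// (lt_le_trans ltr01)// kn_ge1.
  rewrite expr1 -kn_sqr -cabs_sqr -exprMn.
  apply: (@le_trans _ _ ((conv (box N) y (fun p => cabs (a p)) k +
      conv (box N) x (fun q => kn q * y q) k) ^+ 2)).
    by rewrite ler_sqr ?nnegrE ?mulr_ge0 ?kn_ge0 ?cabs_ge0 ?addr_ge0.
  move: (conv _ _ _ _) (conv _ _ _ _) => A B; have := sqr_ge0 (A - B).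
  rewrite sqrrB sqrrD; lra.
apply: (@le_trans _ _ (\sum_(k <- box N) (2 * conv (box N) y (fun p => cabs (a p)) k ^+ 2 +
    2 * conv (box N) x (fun q => kn q * y q) k ^+ 2))).
  by apply: ler_sum => k _; exact: pt.
by rewrite big_split /= -!mulr_sumr; apply: lerD; apply: ler_wpM2l.
Qed.

Definition dotc (u v : R[i]) : R := Re u * Re v + Im u * Im v.

Lemma dotcE (u v : R[i]) : dotc u v = Re ((u^*)%C * v).
Proof. by rewrite /dotc; case: u v => a1 b1 [c1 e1] /=; ring. Qed.

(* In a triad p + q + r = 0, bs p r = - bs p q, so exchanging q and r gives the
   opposite sum. *)
Lemma nonlin_orthogonal N a : (forall k, a (- k) = ((a k)^*)%C) ->
  \sum_(k <- box N) dotc (a k) (nonlin N a k) = 0.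
Proof.
move=> as_.
pose U p q r : R[i] := (p + q + r == 0)%:R * ((bs p q)%:C%C * a p * a q * a r).
pose W := \sum_(p <- box N) \sum_(q <- box N) \sum_(r <- box N) U p q r.
have E : \sum_(k <- box N) (a k)^*%C * nonlin N a k = W.
  rewrite -sum_box_opp.
  transitivity (\sum_(r <- box N) \sum_(p <- box N) \sum_(q <- box N) U p q r).
    apply: eq_bigr => r _; rewrite as_ conjcK /nonlin mulr_sumr.
    apply: eq_bigr => p _; rewrite mulr_sumr; apply: eq_bigr => q _.
    rewrite /U addr_eq0; case: (_ == _); last by rewrite !mul0r mulr0.
    by rewrite !mul1r mulrC.
  rewrite exchange_big; apply: eq_bigr => p _ /=.
  by rewrite exchange_big.
have W' : W = \sum_(p <- box N) \sum_(q <- box N) \sum_(r <- box N) U p r q.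
  by apply: eq_bigr => p _; rewrite exchange_big.
have W0 : W + W = 0.
  rewrite {2}W' /W -big_split big1 // => p _ /=; rewrite -big_split big1 // => q _ /=.
  rewrite -big_split big1 // => r _ /=; rewrite /U (addrAC p r q).
  have [h|_] := eqVneq (p + q + r) 0; last by rewrite !mul0r addr0.
  have hb : bs p q + bs p r = 0.
    have pE : q + r = - p by apply/eqP; rewrite -addr_eq0 addrC addrA h.
    by rewrite -bsD pE bs_opp.
  transitivity ((bs p q + bs p r)%:C%C * (a p * a q * a r)); last by rewrite hb rmorph0 mul0r.
  by rewrite !mul1r rmorphD /=; ring.
have {}W0 : W = 0.
  by apply/eqP; move/eqP: W0; rewrite -mulr2n mulrn_eq0.
transitivity (Re (\sum_(k <- box N) (a k)^*%C * nonlin N a k)).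
  by rewrite Re_sum; apply: eq_bigr => k _; rewrite dotcE.
by rewrite E W0.
Qed.

(** Since [lam k] is at least 16 |k|^2, the linear term dissipates 32 times the sum of order j + 2.
    Completing the square spends one of these 32 to move a factor |k|^2 off [n], which then only
    appears at order j. *)
Lemma Sob_deriv_le N j b (n : int * int -> R[i]) :
  \sum_(k <- box N) ksq k ^+ j.+1 * (2 * dotc (b k) ((- lam k)%:C%C * b k - n k)) <=
  - 31 * Sob N j.+2 b + Sob N j n.
Proof.
rewrite /Sob mulr_sumr -big_split; apply: ler_sum => k _ /=.
have dE : dotc (b k) ((- lam k)%:C%C * b k - n k) = - lam k * nsq (b k) - dotc (b k) (n k).
  by rewrite /dotc /nsq; case: (b k) => u v; case: (n k) => u' v' /=; ring.
rewrite dE.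
have K0 := ksq_ge0 k; have Kj : 0 <= ksq k ^+ j by exact: exprn_ge0.
have h1 : 16 * ksq k * nsq (b k) <= lam k * nsq (b k).
  by apply: ler_wpM2r; [exact: nsq_ge0|exact: lam_ge].
have h2 : 0 <= ksq k ^+ 2 * nsq (b k) + 2 * (ksq k * dotc (b k) (n k)) + nsq (n k).
  have -> : ksq k ^+ 2 * nsq (b k) + 2 * (ksq k * dotc (b k) (n k)) + nsq (n k) =
      nsq ((ksq k)%:C%C * b k + n k).
    by rewrite /dotc /nsq; case: (b k) => u v; case: (n k) => u' v' /=; ring.
  exact: nsq_ge0.
have -> : ksq k ^+ j.+1 * (2 * (- lam k * nsq (b k) - dotc (b k) (n k))) =
  ksq k ^+ j * (- 2 * ksq k * (lam k * nsq (b k)) - 2 * (ksq k * dotc (b k) (n k))).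
  by rewrite exprS; ring.
have -> : - 31 * (ksq k ^+ j.+2 * nsq (b k)) + ksq k ^+ j * nsq (n k) =
  ksq k ^+ j * (- 31 * (ksq k ^+ 2 * nsq (b k)) + nsq (n k)).
  by rewrite !exprS; ring.
apply: ler_wpM2l => //.
have h3 : 2 * ksq k * (16 * ksq k * nsq (b k)) <= 2 * ksq k * (lam k * nsq (b k)).
  by apply: ler_wpM2l => //; rewrite mulr_ge0.
have e3 : 2 * ksq k * (16 * ksq k * nsq (b k)) = 32 * (ksq k ^+ 2 * nsq (b k)) by ring.
lra.
Qed.

(** By [nonlin_orthogonal] the nonlinear term disappears and costs none of the 32. *)
Lemma Sob0_deriv_le N a : (forall k, a (- k) = ((a k)^*)%C) ->
  \sum_(k <- box N) (2 * dotc (a k) ((- lam k)%:C%C * a k - nonlin N a k)) <=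
  - 32 * Sob N 1 a.
Proof.
move=> as_.
have -> : \sum_(k <- box N) (2 * dotc (a k) ((- lam k)%:C%C * a k - nonlin N a k)) =
    \sum_(k <- box N) (- 2 * (lam k * nsq (a k))) - 2 * \sum_(k <- box N) dotc (a k) (nonlin N a k).
  rewrite mulr_sumr -sumrB; apply: eq_bigr => k _.
  by rewrite /dotc /nsq; case: (a k) => u v; case: (nonlin N a k) => u' v' /=; ring.
rewrite nonlin_orthogonal// mulr0 subr0 /Sob mulr_sumr; apply: ler_sum => k _.
have : 16 * ksq k * nsq (a k) <= lam k * nsq (a k).
  by apply: ler_wpM2r; [exact: nsq_ge0|exact: lam_ge].
rewrite expr1; lra.
Qed.

End SpectralSums.

(** * The system of ODEs of the Fourier coefficients *)

Section UnderIntegral.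
Context {R : realType}.
Local Notation Re := complex.Re.
Local Notation Im := complex.Im.
Local Notation tm := (@torus_measure R).
Implicit Types (x y : R * R) (t s : R) (G : R -> R * R -> R).

Lemma continuous_comp_within (T U V : topologicalType) (A : set U) (f : U -> V) (h : T -> U) (x : T) :
  {within A, continuous f} -> {for x, continuous h} -> (forall y : T, A (h y)) ->
  {for x, continuous (fun y : T => f (h y))}.
Proof.
move=> cf ch hA B; move=> /= nB.
have := cf (h x) B nB; rewrite /nbhs /= -nbhs_subspace_in; last exact: hA.
rewrite /within /= => nA; by apply: filterS (ch _ nA : nbhs x (h @^-1` _)) => y /=; apply; exact: hA.
Qed.

Lemma locally_bounded G (a b : R) :
  (forall p : R * (R * R), a <= p.1 <= b -> {for p, continuous (fun q : R * (R * R) => G q.1 q.2)}) ->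
  (forall t, a <= t <= b -> Defs.periodic (G t)) ->
  exists2 M : R, 0 <= M & forall t x, a <= t <= b -> `|G t x| <= M.
Proof.
move=> cG pG; have [ba|ab] := ltP b a.
  exists 0 => // t x /andP[h1 h2]; have := le_lt_trans (le_trans h1 h2) ba.
  by rewrite ltxx.
have cK : compact (`[a, b] `*` (`[0, 1] `*` `[0, 1]) : set (R * (R * R))).
  by apply: compact_setX; [|apply: compact_setX]; exact: segment_compact.
have [||c _ cmax] := @compact_EVT_max _ R (fun p => `|G p.1 p.2|) _ _ cK.
- by exists (a, (0, 0)); split; [|split]; rewrite /= in_itv/= lexx ?ler01.
- apply: continuous_in_subspaceT => p; rewrite inE => -[/= pI _].
  rewrite in_itv/= in pI.
  by apply: continuous_comp; [exact: cG|exact: norm_continuous].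
exists `|G c.1 c.2| => // t x tI.
have [y [/andP[a1 b1] /andP[a2 b2] <-]] := periodic_cell x (pG t tI).
apply: (cmax (t, y)).
rewrite inE; split => /=; first by rewrite in_itv.
by split; rewrite /= in_itv/= ?a1 ?a2 ltW.
Qed.

Lemma continuous_fixed_time G t :
  (forall x, {for (t, x), continuous (fun q : R * (R * R) => G q.1 q.2)}) ->
  continuous (G t).
Proof.
move=> cG x.
have ct : (fun y : R * R => (t, y)) z @[z --> x] --> (t, x).
  exact: (cvg_pair (cvg_cst t) cvg_id).
exact: (cvg_comp _ _ ct (cG x)).
Qed.

Lemma continuous_fixed_point G t x : {for (t, x), continuous (fun q : R * (R * R) => G q.1 q.2)} ->
  {for t, continuous (fun s => G s x)}.
Proof.
move=> cG.
have ct : (fun s : R => (s, x)) z @[z --> t] --> (t, x).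
  exact: (cvg_pair cvg_id (cvg_cst x)).
exact: (cvg_comp _ _ ct cG).
Qed.

Lemma continuous_tint G t (e : R) : 0 < e ->
  (forall p : R * (R * R), t - e <= p.1 <= t + e -> {for p, continuous (fun q : R * (R * R) => G q.1 q.2)}) ->
  (forall s, t - e <= s <= t + e -> Defs.periodic (G s)) ->
  {for t, continuous (fun s => tint (G s))}.
Proof.
move=> e0 cG pG; have [M M0 GM] := locally_bounded cG pG.
have inI s : `]t - e, t + e[%classic s -> t - e <= s <= t + e.
  by rewrite /= in_itv/= => /andP[? ?]; rewrite !ltW.
have eG s : `]t - e, t + e[%classic s -> essbounded (G s).
  move=> /inI sI; apply: essbounded_continuous; last exact: pG.
  by apply: continuous_fixed_time => x; apply: cG.
apply: (@continuity_under_integral R _ _ tm G setT measurableT (t - e) (t + e) _ _ (fun=> M)).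
- by move=> s sI; exact/essbounded_integrable/eG.
- apply: aeW => y _ s; rewrite inE => /inI sI.
  by apply: continuous_fixed_point; exact: cG.
- exact/essbounded_integrable/essbounded_cst.
- by move=> s /inI sI; apply: aeW => y _; exact: GM.
- by rewrite inE /= in_itv/=; apply/andP; split; lra.
Qed.

(** Domination is by a constant: [G'] is continuous and periodic, hence bounded over the compact
    time window around [t]. *)
Lemma drv_tint G (G' : R -> R * R -> R) t (e : R) : 0 < e ->
  (forall s, t - e <= s <= t + e -> essbounded (G s)) ->
  (forall s x, t - e <= s <= t + e -> drv (fun r => G r x) s (G' s x)) ->
  (forall p : R * (R * R), t - e <= p.1 <= t + e ->
    {for p, continuous (fun q : R * (R * R) => G' q.1 q.2)}) ->
  (forall s, t - e <= s <= t + e -> Defs.periodic (G' s)) ->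
  drv (fun s => tint (G s)) t (tint (G' t)).
Proof.
move=> e0 eG dG cG pG; have [M M0 GM] := locally_bounded cG pG.
have inI s : `]t - e, t + e[%classic s -> t - e <= s <= t + e.
  by rewrite /= in_itv/= => /andP[? ?]; rewrite !ltW.
have tI : `]t - e, t + e[%classic t by rewrite /= in_itv/=; apply/andP; split; lra.
have iG s : `]t - e, t + e[%classic s -> tm.-integrable setT (EFin \o G s).
  by move=> /inI sI; exact/essbounded_integrable/eG.
have dG' s y : `]t - e, t + e[%classic s -> setT y -> derivable (G ^~ y) s 1.
  by move=> /inI sI _; exact: drv_derivable (dG s y sI).
have iM : tm.-integrable setT (EFin \o (fun=> M)) by exact/essbounded_integrable/essbounded_cst.
have GM' s y : `]t - e, t + e[%classic s -> setT y -> `|partial1of2 G s y| <= M.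
  by move=> /inI sI _; rewrite /partial1of2 (drv_derive1 (dG s y sI)); exact: GM.
have -> : tint (G' t) = tint (partial1of2 G t).
  by apply: eq_tint => y; rewrite /partial1of2 (drv_derive1 (dG t y (inI t tI))).
apply: DeriveDef.
  exact: (@derivable_under_integral R _ _ tm G setT measurableT t _ _ tI iG dG' (fun=> M) (fun=> M0) iM GM').
rewrite -derive1E.
exact: (@differentiation_under_integral R _ _ tm G setT measurableT t _ _ tI iG dG' (fun=> M) (fun=> M0) iM GM').
Qed.

End UnderIntegral.

(** * The transport term and its defect in Fourier variables *)

Section GalerkinSystem.
Context {R : realType}.
Local Notation Re := complex.Re.
Local Notation Im := complex.Im.
Local Notation tm := (@torus_measure R).
Implicit Types (x y : R * R) (t s : R) (k p q : int * int) (z a : int * int -> R[i]).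

(** The symbol of u . grad w: the factors 2 pi of the two derivatives cancel the 4 pi^2 in [lam p],
    which is why [bs] contains no pi. *)
Lemma sqr_ci_bs p q : ci (wave1 p) * ci (wave2 q) * (- (lam p)^-1)%:C%C
  - ci (wave2 p) * ci (wave1 q) * (- (lam p)^-1)%:C%C = (bs p q)%:C%C :> R[i].
Proof.
have [->|p0] := eqVneq p 0.
  by rewrite lam0 /bs ksq0 !invr0 oppr0 !mulr0 subrr.
have l0 := @lam_neq0 R _ p0.
have k0 : ksq p != 0 :> R by rewrite gt_eqF// (lt_le_trans ltr01)// ksq_ge1.
have E : (wave1 p * wave2 q - wave2 p * wave1 q) / lam p = bs p q :> R.
  rewrite lamE /bs /wave1 /wave2; have := lt0r_neq0 (@pi_gt0 R).
  by move: pi => P P0; field; rewrite k0 P0.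
rewrite -E /ci; apply/eqP; rewrite eq_complex /=.
by apply/andP; split; apply/eqP; ring.
Qed.

Lemma waveN k : wave1 (- k) = - wave1 k :> R /\ wave2 (- k) = - wave2 k :> R.
Proof. by rewrite /wave1 /wave2 /= !mulrNz !mulrN. Qed.

Lemma lamN k : lam (- k) = lam k :> R.
Proof. by rewrite /lam (waveN k).1 (waveN k).2 !sqrrN. Qed.

Lemma bsN p q : bs (- p) (- q) = bs p q :> R.
Proof.
rewrite /bs /ksq /= !mulrNz !mulrNN !sqrrN.
by congr (_ / _); ring.
Qed.

Lemma mean_zero_coef (g : R * R -> R) : mean_zero g -> fourier_coef g 0 = 0.
Proof.
move=> g0; rewrite fourier_coefE.
have -> : tint (fun x => g x * cos (phase 0 x)) = 0.
  by rewrite -[RHS]g0; apply: eq_tint => x; rewrite phase0 cos0 mulr1.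
have -> : tint (fun x => g x * sin (phase 0 x)) = 0.
  by rewrite -[RHS](tint_cst 0); apply: eq_tint => x; rewrite phase0 sin0 mulr0.
by rewrite oppr0.
Qed.

Definition advection_sum N a x : R :=
  \sum_(p <- box N) \sum_(q <- box N) rmode ((bs p q)%:C%C * a p * a q) (p + q) x.

Lemma advection_tpoly N a x : a 0 = 0 -> (forall k, a (- k) = ((a k)^*)%C) ->
  advection (tpoly (box N) a) x = advection_sum N a x.
Proof.
move=> a0 as_; rewrite /advection /velocity inv_laplacian_tpoly// !(d1_tpoly, d2_tpoly) /=.
set b := fun k => (- (lam k)^-1)%:C%C * a k.
have bs_ k : b (- k) = ((b k)^*)%C.
  by rewrite /b lamN as_ rmorphM; congr (_ * _); rewrite /= oppr0.
have conj1 (c : int * int -> R[i]) : (forall k, c (- k) = ((c k)^*)%C) ->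
    (forall k, ci (wave1 (- k)) * c (- k) = ((ci (wave1 k) * c k)^*)%C) /\
    (forall k, ci (wave2 (- k)) * c (- k) = ((ci (wave2 k) * c k)^*)%C).
  move=> h; split=> k; rewrite h rmorphM ?(waveN k).1 ?(waveN k).2;
    by congr (_ * _); rewrite /ci /= ?oppr0.
have [b1 b2] := conj1 _ bs_; have [a1 a2] := conj1 _ as_.
have R1 := tpoly_real N x b1; have R2 := tpoly_real N x b2.
have Q1 := tpoly_real N x a1; have Q2 := tpoly_real N x a2.
transitivity (Re ((- tpoly (box N) (fun k => ci (wave2 k) * b k) x *
   tpoly (box N) (fun k => ci (wave1 k) * a k) x +
   tpoly (box N) (fun k => ci (wave1 k) * b k) x *
   tpoly (box N) (fun k => ci (wave2 k) * a k) x)%:C)%C) => //.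
have CE (u v u' v' : R) : (- u * v + u' * v')%:C%C = - u%:C%C * v%:C%C + u'%:C%C * v'%:C%C.
  by apply/eqP; rewrite eq_complex /=; apply/andP; split; apply/eqP; ring.
rewrite CE -R1 -R2 -Q1 -Q2.
rewrite mulNr !big_distrlr /= -sumrN -big_split /= Re_sum.
apply: eq_bigr => p _; rewrite -sumrN -big_split /= Re_sum.
apply: eq_bigr => q _; rewrite /rmode; congr Re.
rewrite fourier_modeD -sqr_ci_bs /b; ring.
Qed.

Lemma fourier_coef_advection_sum N a k : (forall k, a (- k) = ((a k)^*)%C) ->
  fourier_coef (advection_sum N a) k = nonlin N a k.
Proof.
move=> as_.
rewrite fourier_coef_sum; last first.
  by move=> *; apply: essbounded_sum => *; exact: essbounded_rmode.
pose z p q := (bs p q)%:C%C * a p * a q.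
have zs p q : z (- p) (- q) = ((z p q)^*)%C.
  by rewrite /z bsN !as_ !rmorphM /= oppr0.
pose A := \sum_(p <- box N) \sum_(q <- box N) (p + q == k)%:R * z p q.
(* Reflecting p and q conjugates each term, so the two halves of every real mode contribute equally
   and compensate the factor 1/2. *)
have AE : \sum_(p <- box N) \sum_(q <- box N) (p + q == - k)%:R * ((z p q)^*)%C = A.
  rewrite -sum_box_opp; apply: eq_bigr => p _; rewrite -sum_box_opp; apply: eq_bigr => q _.
  by rewrite zs conjcK -opprD eqr_opp.
rewrite -[nonlin N a k]/A.
transitivity (2^-1 * (A + A)); last by field.
rewrite -{2}AE mulrDr !mulr_sumr -big_split; apply: eq_bigr => p _ /=.
rewrite fourier_coef_sum; last by move=> *; exact: essbounded_rmode.
rewrite !mulr_sumr -big_split; apply: eq_bigr => q _ /=.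
by rewrite fourier_coef_rmode mulrDr.
Qed.

Lemma fourier_proj_advection_sum N a x :
  fourier_proj N (advection_sum N a) x = \sum_(p <- box N) \sum_(q <- box N)
    (p + q \in box N)%:R * rmode ((bs p q)%:C%C * a p * a q) (p + q) x.
Proof.
rewrite fourier_proj_sum; last first.
  by move=> *; apply: essbounded_sum => *; exact: essbounded_rmode.
apply: eq_bigr => p _; rewrite fourier_proj_sum; last by move=> *; exact: essbounded_rmode.
by apply: eq_bigr => q _; rewrite fourier_proj_rmode.
Qed.

Definition defect N a x : R := \sum_(p <- box N) \sum_(q <- box N)
  (p + q \notin box N)%:R * rmode ((bs p q)%:C%C * a p * a q) (p + q) x.

Lemma defectE N a x :
  defect N a x = advection_sum N a x - fourier_proj N (advection_sum N a) x.
Proof.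
rewrite fourier_proj_advection_sum /advection_sum -sumrB; apply: eq_bigr => p _.
rewrite -sumrB; apply: eq_bigr => q _.
by case: (_ \in _) => /=; rewrite ?mul1r ?mul0r ?subrr ?subr0.
Qed.

Variables (N : nat) (f : R * R -> R) (w : R -> R * R -> R).
Hypothesis (sol : solution N (fourier_proj N f) w).

(** Freezing the solution at negative times makes it continuous on full neighbourhoods of t = 0,
    where [w] itself is only continuous from the right. *)
Let W t := w (Num.max t 0).

Lemma clip_continuous (p : R * (R * R)) :
  {for p, continuous (fun q : R * (R * R) => W q.1 q.2)}.
Proof.
have := solution_continuous sol.
move=> cw; apply: (@continuous_comp_within _ _ _ _ (fun p : R * (R * R) => w p.1 p.2)
  (fun q : R * (R * R) => (Num.max q.1 0, q.2)) p cw); last first.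
  by move=> y /=; rewrite le_max lexx orbT.
have c2 : q.2 @[q --> p] --> p.2 by exact: cvg_snd.
have c1 : Num.max q.1 0 @[q --> p] --> Num.max p.1 0.
  apply: (continuous_comp (f := fst) (g := fun s : R => Num.max s 0)); first exact: cvg_fst.
  by apply: continuous_max; [exact: cvg_id|exact: cvg_cst].
exact: (cvg_pair c1 c2).
Qed.

Lemma clipE t : 0 <= t -> W t = w t.
Proof. by move=> t0; rewrite /W max_l. Qed.

Lemma solution_cont t : 0 <= t -> continuous (w t).
Proof.
move=> t0; rewrite -clipE//; apply: continuous_fixed_time => x; exact: clip_continuous.
Qed.

Lemma solution_essbounded t : 0 <= t -> essbounded (w t).
Proof.
move=> t0; apply: essbounded_continuous; first exact: solution_cont.
exact: solution_periodic sol _ t0.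
Qed.

Lemma solution_C2 t : 0 < t -> C2 (w t).
Proof. by move=> t0; case: (solution_C12 sol) => _ h _ _ _; exact: h. Qed.

Lemma drv_solution t x : 0 < t -> drv (fun s => w s x) t (dt w t x).
Proof. by move=> t0; case: (solution_C12 sol) => h _ _ _ _; apply: drvP; exact: h. Qed.

Lemma periodic_dt t : 0 < t -> Defs.periodic (dt w t).
Proof.
move=> t0.
have near_t (P : R -> Prop) : (forall s, 0 < s -> P s) -> \forall s \near t, P s.
  by move=> h; near=> s; apply: h; near: s; exact: lt_nbhsr.
move=> x; split; rewrite /dt !derive1E; apply: near_eq_derive;
  rewrite ?oner_eq0//; apply: near_t => s s0.
- by rewrite (solution_periodic sol (ltW s0) x).1.
- by rewrite (solution_periodic sol (ltW s0) x).2.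
Unshelve. all: by end_near. Qed.

Definition coefs t k : R[i] := fourier_coef (w t) k.

Lemma coefs_sym t k : coefs t (- k) = ((coefs t k)^*)%C.
Proof. exact: fourier_coef_sym. Qed.

Lemma coefs0 t : 0 <= t -> coefs t 0 = 0.
Proof. by move=> t0; exact: mean_zero_coef (solution_mean_zero sol t0). Qed.

Lemma drv_tint_mul (g : R * R -> R) t : continuous g -> Defs.periodic g -> 0 < t ->
  drv (fun s => tint (fun x => w s x * g x)) t (tint (fun x => dt w t x * g x)).
Proof.
move=> cg pg t0; have eg := essbounded_continuous cg pg.
have pos s : t - t / 2 <= s <= t + t / 2 -> 0 < s by move=> /andP[h _]; lra.
apply: (@drv_tint R (fun s y => w s y * g y) (fun s y => dt w s y * g y) t (t / 2)).
- by rewrite divr_gt0.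
- by move=> s /pos s0; apply: essboundedM eg; exact/solution_essbounded/ltW.
- move=> s x /pos s0.
  have h := drvM (drv_solution x s0) (drv_cst s (g x)).
  by rewrite mulr0 addr0 in h.
- move=> p /pos p0; apply: cvgM; first by case: (solution_C12 sol) => _ _ h _ _; exact: h.
  by apply: continuous_comp; [exact: cvg_snd|exact: cg].
- move=> s /pos s0; exact: (periodicM (periodic_dt s0) pg).
Qed.

End GalerkinSystem.

(** * The coefficient equations; the solution is a trigonometric polynomial *)

Section GalerkinCoefficients.
Context {R : realType}.
Local Notation Re := complex.Re.
Local Notation Im := complex.Im.
Implicit Types (x y : R * R) (t s : R) (k p q : int * int).

Lemma Re_fourier_coef (g : R * R -> R) k :
  Re (fourier_coef g k) = tint (fun x => g x * cos (phase k x)).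
Proof. by []. Qed.

Lemma Im_fourier_coef (g : R * R -> R) k :
  Im (fourier_coef g k) = - tint (fun x => g x * sin (phase k x)).
Proof. by []. Qed.

Variables (N : nat) (f : R * R -> R) (w : R -> R * R -> R).
Hypothesis (sol : solution N (fourier_proj N f) w).
Local Notation a := (coefs w).

Let pw t (t0 : 0 < t) : Defs.periodic (w t).
Proof. exact: (solution_periodic sol (ltW t0)). Qed.

Lemma fourier_coef_dt t k : 0 < t -> fourier_coef (dt w t) k =
  (- lam k)%:C%C * a t k - (k \in box N)%:R * fourier_coef (advection (w t)) k.
Proof.
move=> t0; rewrite -(fourier_coef_laplacian k (pw t0) (solution_C2 sol t0)).
rewrite -fourier_coef_proj -fourier_coefB.
- by apply: eq_fourier_coef => x; rewrite -(solution_eq sol x t0) addrK.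
- exact: essbounded_laplacian (pw t0) (solution_C2 sol t0).
- have -> : fourier_proj N (advection (w t)) = tpoly (box N) (fourier_coef (advection (w t))).
    by apply/funext => x; rewrite fourier_proj_tpoly.
  exact: essbounded_tpoly.
Qed.

Lemma drv_coefs t k : 0 < t ->
  drv (fun s => Re (a s k)) t (Re (fourier_coef (dt w t) k)) /\
  drv (fun s => Im (a s k)) t (Im (fourier_coef (dt w t) k)).
Proof.
move=> t0; rewrite Re_fourier_coef Im_fourier_coef; split.
  have h := drv_tint_mul sol (@continuous_cos_phase R k) (@periodic_cos R k) t0.
  by apply: drv_ext h => s; rewrite /coefs Re_fourier_coef.
have h := drvN (drv_tint_mul sol (@continuous_sin_phase R k) (@periodic_sin R k) t0).
by apply: drv_ext h => s; rewrite /coefs Im_fourier_coef.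
Qed.

Lemma drv_rmode_coefs t k x : 0 < t ->
  drv (fun s => rmode (a s k) k x) t (rmode (fourier_coef (dt w t) k) k x).
Proof.
move=> t0; have [h1 h2] := drv_coefs k t0.
apply: drv_ext (drv_eq (drvB (drvM h1 (drv_cst t (cos (phase k x))))
  (drvM h2 (drv_cst t (sin (phase k x))))) _) => [s|]; first by rewrite rmodeE.
by rewrite rmodeE !mulr0 !addr0.
Qed.

Let W t := w (Num.max t 0).

Lemma coefs_clip_continuous k t :
  {for t, continuous (fun s => Re (a (Num.max s 0) k))} /\
  {for t, continuous (fun s => Im (a (Num.max s 0) k))}.
Proof.
have pW s : Defs.periodic (W s).
  by apply: (solution_periodic sol); rewrite le_max lexx orbT.
have key (g : R * R -> R) : continuous g -> Defs.periodic g ->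
    {for t, continuous (fun s => tint (fun x => W s x * g x))}.
  move=> cg pg; apply: (@continuous_tint R (fun s x => W s x * g x) t 1) => //.
    move=> p _; have c1 : {for p, continuous (fun q : R * (R * R) => W q.1 q.2)}.
      exact: (clip_continuous sol).
    have c2 : {for p, continuous (fun q : R * (R * R) => g q.2)}.
      by apply: continuous_comp; [exact: cvg_snd|exact: cg].
    exact: (cvgM c1 c2).
  by move=> s _; exact: (periodicM (pW s) pg).
have rE : (fun s => Re (a (Num.max s 0) k)) = (fun s => tint (fun x => W s x * cos (phase k x))).
  by apply/funext => s; rewrite /coefs Re_fourier_coef.
have iE : (fun s => Im (a (Num.max s 0) k)) = (fun s => - tint (fun x => W s x * sin (phase k x))).
  by apply/funext => s; rewrite /coefs Im_fourier_coef.
rewrite rE iE; split; first exact: key (@continuous_cos_phase R k) (@periodic_cos R k).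
exact: (cvgN (key _ (@continuous_sin_phase R k) (@periodic_sin R k))).
Qed.

Lemma coefs_continuous k (b c : R) : 0 <= b ->
  {within `[b, c], continuous (fun s => Re (a s k))} /\
  {within `[b, c], continuous (fun s => Im (a s k))}.
Proof.
move=> b0; split.
  apply: (@subspace_eq_continuous _ _ _ (fun s => Re (a (Num.max s 0) k))).
    by move=> s; rewrite inE /= in_itv/= => /andP[bs _]; rewrite max_l// (le_trans b0).
  by apply: continuous_subspaceT => t; exact: (coefs_clip_continuous k t).1.
apply: (@subspace_eq_continuous _ _ _ (fun s => Im (a (Num.max s 0) k))).
  by move=> s; rewrite inE /= in_itv/= => /andP[bs _]; rewrite max_l// (le_trans b0).
by apply: continuous_subspaceT => t; exact: (coefs_clip_continuous k t).2.
Qed.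

Lemma coefs_init k : a 0 k = (k \in box N)%:R * fourier_coef f k.
Proof.
rewrite -fourier_coef_proj; apply: eq_fourier_coef => x; exact: (solution_init sol).
Qed.

Let defw t x : R := w t x - tpoly (box N) (a t) x.

Let defw_continuous T :
  {within [set p : R * (R * R) | 0 <= p.1 <= T],
     continuous (fun p : R * (R * R) => defw p.1 p.2)}.
Proof.
apply: (@subspace_eq_continuous _ _ _
  (fun p : R * (R * R) => W p.1 p.2 - tpoly (box N) (a (Num.max p.1 0)) p.2)).
  by move=> p; rewrite inE /= => /andP[p0 _]; rewrite /defw /W max_l.
apply: continuous_subspaceT => p.
have c1 : {for p, continuous (fun q : R * (R * R) => W q.1 q.2)}.
  exact: (clip_continuous sol).
suff c2 : {for p, continuous (fun q : R * (R * R) => tpoly (box N) (a (Num.max q.1 0)) q.2)}.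
  exact: (cvgB c1 c2).
rewrite /tpoly.
apply: (@continuous_bigsum R _ _ _ _ (fun k (q : R * (R * R)) => rmode (a (Num.max q.1 0) k) k q.2)).
move=> k _.
have -> : (fun q : R * (R * R) => rmode (a (Num.max q.1 0) k) k q.2) =
    (fun q : R * (R * R) => Re (a (Num.max q.1 0) k) * cos (phase k q.2)
      - Im (a (Num.max q.1 0) k) * sin (phase k q.2)).
  by apply/funext => q; rewrite rmodeE.
move=> q.
have e1 : {for q, continuous (fun r : R * (R * R) => Re (a (Num.max r.1 0) k))}.
  apply: (continuous_comp (f := fst) (g := fun s : R => Re (a (Num.max s 0) k))).
    exact: cvg_fst.
  exact: (coefs_clip_continuous k q.1).1.
have e2 : {for q, continuous (fun r : R * (R * R) => Im (a (Num.max r.1 0) k))}.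
  apply: (continuous_comp (f := fst) (g := fun s : R => Im (a (Num.max s 0) k))).
    exact: cvg_fst.
  exact: (coefs_clip_continuous k q.1).2.
have e3 : {for q, continuous (fun r : R * (R * R) => cos (phase k r.2))}.
  apply: (continuous_comp (f := snd) (g := fun y : R * R => cos (phase k y))).
    exact: cvg_snd.
  exact: continuous_cos_phase.
have e4 : {for q, continuous (fun r : R * (R * R) => sin (phase k r.2))}.
  apply: (continuous_comp (f := snd) (g := fun y : R * R => sin (phase k y))).
    exact: cvg_snd.
  exact: continuous_sin_phase.
exact: (cvgB (cvgM e1 e3) (cvgM e2 e4)).
Qed.

Let drv_defw t x : 0 < t -> drv (fun s => defw s x) t (dt w t x
  - tpoly (box N) (fourier_coef (dt w t)) x).
Proof.
move=> t0; apply: drvB (drv_solution sol x t0) _.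
exact: (@drv_sum R _ (box N) xpredT (fun k s => rmode (a s k) k x) _ t
  (fun k _ => drv_rmode_coefs k x t0)).
Qed.

Let defw_C2 t : 0 < t -> C2 (defw t) /\
  forall x, laplacian (defw t) x = laplacian (w t) x - tpoly (box N) (fun k => (- lam k)%:C%C * a t k) x.
Proof.
move=> t0; have [h1 h2] := C2B (solution_C2 sol t0) (C2_tpoly (box N) (a t)).
split => // x; rewrite -laplacian_tpoly; exact: h2.
Qed.

(** The projected transport term has no frequency outside the box, so it cancels in the
    difference. *)
Let defw_heat t x : 0 < t -> dt defw t x = laplacian (defw t) x.
Proof.
move=> t0; rewrite /dt (drv_derive1 (drv_defw x t0)) (defw_C2 t0).2.
have E := solution_eq sol x t0.
have E2 : tpoly (box N) (fourier_coef (dt w t)) x =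
    tpoly (box N) (fun k => (- lam k)%:C%C * a t k) x - fourier_proj N (advection (w t)) x.
  rewrite fourier_proj_tpoly /tpoly -sumrB; apply: eq_big_seq => k kN.
  by rewrite fourier_coef_dt// kN mul1r rmodeB.
rewrite E2 -E; move: (dt w t x) (fourier_proj _ _ _) (tpoly _ _ _) => u v z; ring.
Qed.

Let defw_periodic t : 0 <= t -> Defs.periodic (defw t).
Proof.
move=> t0; apply: periodicB (periodic_tpoly _ _); exact: (solution_periodic sol t0).
Qed.

Let defw_init x : defw 0 x = 0.
Proof.
rewrite /defw (solution_init sol) fourier_proj_tpoly (@eq_tpoly R _ _ (a 0)) ?subrr//.
by move=> k kN; rewrite coefs_init kN mul1r.
Qed.

Lemma solution_tpoly t x : 0 <= t -> w t x = tpoly (box N) (a t) x.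
Proof.
move=> t0; have tt : 0 <= t <= t by rewrite t0 lexx.
have le0 : defw t x <= 0.
  apply: (@parabolic_max_principle R defw 0 t 0 _ _ _ _ _ _ t x tt).
  - exact: defw_continuous.
  - by move=> s /andP[s0 _]; exact: defw_periodic.
  - by move=> s y /andP[s0 _]; exact: drv_derivable (drv_defw y s0).
  - by move=> s /andP[s0 _]; exact: C2_slices (defw_C2 s0).1.
  - by move=> s y /andP[s0 _] _ _; rewrite (defw_heat y s0).
  - by move=> y; rewrite defw_init.
have ge0 : - defw t x <= 0.
  (* The opposite is written as a difference with the zero polynomial, so that [C2B] applies to
     it. *)
  have zC := C2_tpoly [::] (fun=> 0 : R[i]).
  have zE : tpoly [::] (fun=> 0 : R[i]) = (fun=> 0 : R).
    by apply/funext => y; rewrite /tpoly big_nil.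
  rewrite zE in zC.
  have nE s : (fun y => - defw s y) = (fun y => 0 - defw s y).
    by apply/funext => y; rewrite sub0r.
  have z2 y : laplacian (fun=> 0 : R) y = 0.
    by rewrite -zE laplacian_tpoly /tpoly big_nil.
  apply: (@parabolic_max_principle R (fun s y => - defw s y) 0 t 0 _ _ _ _ _ _ t x tt).
  - move=> p; exact: (cvgN (@defw_continuous t p)).
  - by move=> s /andP[s0 _] y; rewrite !(defw_periodic s0 y).1 !(defw_periodic s0 y).2.
  - by move=> s y /andP[s0 _]; exact: drv_derivable (drvN (drv_defw y s0)).
  - move=> s /andP[s0 _]; rewrite nE; exact: C2_slices (C2B zC (defw_C2 s0).1).1.
  - move=> s y /andP[s0 _] _ _; rewrite nE (C2B zC (defw_C2 s0).1).2 z2 sub0r.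
    rewrite -(defw_heat y s0) /dt (drv_derive1 (drv_defw y s0)).
    by rewrite (drv_derive1 (drvN (drv_defw y s0))).
  - by move=> y; rewrite defw_init oppr0.
by apply/eqP; rewrite -subr_eq0 eq_le le0 -oppr_le0.
Qed.

Lemma solution_advection t x : 0 <= t -> advection (w t) x = advection_sum N (a t) x.
Proof.
move=> t0; rewrite -advection_tpoly; first last.
- by move=> k; exact: coefs_sym.
- exact: (coefs0 sol t0).
by have -> : w t = tpoly (box N) (a t) by apply/funext => y; exact: solution_tpoly.
Qed.

Lemma fourier_coef_dt_nonlin t k : 0 < t -> k \in box N ->
  fourier_coef (dt w t) k = (- lam k)%:C%C * a t k - nonlin N (a t) k.
Proof.
move=> t0 kN; rewrite fourier_coef_dt// kN mul1r; congr (_ - _).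
rewrite -fourier_coef_advection_sum; last by move=> ?; exact: coefs_sym.
by apply: eq_fourier_coef => x; exact/solution_advection/ltW.
Qed.

Lemma solution_critical t x : 0 < t -> d1 (w t) x = 0 -> d2 (w t) x = 0 ->
  dt w t x = laplacian (w t) x + defect N (a t) x.
Proof.
move=> t0 e1 e2; have E := solution_eq sol x t0; have t0' := ltW t0.
have A0 : advection_sum N (a t) x = 0.
  by rewrite -solution_advection// /advection e1 e2 !mulr0 addr0.
rewrite defectE A0 sub0r -E.
have -> : fourier_proj N (advection (w t)) = fourier_proj N (advection_sum N (a t)).
  by have -> : advection (w t) = advection_sum N (a t) by apply/funext => y; exact: solution_advection.
by rewrite addrK.
Qed.

End GalerkinCoefficients.

(** * Energy estimates *)

Section Energy.
Context {R : realType}.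
Local Notation Re := complex.Re.
Local Notation Im := complex.Im.
Implicit Types (t s T : R) (k p q : int * int) (g h : R -> R).

(** Continuity up to the initial time, where the equation gives no derivative; this is the form that
    [drv_le] asks for. *)
Definition cont0 g := forall T, {within `[0, T], continuous g}.

Lemma cont0_continuous g : continuous g -> cont0 g.
Proof. by move=> cg T; exact: continuous_subspaceT. Qed.

Lemma cont0D g h : cont0 g -> cont0 h -> cont0 (fun s => g s + h s).
Proof. by move=> cg ch T x; exact: (cvgD (cg T x) (ch T x)). Qed.

Lemma cont0N g : cont0 g -> cont0 (fun s => - g s).
Proof. by move=> cg T x; exact: (cvgN (cg T x)). Qed.

Lemma cont0B g h : cont0 g -> cont0 h -> cont0 (fun s => g s - h s).
Proof. by move=> cg ch; exact: cont0D cg (cont0N ch). Qed.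

Lemma cont0M g h : cont0 g -> cont0 h -> cont0 (fun s => g s * h s).
Proof. by move=> cg ch T x; exact: (cvgM (cg T x) (ch T x)). Qed.

Lemma cont0_drv g (dg : R -> R) : (forall t, drv g t (dg t)) -> cont0 g.
Proof. by move=> h; apply: cont0_continuous => t; exact: drv_continuous (h t). Qed.

Lemma cont0_cst (c : R) : cont0 (fun=> c).
Proof. by apply: cont0_drv => t; exact: drv_cst. Qed.

Lemma cont0_sum (I : Type) (r : seq I) (F : I -> R -> R) :
  (forall i, cont0 (F i)) -> cont0 (fun s => \sum_(i <- r) F i s).
Proof.
move=> cF; elim: r => [|i r IH] T.
  have -> : (fun s => \sum_(j <- [::]) F j s) = (fun=> 0) by apply/funext => s; rewrite big_nil.
  exact: cont0_cst.
have -> : (fun s => \sum_(j <- i :: r) F j s) = (fun s => F i s + \sum_(j <- r) F j s).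
  by apply/funext => s; rewrite big_cons.
exact: (cont0D (cF i) IH).
Qed.

(** All that the energy estimates use of a solution: the finite system of equations at positive
    times, and continuity down to t = 0. *)
Record galerkin N (z : int * int -> R[i]) (a : R -> int * int -> R[i]) : Prop := Galerkin {
  galerkin_sym : forall t k, a t (- k) = ((a t k)^*)%C;
  galerkin0 : forall t, 0 <= t -> a t 0 = 0;
  galerkin_cont : forall k, cont0 (fun s => Re (a s k)) /\ cont0 (fun s => Im (a s k));
  galerkin_drv : forall t k, 0 < t -> k \in box N ->
    drv (fun s => Re (a s k)) t (Re ((- lam k)%:C%C * a t k - nonlin N (a t) k)) /\
    drv (fun s => Im (a s k)) t (Im ((- lam k)%:C%C * a t k - nonlin N (a t) k));
  galerkin_init : forall k, k \in box N -> a 0 k = z k }.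

Lemma solution_galerkin N (f : R * R -> R) (w : R -> R * R -> R) :
  solution N (fourier_proj N f) w -> galerkin N (fourier_coef f) (coefs w).
Proof.
move=> sol; split.
- by move=> t k; exact: coefs_sym.
- by move=> t t0; exact: (coefs0 sol t0).
- by move=> k; split=> T; have [h1 h2] := coefs_continuous sol k T (lexx 0).
- move=> t k t0 kN; rewrite -(fourier_coef_dt_nonlin sol t0 kN).
  exact: (drv_coefs sol k t0).
- by move=> k kN; rewrite (coefs_init sol) kN mul1r.
Qed.

Lemma drv_Sob N j (c : R -> int * int -> R[i]) (r : int * int -> R[i]) t :
  (forall k, k \in box N -> drv (fun s => Re (c s k)) t (Re (r k)) /\
     drv (fun s => Im (c s k)) t (Im (r k))) ->
  drv (fun s => Sob N j (c s)) t (\sum_(k <- box N) ksq k ^+ j * (2 * dotc (c t k) (r k))).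
Proof.
move=> h; rewrite big_seq.
apply: (@drv_ext R (fun s => \sum_(k <- box N | k \in box N) ksq k ^+ j * nsq (c s k))).
  by move=> s; rewrite /Sob [RHS]big_seq.
apply: (@drv_sum R _ (box N) (fun k => k \in box N) (fun k s => ksq k ^+ j * nsq (c s k))).
move=> k /h [h1 h2].
apply: drv_eq (drvZ (ksq k ^+ j) (drvD (drv_sqr h1) (drv_sqr h2))) _.
by congr (_ * _); rewrite /dotc; ring.
Qed.

Lemma cont0_Sob N j (c : R -> int * int -> R[i]) :
  (forall k, cont0 (fun s => Re (c s k)) /\ cont0 (fun s => Im (c s k))) ->
  cont0 (fun s => Sob N j (c s)).
Proof.
move=> h; apply: cont0_sum => k; have [h1 h2] := h k.
apply: cont0M; first exact: cont0_cst.
by apply: cont0D; under eq_fun do rewrite expr2; exact: cont0M.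
Qed.

Definition heat (z : int * int -> R[i]) t k : R[i] := (expR (- lam k * t))%:C%C * z k.

Lemma drv_heat z t k :
  drv (fun s => Re (heat z s k)) t (Re ((- lam k)%:C%C * heat z t k)) /\
  drv (fun s => Im (heat z s k)) t (Im ((- lam k)%:C%C * heat z t k)).
Proof.
have de : drv (fun s => expR (- lam k * s)) t (expR (- lam k * t) * (- lam k)).
  apply: drv_exp; apply: drv_eq (drvZ (- lam k) (drv_id t)) _; by rewrite mulr1.
split.
  apply: drv_ext (drv_eq (drvM de (drv_cst t (Re (z k)))) _) => [s|].
    by rewrite /heat; case: (z k) => ? ? /=; rewrite mul0r subr0.
  by rewrite /heat; case: (z k) => ? ? /=; ring.
apply: drv_ext (drv_eq (drvM de (drv_cst t (Im (z k)))) _) => [s|].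
  by rewrite /heat; case: (z k) => ? ? /=; rewrite mul0r addr0.
by rewrite /heat; case: (z k) => ? ? /=; ring.
Qed.

Lemma cont0_heat z k :
  cont0 (fun s => Re (heat z s k)) /\ cont0 (fun s => Im (heat z s k)).
Proof. by split; apply: cont0_drv => t; [exact: (drv_heat z t k).1|exact: (drv_heat z t k).2]. Qed.

Variables (N : nat) (z : int * int -> R[i]) (a : R -> int * int -> R[i]) (M : R).
Hypotheses (gal : galerkin N z a) (z00 : z 0 = 0) (zM : Sob N 0 z <= M ^+ 2).

Let b t k := a t k - heat z t k.
(** Bounds the square of [velo] at all times, see [galerkin_velo]. *)
Let K := M ^+ 2 * Lam N.
Let rhs t k := (- lam k)%:C%C * a t k - nonlin N (a t) k.

Lemma ReB (u v : R[i]) : Re (u - v) = Re u - Re v.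
Proof. by case: u v => ? ? [? ?]. Qed.

Lemma ImB (u v : R[i]) : Im (u - v) = Im u - Im v.
Proof. by case: u v => ? ? [? ?]. Qed.

(** The heat flow drops out of the linear part, but the forcing remains the nonlinearity of the full
    [a]. Hence the estimates for [b] below always come with sums of [a]. *)
Let drv_b t k : 0 < t -> k \in box N ->
  drv (fun s => Re (b s k)) t (Re ((- lam k)%:C%C * b t k - nonlin N (a t) k)) /\
  drv (fun s => Im (b s k)) t (Im ((- lam k)%:C%C * b t k - nonlin N (a t) k)).
Proof.
move=> t0 kN; have [h1 h2] := galerkin_drv gal t0 kN; have [g1 g2] := drv_heat z t k.
have E : (- lam k)%:C%C * b t k - nonlin N (a t) k =
  ((- lam k)%:C%C * a t k - nonlin N (a t) k) - (- lam k)%:C%C * heat z t k.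
  by rewrite /b; ring.
rewrite E; split.
  by rewrite ReB; apply: drv_ext (drvB h1 g1) => s; rewrite /b ReB.
by rewrite ImB; apply: drv_ext (drvB h2 g2) => s; rewrite /b ImB.
Qed.

Let cont_b k : cont0 (fun s => Re (b s k)) /\ cont0 (fun s => Im (b s k)).
Proof.
have [h1 h2] := galerkin_cont gal k; have [g1 g2] := cont0_heat z k; split.
  by under eq_fun do rewrite /b ReB; exact: cont0B.
by under eq_fun do rewrite /b ImB; exact: cont0B.
Qed.

Let b0 t : 0 <= t -> b t 0 = 0.
Proof. by move=> t0; rewrite /b (galerkin0 gal t0) /heat z00 mulr0 subrr. Qed.

Let Sob_a0 : Sob N 0 (a 0) <= M ^+ 2.
Proof.
suff -> : Sob N 0 (a 0) = Sob N 0 z by [].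
by apply: eq_big_seq => k kN; rewrite (galerkin_init gal kN).
Qed.

Let Sob_b0 j : Sob N j (b 0) = 0.
Proof.
rewrite /Sob big_seq big1// => k kN.
have -> : b 0 k = 0.
  by rewrite /b (galerkin_init gal kN) /heat mulr0 expR0 mul1r subrr.
by rewrite /nsq /= expr0n addr0 mulr0.
Qed.

Let dS0 t := \sum_(k <- box N) ksq k ^+ 0 * (2 * dotc (a t k) (rhs t k)).

Let drv_S0 t : 0 < t -> drv (fun s => Sob N 0 (a s)) t (dS0 t).
Proof. by move=> t0; apply: drv_Sob => k kN; exact: (galerkin_drv gal t0 kN). Qed.

Let dS0_le t : dS0 t <= - 32 * Sob N 1 (a t).
Proof.
have -> : dS0 t = \sum_(k <- box N) (2 * dotc (a t k) (rhs t k)).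
  by apply: eq_bigr => k _; rewrite expr0 mul1r.
apply: Sob0_deriv_le; exact: galerkin_sym gal t.
Qed.

Lemma galerkin_energy t : 0 <= t -> Sob N 0 (a t) <= M ^+ 2.
Proof.
move=> t0; have c0 := @cont0_Sob N 0 a (galerkin_cont gal) t.
have := @drv_le R (fun s => Sob N 0 (a s)) (fun=> 0) dS0 (fun=> 0) 0 t t0 c0 (@cont0_cst 0 t).
have drv0 s : 0 < s < t -> drv (fun s => Sob N 0 (a s)) s (dS0 s) by move=> /andP[s0 _]; exact: drv_S0.
move=> /(_ drv0 (fun s _ => drv_cst s 0)) h.
have {}h : Sob N 0 (a t) - Sob N 0 (a 0) <= 0 - 0.
  apply: h => s _; apply: le_trans (dS0_le s) _.
  by rewrite mulNr oppr_le0 mulr_ge0// Sob_ge0.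
by rewrite subrr subr_le0 in h; exact: le_trans h Sob_a0.
Qed.

Lemma galerkin_velo t : 0 <= t -> velo N (a t) ^+ 2 <= K.
Proof.
move=> t0; apply: le_trans (velo_le N (a t)) _.
by rewrite ler_wpM2r ?Lam_ge0// galerkin_energy.
Qed.

Let n0_le t : 0 <= t -> Sob N 0 (nonlin N (a t)) <= K * Sob N 1 (a t).
Proof.
move=> t0; apply: le_trans (Sob0_nonlin N (a t)) _.
by rewrite ler_wpM2r ?Sob_ge0// galerkin_velo.
Qed.

Let n1_le t : 0 <= t -> Sob N 1 (nonlin N (a t)) <= 4 * K * Sob N 2 (a t).
Proof.
move=> t0; apply: le_trans (Sob1_nonlin N (a t)) _.
have h1 := gradl1_le N (a t); have h2 := galerkin_velo t0; have h3 := galerkin_energy t0.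
have S0 := Sob_ge0 N 0 (a t); have S2 := Sob_ge0 N 2 (a t); have L0 := Lam_ge0 N : 0 <= Lam N :> R.
have e1 : gradl1 N (a t) ^+ 2 * Sob N 0 (a t) <= K * Sob N 2 (a t).
  apply: le_trans (ler_wpM2r S0 h1) _.
  rewrite -mulrA [leLHS]mulrC; apply: ler_wpM2r => //.
  by rewrite mulrC /K; exact: ler_wpM2r.
have e2 := ler_wpM2r S2 h2.
move: e1 e2; rewrite -[4 * K * _]mulrA.
move: (gradl1 _ _ ^+ 2 * _) (velo _ _ ^+ 2 * _) (K * _) => x y u; lra.
Qed.

Let dS1 t := \sum_(k <- box N) ksq k ^+ 1 * (2 * dotc (a t k) (rhs t k)).
Let dB j t := \sum_(k <- box N) ksq k ^+ j * (2 * dotc (b t k) ((- lam k)%:C%C * b t k - nonlin N (a t) k)).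

Let drv_S1 t : 0 < t -> drv (fun s => Sob N 1 (a s)) t (dS1 t).
Proof. by move=> t0; apply: drv_Sob => k kN; exact: (galerkin_drv gal t0 kN). Qed.

Let drv_B j t : 0 < t -> drv (fun s => Sob N j (b s)) t (dB j t).
Proof. by move=> t0; apply: drv_Sob => k kN; exact: drv_b. Qed.

Let dS1_le t : 0 < t -> dS1 t <= - 31 * Sob N 2 (a t) + K * Sob N 1 (a t).
Proof.
move=> t0; apply: le_trans (Sob_deriv_le N 0 (a t) (nonlin N (a t))) _.
by rewrite lerD2l n0_le// ltW.
Qed.

Let dB1_le t : 0 < t -> dB 1 t <= - 31 * Sob N 2 (b t) + K * Sob N 1 (a t).
Proof.
move=> t0; apply: le_trans (Sob_deriv_le N 0 (b t) (nonlin N (a t))) _.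
by rewrite lerD2l n0_le// ltW.
Qed.

Let dB2_le t : 0 < t -> dB 2 t <= - 31 * Sob N 3 (b t) + 4 * K * Sob N 2 (a t).
Proof.
move=> t0; apply: le_trans (Sob_deriv_le N 1 (b t) (nonlin N (a t))) _.
by rewrite lerD2l n1_le// ltW.
Qed.

Let K0 : 0 <= K.
Proof. by rewrite /K mulr_ge0 ?sqr_ge0 ?Lam_ge0. Qed.

Let drv_exp1 t : drv (fun s => expR s) t (expR t).
Proof. by apply: drv_eq (drv_exp (drv_id t)) _; rewrite mulr1. Qed.

(** The factor s in [E1] makes it vanish at time 0, where S_1 of the data is not controlled. The
    factor e^s is there because [defect_long] needs 1 / (s e^s) integrable at infinity; it is
    affordable because nonzero frequencies have |k| >= 1. The weight e^(2s) dominates the derivative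
    of s e^s. *)
Let E0 s := expR s ^+ 2 * Sob N 0 (a s).
Let E1 s := s * expR s * Sob N 1 (a s).
Let F1 s := expR s ^+ 2 * Sob N 1 (b s).
Let F2 s := s * expR s * Sob N 2 (b s).
Let dE0 t := 2 * expR t * expR t * Sob N 0 (a t) + expR t ^+ 2 * dS0 t.
Let dE1 t := (1 * expR t + t * expR t) * Sob N 1 (a t) + t * expR t * dS1 t.
Let dF1 t := 2 * expR t * expR t * Sob N 1 (b t) + expR t ^+ 2 * dB 1 t.
Let dF2 t := (1 * expR t + t * expR t) * Sob N 2 (b t) + t * expR t * dB 2 t.

Let drv_E0 t : 0 < t -> drv E0 t (dE0 t).
Proof. by move=> t0; exact: drvM (drv_sqr (drv_exp1 t)) (drv_S0 t0). Qed.
Let drv_E1 t : 0 < t -> drv E1 t (dE1 t).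
Proof. by move=> t0; exact: drvM (drvM (drv_id t) (drv_exp1 t)) (drv_S1 t0). Qed.
Let drv_F1 t : 0 < t -> drv F1 t (dF1 t).
Proof. by move=> t0; exact: drvM (drv_sqr (drv_exp1 t)) (drv_B 1 t0). Qed.
Let drv_F2 t : 0 < t -> drv F2 t (dF2 t).
Proof. by move=> t0; exact: drvM (drvM (drv_id t) (drv_exp1 t)) (drv_B 2 t0). Qed.

Let cexp2 : cont0 (fun s : R => expR s ^+ 2).
Proof. by apply: cont0_drv => t; exact: drv_sqr (drv_exp1 t). Qed.
Let ctexp : cont0 (fun s : R => s * expR s).
Proof. by apply: cont0_drv => t; exact: drvM (drv_id t) (drv_exp1 t). Qed.

Let cE0 : cont0 E0. Proof. exact: cont0M cexp2 (cont0_Sob (galerkin_cont gal)). Qed.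
Let cE1 : cont0 E1. Proof. exact: cont0M ctexp (cont0_Sob (galerkin_cont gal)). Qed.
Let cF1 : cont0 F1. Proof. exact: cont0M cexp2 (cont0_Sob cont_b). Qed.
Let cF2 : cont0 F2. Proof. exact: cont0M ctexp (cont0_Sob cont_b). Qed.

Let weights t : 0 < t -> [/\ 0 <= t * expR t, t * expR t <= expR t ^+ 2 &
  expR t + t * expR t <= expR t ^+ 2].
Proof.
move=> t0; have e1 := expR_ge1Dx t; have t0' := ltW t0.
have e0 := expR_ge0 t.
rewrite expr2; split; first exact: mulr_ge0.
- have -> : expR t * expR t = t * expR t + (expR t - t) * expR t by ring.
  by rewrite lerDl mulr_ge0//; lra.
- by rewrite -[X in X + _]mul1r -mulrDl ler_wpM2r//; lra.
Qed.

(** The derivative of the weight costs 2 S_0 <= 2 S_1, taken from the dissipation: 30 = 32 - 2.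
    Likewise 29 = 31 - 2 in [dF1_le]. *)
Let dE0_le t : 0 < t -> dE0 t <= - 30 * (expR t ^+ 2 * Sob N 1 (a t)).
Proof.
move=> t0; have e2 : 0 <= expR t ^+ 2 by exact: sqr_ge0.
have h1 := ler_wpM2l e2 (dS0_le t).
have h2 := ler_wpM2l e2 (Sob_le_succ N 0 (galerkin0 gal (ltW t0))).
rewrite /dE0; move: h1 h2; move: (expR t) (dS0 t) (Sob _ _ _) (Sob _ _ _) => e x y u; lra.
Qed.

Let dE1_le t : 0 < t -> dE1 t <= (1 + K) * (expR t ^+ 2 * Sob N 1 (a t)) - 31 * (t * expR t * Sob N 2 (a t)).
Proof.
move=> t0; have [w0 w1 w2] := weights t0.
have h1 := ler_wpM2l w0 (dS1_le t0).
have S1 := Sob_ge0 N 1 (a t).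
have h2 := ler_wpM2r S1 w2; have h3 := ler_wpM2l K0 (ler_wpM2r S1 w1).
rewrite /dE1; move: h1 h2 h3; move: (expR t) (dS1 t) (Sob _ 1 _) (Sob _ 2 _) (K) => e x y u k.
lra.
Qed.

Let dF1_le t : 0 < t -> dF1 t <= - 29 * (expR t ^+ 2 * Sob N 2 (b t)) + K * (expR t ^+ 2 * Sob N 1 (a t)).
Proof.
move=> t0; have e2 : 0 <= expR t ^+ 2 by exact: sqr_ge0.
have h1 := ler_wpM2l e2 (dB1_le t0).
have h2 := ler_wpM2l e2 (Sob_le_succ N 1 (b0 (ltW t0))).
rewrite /dF1; move: h1 h2; move: (expR t) (dB 1 t) (Sob _ 1 (b t)) (Sob _ 2 _) (Sob _ 1 (a t)) (K) => e x y u v k.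
lra.
Qed.

Let dF2_le t : 0 < t -> dF2 t <= expR t ^+ 2 * Sob N 2 (b t) - 31 * (t * expR t * Sob N 3 (b t))
  + 4 * K * (t * expR t * Sob N 2 (a t)).
Proof.
move=> t0; have [w0 w1 w2] := weights t0.
have h1 := ler_wpM2l w0 (dB2_le t0).
have h2 := ler_wpM2r (Sob_ge0 N 2 (b t)) w2.
rewrite /dF2; move: h1 h2; move: (expR t) (dB 2 t) (Sob _ 2 (b t)) (Sob _ 3 _) (Sob _ 2 (a t)) (K) => e x y u v k.
lra.
Qed.

(* b vanishes at t = 0, so Phi 0 only involves the energy of a; the source terms
   with S_1(a) and S_2(a) are absorbed by the dissipation of E0 and E1. *)
Lemma energy1 : exists Phi dPhi : R -> R, [/\ cont0 Phi,
  forall t, 0 < t -> drv Phi t (dPhi t) /\ dPhi t <= - Sob N 2 (b t),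
  forall t, 0 <= t -> 0 <= Phi t & Phi 0 <= K * M ^+ 2].
Proof.
(* A Lyapunov function replaces the time integral of S_2(b): its decrease is what the barrier of
   [sup_short] spends. *)
exists (fun s => F1 s + K * E0 s), (fun s => dF1 s + K * dE0 s); split.
- exact: (cont0D cF1 (cont0M (@cont0_cst K) cE0)).
- move=> t t0; split; first exact: drvD (drv_F1 t0) (drvZ K (drv_E0 t0)).
  have h1 := dF1_le t0; have h2 := ler_wpM2l K0 (dE0_le t0).
  have h3 : Sob N 2 (b t) <= expR t ^+ 2 * Sob N 2 (b t).
    rewrite ler_peMl ?Sob_ge0// exprn_ege1// (le_trans _ (expR_ge1Dx t))//; lra.
  have h4 : 0 <= K * (expR t ^+ 2 * Sob N 1 (a t)).
    exact: (mulr_ge0 K0 (mulr_ge0 (sqr_ge0 _) (Sob_ge0 _ _ _))).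
  have h5 := Sob_ge0 N 2 (b t).
  move: h1 h2 h3 h4 h5; rewrite [K * (-30 * _)]mulrCA.
  move: (Sob N 2 _) (_ * Sob N 2 _) (dF1 t) (K * dE0 _) (K * (_ * Sob N 1 _)).
  by move=> *; lra.
- by move=> t t0; rewrite (addr_ge0 _ (mulr_ge0 K0 _))// mulr_ge0 ?Sob_ge0 ?sqr_ge0.
- rewrite /F1 /E0 Sob_b0 mulr0 add0r expR0 expr1n mul1r; exact: ler_wpM2l.
Qed.

Lemma energy2 : exists Phi dPhi : R -> R, [/\ cont0 Phi,
  forall t, 0 < t -> drv Phi t (dPhi t) /\ dPhi t <= - (t * expR t * Sob N 3 (b t)),
  forall t, 0 <= t -> 0 <= Phi t & Phi 0 <= (K + 4 * K * (1 + K)) * M ^+ 2].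
Proof.
(* [F1] absorbs the S_2(b) left by [F2], and 4 K E1 the S_2(a). The remaining sources in S_1(a) are
   K from [F1] and 4 K (1 + K) from 4 K E1, and their sum is the weight of [E0]. *)
pose c := K + 4 * K * (1 + K).
have K4 : 0 <= 4 * K by exact: (mulr_ge0 (ler0n _ 4) K0).
have c0 : 0 <= c by apply: (addr_ge0 K0 (mulr_ge0 K4 (addr_ge0 ler01 K0))).
exists (fun s => F2 s + F1 s + 4 * K * E1 s + c * E0 s),
  (fun s => dF2 s + dF1 s + 4 * K * dE1 s + c * dE0 s); split.
- exact: (cont0D (cont0D (cont0D cF2 cF1) (cont0M (@cont0_cst (4 * K)) cE1)) (cont0M (@cont0_cst c) cE0)).
- move=> t t0; split.
    exact: drvD (drvD (drvD (drv_F2 t0) (drv_F1 t0)) (drvZ (4 * K) (drv_E1 t0))) (drvZ c (drv_E0 t0)).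
  have [w0 w1 w2] := weights t0.
  have h1 := dF1_le t0; have h2 := ler_wpM2l c0 (dE0_le t0).
  have h3 := dF2_le t0; have h4 := ler_wpM2l K4 (dE1_le t0).
  have p1 : 0 <= expR t ^+ 2 * Sob N 1 (a t) by rewrite mulr_ge0 ?Sob_ge0 ?sqr_ge0.
  have p2 : 0 <= expR t ^+ 2 * Sob N 2 (b t) by rewrite mulr_ge0 ?Sob_ge0 ?sqr_ge0.
  have p3 : 0 <= t * expR t * Sob N 3 (b t) by rewrite mulr_ge0 ?Sob_ge0.
  have p4 := mulr_ge0 K0 (mulr_ge0 w0 (Sob_ge0 N 2 (a t))).
  have p5 := mulr_ge0 c0 p1.
  move: h1 h2 h3 h4 p1 p2 p3 p4 p5; rewrite /c.
  move: (dF1 t) (dE0 t) (dF2 t) (dE1 t) => ? ? ? ?.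
  move: (_ ^+ 2 * Sob N 1 _) (_ * Sob N 2 (b t)) (_ * Sob N 3 _) (_ * _ * Sob N 2 (a t)) => A B C D.
  move: (K) => k h1 h2 h3 h4 p1 p2 p3 p4 p5.
  by nra.
- move=> t t0; have w0 := mulr_ge0 t0 (expR_ge0 t); have e2 := sqr_ge0 (expR t).
  apply: (addr_ge0 (addr_ge0 (addr_ge0 _ _) (mulr_ge0 K4 _)) (mulr_ge0 c0 _));
    by rewrite mulr_ge0 ?Sob_ge0.
- rewrite /F1 /E0 /F2 /E1 !Sob_b0 !mulr0 !mul0r !mulr0 !add0r expR0 expr1n mul1r.
  exact: ler_wpM2l.
Qed.

End Energy.

(** * Bounds on the defect *)

Section HeatGradient.
Context {R : realType}.
Implicit Types (x y : R * R) (t T A : R) (k : int * int) (z : int * int -> R[i])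
  (r : seq (int * int)).

Lemma drv_heat_tpoly r (c z : int * int -> R[i]) t x :
  drv (fun s => tpoly r (fun k => c k * heat z s k) x) t
    (tpoly r (fun k => (- lam k)%:C%C * (c k * heat z t k)) x).
Proof.
apply: (@drv_sum R _ r xpredT (fun k s => rmode (c k * heat z s k) k x)) => k _.
have [h1 h2] := drv_heat z t k.
set u := fourier_mode k x.
have E (v : R[i]) : rmode (c k * v) k x =
    complex.Re v * complex.Re (c k * u) - complex.Im v * complex.Im (c k * u).
  by rewrite /rmode -/u mulrAC mulrC; case: v (c k * u) => ? ? [].
apply: drv_ext (drv_eq (drvB (drvM h1 (drv_cst t (complex.Re (c k * u))))
  (drvM h2 (drv_cst t (complex.Im (c k * u))))) _) => [s|]; first by rewrite E.
have -> : (- lam k)%:C%C * (c k * heat z t k) = c k * ((- lam k)%:C%C * heat z t k).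
  exact: mulrCA.
by rewrite E !mulr0 !addr0.
Qed.

Lemma heat0 z k : heat z 0 k = z k.
Proof. by rewrite /heat mulr0 expR0 mul1r. Qed.

Lemma heat_tpoly_continuous r (c z : int * int -> R[i]) :
  continuous (fun p : R * (R * R) => tpoly r (fun k => c k * heat z p.1 k) p.2).
Proof.
apply: (@continuous_bigsum R _ _ r xpredT
  (fun k (p : R * (R * R)) => rmode (c k * heat z p.1 k) k p.2)) => k _ p.
have -> : (fun p : R * (R * R) => rmode (c k * heat z p.1 k) k p.2) =
    (fun p => expR (- lam k * p.1) * rmode (c k * z k) k p.2).
  by apply/funext => q; rewrite /heat mulrCA rmodeZ.
have c1 : {for p, continuous (fun p : R * (R * R) => expR (- lam k * p.1))}.
  apply: (continuous_comp (f := fst) (g := fun s : R => expR (- lam k * s))); first exact: cvg_fst.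
  have d : drv (fun s => expR (- lam k * s)) p.1 (expR (- lam k * p.1) * (- lam k * 1)).
    exact: drv_exp (drvZ (- lam k) (drv_id p.1)).
  exact: drv_continuous d.
have c2 : {for p, continuous (fun p : R * (R * R) => rmode (c k * z k) k p.2)}.
  apply: (continuous_comp (f := snd) (g := fun y : R * R => rmode (c k * z k) k y)).
    exact: cvg_snd.
  exact: continuous_rmode.
exact: (cvgM c1 c2).
Qed.

(* Bernstein's trick: X^2 + 2 t |grad X|^2 is a subsolution of the heat equation. *)
Lemma heat_gradient r z A T x : 0 <= T -> (forall y, `|tpoly r z y| <= A) ->
  2 * T * (tpoly r (fun k => ci (wave1 k) * heat z T k) x ^+ 2 +
           tpoly r (fun k => ci (wave2 k) * heat z T k) x ^+ 2) <= A ^+ 2.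
Proof.
move=> T0 bA.
pose w0 : int * int -> R[i] := fun k => 1.
pose w1 : int * int -> R[i] := fun k => ci (wave1 k).
pose w2 : int * int -> R[i] := fun k => ci (wave2 k).
(* [H c] is the heat flow under the Fourier multiplier [c]; [w0], [w1], [w2] stand for no derivative
   and the two first derivatives. *)
pose H (c : int * int -> R[i]) t y := tpoly r (fun k => c k * heat z t k) y.
have dH1 c t y : drv (fun s : R => H c t (s, y.2)) y.1 (H (fun k => w1 k * c k) t y).
  apply: drv_eq (drv_tpoly1 r _ y) _; apply: eq_tpoly => k _; exact: mulrA.
have dH2 c t y : drv (fun s : R => H c t (y.1, s)) y.2 (H (fun k => w2 k * c k) t y).
  apply: drv_eq (drv_tpoly2 r _ y) _; apply: eq_tpoly => k _; exact: mulrA.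
have dHt c t y : drv (fun s : R => H c s y) t
    (H (fun k => w1 k * (w1 k * c k)) t y + H (fun k => w2 k * (w2 k * c k)) t y).
  apply: drv_eq (drv_heat_tpoly r c z t y) _.
  rewrite /H /tpoly -big_split; apply: eq_bigr => k _ /=; rewrite -rmodeD; congr rmode.
  have -> : (- lam k)%:C%C = w1 k * w1 k + w2 k * w2 k.
    rewrite /w1 /w2 /ci /lam; apply/eqP; rewrite eq_complex /=.
    by apply/andP; split; apply/eqP; ring.
  ring.
pose Y t y := H w0 t y ^+ 2 + 2 * t * (H w1 t y ^+ 2 + H w2 t y ^+ 2).
pose w11 k := w1 k * w1 k; pose w12 k := w1 k * w2 k.
pose w21 k := w2 k * w1 k; pose w22 k := w2 k * w2 k.
have e1 : (fun k => w1 k * w0 k) = w1 by apply/funext => k; rewrite mulr1.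
have e2 : (fun k => w2 k * w0 k) = w2 by apply/funext => k; rewrite mulr1.
have sum_sqr_drv (g h m : R -> R) (c s dg dh dm : R) : drv g s dg -> drv h s dh -> drv m s dm ->
    drv (fun s => g s ^+ 2 + c * (h s ^+ 2 + m s ^+ 2)) s
      (2 * g s * dg + c * (2 * h s * dh + 2 * m s * dm)).
  by move=> hg hh hm; exact: (drvD (drv_sqr hg) (drvZ c (drvD (drv_sqr hh) (drv_sqr hm)))).
pose Y1 t y := 2 * H w0 t y * H w1 t y
  + 2 * t * (2 * H w1 t y * H w11 t y + 2 * H w2 t y * H w12 t y).
pose Y2 t y := 2 * H w0 t y * H w2 t y
  + 2 * t * (2 * H w1 t y * H w21 t y + 2 * H w2 t y * H w22 t y).
have dY1 t y : drv (fun s : R => Y t (s, y.2)) y.1 (Y1 t y).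
  have h0 := dH1 w0 t y; rewrite e1 in h0.
  have h := sum_sqr_drv _ _ _ (2 * t) y.1 _ _ _ h0 (dH1 w1 t y) (dH1 w2 t y).
  by case: y h {h0}.
have dY2 t y : drv (fun s : R => Y t (y.1, s)) y.2 (Y2 t y).
  have h0 := dH2 w0 t y; rewrite e2 in h0.
  have h := sum_sqr_drv _ _ _ (2 * t) y.2 _ _ _ h0 (dH2 w1 t y) (dH2 w2 t y).
  by case: y h {h0}.
have Y1E t : d1 (Y t) = Y1 t by apply/funext => y; exact: drv_derive1 (dY1 t y).
have Y2E t : d2 (Y t) = Y2 t by apply/funext => y; exact: drv_derive1 (dY2 t y).
have prod_drv (g h m n u v : R -> R) (c s dg dh dm dn du dv : R) :
    drv g s dg -> drv h s dh -> drv m s dm -> drv n s dn -> drv u s du -> drv v s dv ->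
    drv (fun s => 2 * g s * h s + c * (2 * m s * n s + 2 * u s * v s)) s
      (2 * (dg * h s + g s * dh) + c * (2 * (dm * n s + m s * dn) + 2 * (du * v s + u s * dv))).
  move=> hg hh hm hn hu hv.
  apply: drv_ext (drvD (drvZ 2 (drvM hg hh)) (drvZ c (drvD (drvZ 2 (drvM hm hn)) (drvZ 2 (drvM hu hv))))).
  by move=> s'; rewrite !mulrA.
have dY11 t y := prod_drv _ _ _ _ _ _ (2 * t) y.1 _ _ _ _ _ _ (dH1 w0 t y) (dH1 w1 t y)
  (dH1 w1 t y) (dH1 w11 t y) (dH1 w2 t y) (dH1 w12 t y).
have dY22 t y := prod_drv _ _ _ _ _ _ (2 * t) y.2 _ _ _ _ _ _ (dH2 w0 t y) (dH2 w2 t y)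
  (dH2 w1 t y) (dH2 w21 t y) (dH2 w2 t y) (dH2 w22 t y).
have dYt t y := drvD (drv_sqr (dHt w0 t y))
  (drvM (drvZ 2 (drv_id t)) (drvD (drv_sqr (dHt w1 t y)) (drv_sqr (dHt w2 t y)))).
have TT : 0 <= T <= T by rewrite T0 lexx.
have key : Y T x <= A ^+ 2.
  apply: (@parabolic_max_principle R Y 0 T (A ^+ 2) _ _ _ _ _ _ T x TT).
  - apply: continuous_subspaceT => p.
    have cH c : {for p, continuous (fun p : R * (R * R) => H c p.1 p.2)}.
      exact: heat_tpoly_continuous.
    have sq (g : R * (R * R) -> R) : {for p, continuous g} -> {for p, continuous (fun q => g q ^+ 2)}.
      by move=> cg; exact: (cvgM cg cg).
    have c2 : {for p, continuous (fun p : R * (R * R) => 2 * p.1)}.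
      by apply: cvgM; [exact: cvg_cst|exact: cvg_fst].
    exact: (cvgD (sq _ (cH w0)) (cvgM c2 (cvgD (sq _ (cH w1)) (sq _ (cH w2))))).
  - move=> t _ y; have pH c := periodic_tpoly r (fun k => c k * heat z t k) y.
    by split; rewrite /Y /H; [rewrite !(pH _).1|rewrite !(pH _).2].
  - by move=> t y _; exact: drv_derivable (dYt t y).
  - move=> t _; split=> y.
    + exact: drv_derivable (dY1 t y).
    + exact: drv_derivable (dY2 t y).
    + by rewrite Y1E; exact: drv_derivable (dY11 t y).
    + by rewrite Y2E; exact: drv_derivable (dY22 t y).
  - move=> t y /andP[t0 _] _ _.
    rewrite /laplacian /dt (drv_derive1 (dYt t y)) Y1E Y2E.
    rewrite (d1E (Y1 t) y) (d2E (Y2 t) y) (drv_derive1 (dY11 t y)) (drv_derive1 (dY22 t y)).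
    rewrite /Y1 /Y2 /= -!surjective_pairing e1 e2.
    rewrite (_ : (fun k => w1 k * (w1 k * w0 k)) = w11); last by apply/funext => k; rewrite mulr1.
    rewrite (_ : (fun k => w2 k * (w2 k * w0 k)) = w22); last by apply/funext => k; rewrite mulr1.
    rewrite (_ : (fun k => w1 k * w11 k) = (fun k => w1 k * (w1 k * w1 k)))//.
    rewrite (_ : (fun k => w1 k * w12 k) = (fun k => w1 k * (w1 k * w2 k)))//.
    rewrite (_ : (fun k => w2 k * w21 k) = (fun k => w2 k * (w2 k * w1 k)))//.
    rewrite (_ : (fun k => w2 k * w22 k) = (fun k => w2 k * (w2 k * w2 k)))//.
    rewrite (_ : (fun k => w1 k * w1 k) = w11)// (_ : (fun k => w1 k * w2 k) = w12)//.
    rewrite (_ : (fun k => w2 k * w1 k) = w21)// (_ : (fun k => w2 k * w2 k) = w22)//.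
    move: (H w0 t y) (H w1 t y) (H w2 t y) (H w11 t y) (H w12 t y) (H w21 t y) (H w22 t y).
    move: (H (fun k => w1 k * (w1 k * w1 k)) t y) (H (fun k => w1 k * (w1 k * w2 k)) t y).
    move: (H (fun k => w2 k * (w2 k * w1 k)) t y) (H (fun k => w2 k * (w2 k * w2 k)) t y).
    move=> g1 g2 g3 g4 h h1 h2 h11 h12 h21 h22.
    (* The gap between the Laplacian and the time derivative is 4 t times the squared Hessian:
       differentiating the factor 2 t produces 2 |grad X|^2, which cancels against the dissipation
       of X^2. *)
    rewrite -subr_ge0.
    have -> : forall u : R, u = 4 * t * (h11 ^+ 2 + h12 ^+ 2 + h21 ^+ 2 + h22 ^+ 2) -> 0 <= u.
      by move=> u ->; rewrite !mulr_ge0 ?addr_ge0 ?sqr_ge0 ?ltW.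
    by [].
    ring.
  - move=> y; have A0 := le_trans (normr_ge0 _) (bA y).
    have E : H w0 0 y = tpoly r z y by apply: eq_tpoly => k _; rewrite heat0 mul1r.
    rewrite /Y !(mulr0, mul0r) addr0 E -(@real_normK _ (tpoly r z y)) ?num_real//.
    by rewrite ler_pXn2r ?nnegrE// bA.
apply: le_trans key; rewrite /Y lerDr; exact: sqr_ge0.
Qed.

End HeatGradient.

(** * The defect: heat-flow part and high-frequency part *)

Section Defect.
Context {R : realType}.
Local Notation Re := complex.Re.
Local Notation Im := complex.Im.
Local Notation tm := (@torus_measure R).
Implicit Types (x y : R * R) (t M : R) (k p q : int * int) (a c z : int * int -> R[i]) (u : R[i]).

Lemma cabs_le_ReIm u : cabs u <= `|Re u| + `|Im u|.
Proof.
have -> : u = (Re u)%:C%C + ci (Im u).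
  by case: u => ? ?; apply/eqP; rewrite eq_complex /= addr0 add0r !eqxx.
apply: le_trans (cabsD _ _) _; rewrite cabs_real cabs_ci.
by case: u => ? ? /=; rewrite addr0 add0r.
Qed.

Lemma abs_le_kn p : `|p.1%:~R| <= kn p :> R /\ `|p.2%:~R| <= kn p :> R.
Proof.
split.
  exact: (Re_le_cabs (p.1%:~R +i* p.2%:~R)%C).
exact: (Im_le_cabs (p.1%:~R +i* p.2%:~R)%C).
Qed.

(** The defect with separate arguments for velocity and gradient, because only the gradient is split
    into heat flow and remainder. *)
Definition interaction N a c x : R := \sum_(p <- box N) \sum_(q <- box N)
  (p + q \notin box N)%:R * rmode ((bs p q)%:C%C * a p * c q) (p + q) x.

Lemma defect_interaction N a x : defect N a x = interaction N a a x.
Proof. by []. Qed.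

Lemma interactionD N a c c' x :
  interaction N a (fun k => c k + c' k) x = interaction N a c x + interaction N a c' x.
Proof.
rewrite /interaction -big_split; apply: eq_bigr => p _.
by rewrite -big_split; apply: eq_bigr => q _ /=; rewrite mulrDr rmodeD mulrDr.
Qed.

Lemma rmode_bs_le a c p q (j : int * int) x :
  `|rmode ((bs p q)%:C%C * a p * c q) j x| <= (cabs (a p) / kn p) * (kn q * cabs (c q)).
Proof.
apply: le_trans (rmode_le _ _ _) _; rewrite !cabsM cabs_real.
have -> : cabs (a p) / kn p * (kn q * cabs (c q)) = kn q / kn p * cabs (a p) * cabs (c q) by ring.
by rewrite !ler_wpM2r ?cabs_ge0 ?bs_le.
Qed.

Lemma interaction_le N a c x : `|interaction N a c x| <= velo N a * gradl1 N c.
Proof.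
rewrite /velo /gradl1 big_distrlr /=; apply: le_trans (ler_norm_sum _ _ _) _.
apply: ler_sum => p _; apply: le_trans (ler_norm_sum _ _ _) _.
apply: ler_sum => q _; rewrite normrM.
have r0 := rmode_bs_le a c p q (p + q) x.
by case: (p + q \in box N); rewrite /= ?normr0 ?normr1 ?mul0r ?mul1r// (le_trans _ r0).
Qed.

Definition high N k : bool := (N%:R ^+ 2 <= 4 * ksq k :> R).

(** If a coordinate of p + q exceeds N in absolute value, the same coordinate of p or of q is at
    least N/2. *)
Lemma high_or N p q : p + q \notin box N -> high N p || high N q.
Proof.
rewrite mem_box /high negb_and -!ltnNge => h.
have key (i j : int) : (N < `|(i + j)%R|)%N ->
    (N%:R ^+ 2 <= 4 * i%:~R ^+ 2 :> R) \/ (N%:R ^+ 2 <= 4 * j%:~R ^+ 2 :> R).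
  move=> hN; have : (N <= 2 * `|i|)%N \/ (N <= 2 * `|j|)%N by lia.
  have sq (m : int) : (N <= 2 * `|m|)%N -> N%:R ^+ 2 <= 4 * m%:~R ^+ 2 :> R.
    move=> hm; have -> : 4 * m%:~R ^+ 2 = (2 * `|m%:~R|) ^+ 2 :> R.
      by rewrite exprMn real_normK ?num_real// -natrX.
    rewrite ler_pXn2r ?nnegrE ?mulr_ge0// -intr_norm -abszE.
    by rewrite -[_%:~R]/(`|m|%N%:R) -natrM ler_nat.
  by case=> /sq; [left|right].
have le1 (m : int * int) : 4 * m.1%:~R ^+ 2 <= 4 * ksq m :> R.
  by rewrite ler_wpM2l// /ksq lerDl sqr_ge0.
have le2 (m : int * int) : 4 * m.2%:~R ^+ 2 <= 4 * ksq m :> R.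
  by rewrite ler_wpM2l// /ksq lerDr sqr_ge0.
case/orP: h => /key [h|h]; apply/orP.
- by left; exact: le_trans h (le1 p).
- by right; exact: le_trans h (le1 q).
- by left; exact: le_trans h (le2 p).
- by right; exact: le_trans h (le2 q).
Qed.

Definition highl1 N a : R := \sum_(q <- box N | high N q) kn q * cabs (a q).

Lemma le_kn p q : ksq p <= ksq q :> R -> kn p <= kn q :> R.
Proof. by rewrite -!kn_sqr ler_pXn2r ?nnegrE ?kn_ge0. Qed.

(* If p is high and q is not then |q| <= |p|, so p and q can be exchanged in
   |q| |a_q| |a_p| / |p|. *)
Lemma defect_high N a x : `|defect N a x| <= 2 * (velo N a * highl1 N a).
Proof.
pose A p := cabs (a p) / kn p; pose B q := kn q * cabs (a q).
have A0 p : 0 <= A p by rewrite /A divr_ge0 ?cabs_ge0 ?kn_ge0.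
have B0 q : 0 <= B q by rewrite /B mulr_ge0 ?cabs_ge0 ?kn_ge0.
have hE : highl1 N a = \sum_(q <- box N) (high N q)%:R * B q.
  by rewrite /highl1 big_mkcond; apply: eq_bigr => q _; case: high; rewrite ?mul1r ?mul0r.
rewrite mulr2n mulrDl !mul1r; apply: (@le_trans _ _
  (\sum_(p <- box N) \sum_(q <- box N) (A p * ((high N q)%:R * B q) + A q * ((high N p)%:R * B p)))).
  apply: le_trans (ler_norm_sum _ _ _) _.
  apply: ler_sum => p _; apply: le_trans (ler_norm_sum _ _ _) _.
  apply: ler_sum => q _; rewrite normrM.
  have r0 := rmode_bs_le a a p q (p + q) x.
  have n1 := mulr_ge0 (A0 p) (mulr_ge0 (ler0n _ (high N q)) (B0 q)).
  have n2 := mulr_ge0 (A0 q) (mulr_ge0 (ler0n _ (high N p)) (B0 p)).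
  case: (boolP (p + q \in box N)) => h /=; rewrite ?normr0 ?normr1 ?mul0r ?mul1r ?addr_ge0//.
  have [hq|nhq] := boolP (high N q); first by rewrite mul1r -[leLHS]addr0 lerD.
  have hp : high N p by move: (high_or h); rewrite (negbTE nhq) orbF.
  rewrite hp mul0r mulr0 add0r mul1r; apply: le_trans r0 _.
  have lt : ksq q <= ksq p :> R.
    move: nhq hp; rewrite /high -ltNge => h1 h2.
    have := lt_le_trans h1 h2; lra.
  have [->|q0] := eqVneq q 0; first by rewrite kn0 !mul0r mulr0 mulr_ge0.
  have k1 : 0 < kn q :> R by exact: (lt_le_trans ltr01 (@kn_ge1 R q q0)).
  have k2 := le_kn lt; have k3 : 0 < kn p :> R by exact: lt_le_trans k2.
  rewrite /A /B.
  have -> : cabs (a p) / kn p * (kn q * cabs (a q)) = (kn q / kn p) * (cabs (a p) * cabs (a q)) by ring.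
  have -> : cabs (a q) / kn q * (kn p * cabs (a p)) = (kn p / kn q) * (cabs (a p) * cabs (a q)) by ring.
  apply: ler_wpM2r; first by rewrite mulr_ge0 ?cabs_ge0.
  by apply: (@le_trans _ _ 1); rewrite ?ler_pdivrMr ?ler_pdivlMr ?mul1r.
rewrite hE /velo big_distrlr /= -/A.
under eq_bigr do rewrite big_split.
by rewrite big_split /= [X in _ + X]exchange_big.
Qed.

Lemma highl1D N a c : highl1 N (fun k => a k + c k) <= highl1 N a + highl1 N c.
Proof.
rewrite /highl1 -big_split; apply: ler_sum => q _.
by rewrite /= -mulrDr ler_wpM2l ?kn_ge0// cabsD.
Qed.

Lemma high_neq0 N k : (0 < N)%N -> high N k -> k != 0.
Proof.
move=> N0; apply: contraTneq => ->; rewrite /high ksq0 mulr0 -ltNge.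
by rewrite exprn_gt0// ltr0n.
Qed.

Lemma ksq_inv_high N k : (0 < N)%N -> high N k -> (ksq k)^-1 <= 4 / N%:R ^+ 2 :> R.
Proof.
move=> N0 h; have k0 : 0 < ksq k :> R.
  exact: (lt_le_trans ltr01 (@ksq_ge1 R k (high_neq0 N0 h))).
rewrite -[X in X^-1 <= _]invrK invrK -[leLHS]mul1r ler_pdivrMr// mulrAC ler_pdivlMr ?mul1r//.
by rewrite exprn_gt0// ltr0n.
Qed.

(** Cauchy-Schwarz for |q|^3 |b_q| against |q|^-2. In the squared weight |q|^-4, one factor |q|^-2
    is at most 4/N^2 at high frequencies and the other sums to [Lam N]. *)
Lemma highl1_Sob N b : (0 < N)%N ->
  highl1 N b ^+ 2 <= Sob N 3 b * (4 / N%:R ^+ 2 * Lam N).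
Proof.
move=> N0.
have -> : highl1 N b = \sum_(q <- box N) (kn q * ksq q * cabs (b q)) * ((high N q)%:R / ksq q).
  rewrite /highl1 big_mkcond; apply: eq_bigr => q _; case: ifP => h; last by rewrite mul0r mulr0.
  have k0 : ksq q != 0 :> R.
    by rewrite gt_eqF// (lt_le_trans ltr01)// ksq_ge1// (high_neq0 N0).
  by rewrite /= mulrA mulr1 mulrAC mulfK.
apply: le_trans (cauchy_schwarz _ _ _) _.
have e1 : \sum_(q <- box N) (kn q * ksq q * cabs (b q)) ^+ 2 = Sob N 3 b.
  by apply: eq_bigr => q _; rewrite !exprMn kn_sqr cabs_sqr -exprS.
rewrite e1; apply: ler_wpM2l; first exact: Sob_ge0.
rewrite /Lam mulr_sumr; apply: ler_sum => q _.
have [h|_] := boolP (high N q); last first.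
  by rewrite mul0r expr0n /= mulr_ge0 ?invr_ge0 ?ksq_ge0 ?divr_ge0 ?sqr_ge0.
rewrite mul1r expr2 ler_wpM2r ?invr_ge0 ?ksq_ge0//; exact: ksq_inv_high.
Qed.

Lemma expN_le (s : R) : 0 < s -> expR (- s) <= 2 / s ^+ 2.
Proof.
move=> s0; rewrite expRN -[leLHS]mul1r ler_pdivrMr ?expR_gt0// mulrAC ler_pdivlMr ?exprn_gt0// mul1r.
have := expR_ge1Dxn 1 (ltW s0); rewrite /= => h.
have f2 : 2`!%:R = 2 :> R by [].
rewrite f2 in h; lra.
Qed.

(** Of the exponential decay only e^(-s) <= 2/s^2 is used. It gains |q|^-4: two powers turn |q|
    |z_q| into |z_q|/|q|, and the other two give N^-2 at high frequencies. The factor t^-2 stays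
    integrable at infinity. *)
Lemma highl1_heat N z t : (0 < N)%N -> 0 < t ->
  highl1 N (heat z t) <= (32 * N%:R ^+ 2 * t ^+ 2)^-1 * velo N z.
Proof.
move=> N0 t0; have N0' : 0 < N%:R :> R by rewrite ltr0n.
rewrite /velo mulr_sumr /highl1 big_mkcond; apply: ler_sum => q _.
have pos : 0 <= (32 * N%:R ^+ 2 * t ^+ 2)^-1 * (cabs (z q) / kn q).
  apply: mulr_ge0 (divr_ge0 (cabs_ge0 _) (kn_ge0 _)).
  by rewrite invr_ge0 (mulr_ge0 (mulr_ge0 (ler0n _ 32) (sqr_ge0 _)) (sqr_ge0 _)).
case: ifP => // h.
have k1 := ksq_ge1 (R := R) (high_neq0 N0 h); have n1 := kn_ge1 (R := R) (high_neq0 N0 h).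
have l1 := lam_ge (R := R) q.
have lt0 : 0 < lam q * t by rewrite mulr_gt0//; lra.
rewrite /heat cabsM cabs_real ger0_norm ?expR_ge0// mulNr.
have e1 := expN_le lt0.
have e2 : 2 / (lam q * t) ^+ 2 <= 2 / (16 * ksq q * t) ^+ 2.
  apply: ler_wpM2l => //; rewrite lef_pV2 ?posrE ?exprn_gt0//; last by rewrite !mulr_gt0//; lra.
  rewrite ler_pXn2r ?nnegrE ?(ltW lt0)//; last by rewrite !mulr_ge0 ?ltW//; lra.
  by rewrite ler_wpM2r// ltW.
have e3 : kn q * (2 / (16 * ksq q * t) ^+ 2) <= (32 * N%:R ^+ 2 * t ^+ 2)^-1 / kn q.
  have -> : kn q * (2 / (16 * ksq q * t) ^+ 2) = (ksq q)^-1 * (128 * t ^+ 2 * kn q)^-1.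
    rewrite -kn_sqr; move: (kn q) n1 => s s1.
    have s0 : s != 0 by rewrite gt_eqF//; lra.
    field; by rewrite s0 gt_eqF.
  have -> : (32 * N%:R ^+ 2 * t ^+ 2)^-1 / kn q = 4 / N%:R ^+ 2 * (128 * t ^+ 2 * kn q)^-1.
    move: (kn q) n1 => s s1.
    have s0 : s != 0 by rewrite gt_eqF//; lra.
    field; by rewrite s0 !gt_eqF.
  apply: ler_wpM2r (ksq_inv_high N0 h).
  by rewrite invr_ge0 (mulr_ge0 (mulr_ge0 (ler0n _ 128) (sqr_ge0 _)) (kn_ge0 _)).
rewrite mulrA; apply: le_trans (ler_wpM2r (cabs_ge0 (z q)) _) _.
  exact: (le_trans (ler_wpM2l (kn_ge0 q) (le_trans e1 e2)) e3).
by rewrite -!mulrA [_^-1 * cabs _]mulrC.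
Qed.

(* For fixed p, the sum over q is a derivative of the heat flow of a truncation of
   f to the box minus a translated box. *)
Lemma heat_interaction N f M a t x : essbounded f -> {ae tm, forall y, `|f y| <= M} -> 0 <= M ->
  0 < t -> `|interaction N a (heat (fourier_coef f) t) x| <=
    velo N a * (2 * M * dirichlet_bound N ^+ 2 / Num.sqrt t).
Proof.
move=> ef fM M0 t0; set z := fourier_coef f; set D := dirichlet_bound N.
have D0 : 0 <= D ^+ 2 by exact: sqr_ge0.
have MD0 : 0 <= M * D ^+ 2 by exact: mulr_ge0.
have st0 : 0 < Num.sqrt t by rewrite sqrtr_gt0.
rewrite /velo mulr_suml; apply: le_trans (ler_norm_sum _ _ _) _.
apply: ler_sum => p _.
have [->|p0] := eqVneq p 0.
  rewrite big1 ?normr0; last first.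
    move=> q _; rewrite (_ : bs 0 q = 0); last by rewrite /bs ksq0 invr0 mulr0.
    by rewrite !mul0r rmode0 mulr0.
  apply: mulr_ge0 (divr_ge0 (cabs_ge0 _) (kn_ge0 _)) (divr_ge0 _ (ltW st0)).
  by rewrite -mulrA mulr_ge0.
pose r := [seq q <- box N | p + q \notin box N].
pose Z := \sum_(q <- r) (bs p q)%:C%C * heat z t q * fourier_mode q x.
have TE : \sum_(q <- box N) (p + q \notin box N)%:R * rmode ((bs p q)%:C%C * a p * heat z t q) (p + q) x
    = Re (a p * fourier_mode p x * Z).
  rewrite /Z mulr_sumr Re_sum big_filter [RHS]big_mkcond; apply: eq_bigr => q _.
  case: (p + q \in box N); rewrite /= ?mul0r ?mul1r// /rmode fourier_modeD; congr Re; ring.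
have kp1 := kn_ge1 (R := R) p0; have kp0 : 0 < kn p :> R by lra.
(* The full box is the case of shift 0 in [shifted_projection_bound]; subtracting the part that
   stays inside after the shift gives the factor 2. *)
have sup u y : cabs u <= 1 -> `|tpoly r (fun q => u * z q) y| <= 2 * (M * D ^+ 2).
  move=> u1; have h1 := shifted_projection_bound N 0 y ef fM M0 u1.
  have h2 := shifted_projection_bound N p y ef fM M0 u1.
  rewrite /tpoly big_filter.
  have E0 : \sum_(k <- box N | k + 0 \in box N) rmode (u * z k) k y =
      \sum_(k <- box N) rmode (u * z k) k y.
    by rewrite [RHS]big_seq; apply: eq_bigl => k; rewrite addr0.
  have E1 : \sum_(k <- box N) rmode (u * z k) k y =
      \sum_(k <- box N | k + p \in box N) rmode (u * z k) k y +
      \sum_(k <- box N | p + k \notin box N) rmode (u * z k) k y.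
    rewrite (bigID (fun k => k + p \in box N)) /=; congr (_ + _).
    by apply: eq_bigl => k; rewrite addrC.
  rewrite E0 E1 in h1.
  have -> : \sum_(k <- box N | p + k \notin box N) rmode (u * z k) k y =
     (\sum_(k <- box N | k + p \in box N) rmode (u * z k) k y +
      \sum_(k <- box N | p + k \notin box N) rmode (u * z k) k y) -
     \sum_(k <- box N | k + p \in box N) rmode (u * z k) k y by ring.
  by apply: le_trans (ler_normB _ _) _; rewrite mulrDl mul1r; exact: lerD.
have grad u : cabs u <= 1 ->
    `|tpoly r (fun q => ci (wave1 q) * heat (fun q => u * z q) t q) x| <= 2 * (M * D ^+ 2) / Num.sqrt t /\
    `|tpoly r (fun q => ci (wave2 q) * heat (fun q => u * z q) t q) x| <= 2 * (M * D ^+ 2) / Num.sqrt t.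
  move=> u1; have h := heat_gradient x (ltW t0) (fun y => sup u y u1).
  move: h; set g1 := tpoly _ _ x; set g2 := tpoly _ _ x; set A := 2 * (M * _) => h.
  have A0 : 0 <= A by rewrite /A mulr_ge0.
  have gen g : t * g ^+ 2 <= A ^+ 2 -> `|g| <= A / Num.sqrt t.
    move=> hg; rewrite ler_pdivlMr// -(ler_pXn2r (n := 2))// ?nnegrE ?mulr_ge0 ?(ltW st0)//.
    by rewrite exprMn sqr_sqrtr ?(ltW t0)// real_normK ?num_real// mulrC.
  split; apply: gen; apply: le_trans h.
    have := mulr_ge0 (ltW t0) (sqr_ge0 g2); have := mulr_ge0 (ltW t0) (sqr_ge0 g1).
    by move: (g1 ^+ 2) (g2 ^+ 2) => u2 v2; lra.
  have := mulr_ge0 (ltW t0) (sqr_ge0 g2); have := mulr_ge0 (ltW t0) (sqr_ge0 g1).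
  by move: (g1 ^+ 2) (g2 ^+ 2) => u2 v2; lra.
(* [bs p q] is linear in q, so this sum is a combination of the two space derivatives of the
   truncated flow; [ci (-1)] cancels the i produced by differentiation. *)
have piece u : cabs u <= 1 -> `|\sum_(q <- r) rmode (u * ((bs p q)%:C%C * heat z t q)) q x| <=
    M * D ^+ 2 / (kn p * Num.sqrt t).
  move=> u1; have u1' : cabs (ci (- 1) * u) <= 1.
    by rewrite cabsM cabs_ci normrN1 mul1r.
  have [h1 h2] := grad _ u1'.
  have -> : \sum_(q <- r) rmode (u * ((bs p q)%:C%C * heat z t q)) q x =
      (p.1%:~R * tpoly r (fun q => ci (wave2 q) * heat (fun q => ci (-1) * u * z q) t q) x -
       p.2%:~R * tpoly r (fun q => ci (wave1 q) * heat (fun q => ci (-1) * u * z q) t q) x)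
      / (2 * pi * ksq p).
    rewrite /tpoly !mulr_sumr -sumrB mulr_suml; apply: eq_bigr => q _.
    have ciM (v : R) : ci v * ci (-1) = v%:C%C.
      by rewrite /ci; apply/eqP; rewrite eq_complex /=; apply/andP; split; apply/eqP; ring.
    have ciE (v : R) : ci v * heat (fun q0 => ci (-1) * u * z q0) t q = v%:C%C * (u * heat z t q).
      by rewrite -(ciM v) /heat; ring.
    rewrite !ciE [u * (_ * _)]mulrCA !rmodeZ /bs /wave1 /wave2.
    have k0 : ksq p != 0 :> R by rewrite gt_eqF// (lt_le_trans ltr01)// ksq_ge1.
    have P0 := lt0r_neq0 (@pi_gt0 R).
    by move: pi (ksq p) (rmode _ _ _) P0 k0 => P s v P0 s0; field; rewrite P0 s0.
  have pi2 : 2 <= pi :> R by exact: pi_ge2.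
  have kk : ksq p = kn p * kn p :> R by rewrite -kn_sqr expr2.
  have [n1 n2] := abs_le_kn p.
  set G1 := tpoly _ _ x in h1 *; set G2 := tpoly _ _ x in h2 *.
  set A := 2 * (M * D ^+ 2) / Num.sqrt t in h1 h2.
  have A0 : 0 <= A by exact: le_trans (normr_ge0 _) h1.
  have num : `|p.1%:~R * G2 - p.2%:~R * G1| <= 2 * (kn p * A).
    apply: le_trans (ler_normB _ _) _; rewrite !normrM [leRHS]mulrDl mul1r.
    by apply: lerD; apply: ler_pM.
  rewrite normrM normfV [X in _ / X]ger0_norm; last by rewrite !mulr_ge0 ?ksq_ge0 ?pi_ge0.
  rewrite ler_pdivrMr; last by rewrite kk !mulr_gt0// pi_gt0.
  apply: le_trans num _; rewrite kk /A.
  have -> : M * D ^+ 2 / (kn p * Num.sqrt t) * (2 * pi * (kn p * kn p)) =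
     2 * pi * (kn p * (M * D ^+ 2 / Num.sqrt t)).
    move: (kn p) (Num.sqrt t) kp0 st0 => s v s0 v0; field; by rewrite !gt_eqF.
  have -> : 2 * (kn p * (2 * (M * D ^+ 2) / Num.sqrt t)) = 2 * 2 * (kn p * (M * D ^+ 2 / Num.sqrt t)).
    ring.
  apply: ler_wpM2r; last by rewrite ler_wpM2l.
  exact: mulr_ge0 (ltW kp0) (divr_ge0 MD0 (ltW st0)).
(* The real bound [piece] is applied with u = 1 and u = - i to reach both parts of [Z]. *)
have ReE : Re Z = \sum_(q <- r) rmode (1 * ((bs p q)%:C%C * heat z t q)) q x.
  by rewrite /Z Re_sum; apply: eq_bigr => q _; rewrite mul1r.
have ImE : Im Z = \sum_(q <- r) rmode (ci (-1) * ((bs p q)%:C%C * heat z t q)) q x.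
  rewrite /Z Im_sum; apply: eq_bigr => q _; rewrite /rmode -[ci (-1) * _ * _]mulrA.
  by case: (_ * _ * fourier_mode q x) => v w /=; rewrite mul0r sub0r mulN1r opprK.
have c1 : cabs (1 : R[i]) <= 1.
  by rewrite -[1]/((1 : R)%:C%C) cabs_real normr1.
have c2 : cabs (ci (-1)) <= 1 :> R by rewrite cabs_ci normrN1.
rewrite TE; apply: le_trans (Re_le_cabs _) _; rewrite !cabsM cabs_mode mulr1.
have ZZ : cabs Z <= 2 * (M * D ^+ 2 / (kn p * Num.sqrt t)).
  apply: le_trans (cabs_le_ReIm Z) _; rewrite ReE ImE [leRHS]mulrDl mul1r.
  exact: lerD (piece _ c1) (piece _ c2).
apply: le_trans (ler_wpM2l (cabs_ge0 (a p)) ZZ) _.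
rewrite le_eqVlt; apply/orP; left; apply/eqP.
by move: (kn p) (Num.sqrt t) kp0 st0 => s v s0 v0; field; rewrite !gt_eqF.
Qed.

End Defect.

(** * Logarithmic growth of the lattice sum and of the kernel bound *)

Section LatticeSum.
Context {R : realType}.

(** Equal to 1 at j = 0, so that the two-dimensional sum is dominated by a product of
    one-dimensional ones. *)
Definition recip (j : int) : R := (maxn `|j| 1)%:R^-1.

Lemma recip_ge0 j : 0 <= recip j.
Proof. by rewrite /recip invr_ge0. Qed.

Lemma ksq_inv_le (k : int * int) : (ksq k)^-1 <= recip k.1 * recip k.2 :> R.
Proof.
have [->|k0] := eqVneq k 0; first by rewrite ksq0 invr0 mulr_ge0 ?recip_ge0.
have kE : ksq k = (`|k.1| ^ 2 + `|k.2| ^ 2)%:R :> R.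
  have sq (m : int) : m%:~R ^+ 2 = (`|m| ^ 2)%:R :> R.
    by rewrite natrX natr_absz intr_norm real_normK ?num_real.
  by rewrite /ksq !sq natrD.
rewrite /recip -invfM kE -natrM lef_pV2 ?posrE ?ltr0n.
- rewrite ler_nat; case: k k0 {kE} => i j; rewrite xpair_eqE negb_and -!absz_eq0 /=.
  move: `|i|%N `|j|%N => a b; rewrite -!mulnn.
  have ab2 : (a * b <= a * a + b * b)%N.
    by have [ab|/ltnW ba] := leqP a b;
      [apply: leq_trans (leq_mul ab (leqnn b)) (leq_addl _ _)
      |apply: leq_trans (leq_mul (leqnn a) ba) (leq_addr _ _)].
  have m1 (n : nat) : maxn n.+1 1 = n.+1 by rewrite /maxn ltnS ltn0.
  case: a b ab2 => [|a] [|b] ab2 //= _; rewrite !m1 ?mul1n ?muln1//.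
    by rewrite mul0n add0n leq_pmulr.
  by rewrite mul0n addn0 leq_pmulr.
- have := ksq_ge1 (R := R) k0; rewrite kE -[1]/(1%:R) ler_nat; lia.
- by rewrite muln_gt0; apply/andP; split; lia.
Qed.

Lemma ln1p_ge (s : R) : 0 <= s -> s / (1 + s) <= ln (1 + s).
Proof.
move=> s0; have p : 0 < (1 + s)^-1 by rewrite invr_gt0; lra.
have h := le_ln1Dx (x := (1 + s)^-1 - 1).
have e : 1 + ((1 + s)^-1 - 1) = (1 + s)^-1 by ring.
rewrite e lnV ?posrE in h; last by lra.
have {}h : - ln (1 + s) <= (1 + s)^-1 - 1 by apply: h; lra.
have -> : s / (1 + s) = - ((1 + s)^-1 - 1) by field; rewrite gt_eqF; lra.
by rewrite lerNl.
Qed.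

(** Each step adds two terms 1/(N + 1), while ln (N + 1) grows by at least half of one such term:
    hence the factor 4. *)
Lemma sum_recip_le N :
  \sum_(0 <= i < (2 * N).+1) recip (i%:Z - N%:Z) <= 1 + 4 * ln (N%:R + 1).
Proof.
elim: N => [|N IH].
  rewrite muln0 big_nat1 (add0r (1 : R)) ln1 mulr0 !addr0.
  by rewrite /recip (_ : maxn _ _ = 1%N)// invr1.
have -> : (2 * N.+1).+1 = (2 * N).+3 by lia.
rewrite big_nat_recl// big_nat_recr//=.
have -> : \sum_(0 <= i < (2 * N).+1) recip (i.+1%:Z - N.+1%:Z) =
  \sum_(0 <= i < (2 * N).+1) recip (i%:Z - N%:Z).
  by apply: eq_bigr => i _; congr recip; lia.
have r1 : recip (0%:Z - N.+1%:Z) = N.+1%:R^-1.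
  by rewrite /recip; congr (_%:R^-1); lia.
have r2 : recip ((2 * N).+2%:Z - N.+1%:Z) = N.+1%:R^-1.
  by rewrite /recip; congr (_%:R^-1); lia.
rewrite r1 r2.
have n0 : 0 < N%:R + 1 :> R by rewrite ltr_wpDl.
have nE : N.+1%:R = N%:R + 1 :> R by rewrite -addn1 natrD.
rewrite nE.
have h := ln1p_ge (s := (N%:R + 1)^-1); rewrite invr_ge0 (ltW n0) in h.
have {}h := h isT.
have n1 : 0 < 1 + (N%:R + 1)^-1 :> R by rewrite addr_gt0// invr_gt0.
have lnE : ln (N%:R + 1 + 1) = ln (N%:R + 1) + ln (1 + (N%:R + 1)^-1) :> R.
  rewrite -lnM ?posrE//.
  by congr ln; rewrite mulrDr mulr1 divff// gt_eqF.
have h2 : (N%:R + 1)^-1 / 2 <= (N%:R + 1)^-1 / (1 + (N%:R + 1)^-1) :> R.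
  apply: ler_wpM2l; first by rewrite invr_ge0 ltW.
  rewrite lef_pV2 ?posrE//.
  by rewrite -[2]/(1 + 1) lerD2l invf_le1// lerDr.
rewrite lnE; move: IH h h2; move: (\sum_(_ <= _ < _) _) (ln _) (ln _) => S u v.
move: ((N%:R + 1)^-1) => d; move: (d / (1 + d)) => c; lra.
Qed.

Lemma dirichlet_bound_ge1 N : 1 + 4 * ln (N%:R + 1) <= dirichlet_bound N :> R.
Proof.
have l2 : 1 / 8 <= ln 2 :> R.
  have := @ln1p_ge 1 ler01; rewrite -[1 + 1]/(2 : R); lra.
have n0 := ler0n R N.
have l1 : ln (N%:R + 1) <= ln (8 * N%:R + 5) :> R by rewrite ler_ln ?posrE; lra.
have l3 : ln 2 <= ln (8 * N%:R + 5) :> R by rewrite ler_ln ?posrE; lra.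
by rewrite /dirichlet_bound; move: (ln _) (ln _) (ln _) l1 l2 l3 => u v s; lra.
Qed.

(** A squared logarithm where a single one would do, so that [dirichlet_bound] is the only
    logarithmic quantity left. *)
Lemma Lam_le N : Lam N <= dirichlet_bound N ^+ 2 :> R.
Proof.
apply: (@le_trans _ _ ((\sum_(0 <= i < (2 * N).+1) recip (i%:Z - N%:Z)) ^+ 2)); last first.
  rewrite ler_pXn2r ?nnegrE ?dirichlet_bound_ge0 ?sumr_ge0//; last first.
    by move=> i _; exact: recip_ge0.
  exact: le_trans (sum_recip_le N) (dirichlet_bound_ge1 N).
apply: (@le_trans _ _ (\sum_(k <- box N) recip k.1 * recip k.2)).
  by apply: ler_sum => k _; exact: ksq_inv_le.
rewrite -sum_box -(pair_bigA _ (fun i j : 'I_(2 * N).+1 =>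
  recip (i%:Z - N%:Z) * recip (j%:Z - N%:Z))) /=.
by rewrite expr2 big_mkord big_distrlr.
Qed.

(** With y = 8 N + 5 <= 13 N, ln y <= 48 y^(1/48); the exponent 48 = 6 * 8 makes the sixth power
    y^(1/8), which is at most 13 r. *)
Lemma dirichlet_bound_pow (r : R) N : (0 < N)%N -> 0 <= r -> r ^+ 8 = N%:R ->
  dirichlet_bound N ^+ 6 <= (12 * 48) ^+ 6 * 13 * r.
Proof.
move=> N0 r0 rN; set y : R := 8 * N%:R + 5.
have n1 : 1 <= N%:R :> R by rewrite -[1]/(1%:R) ler_nat.
have y0 : 0 < y by rewrite /y; lra.
pose s := y `^ (48%:R^-1).
have s0 : 0 < s by exact: powR_gt0.
have s48 : s ^+ 48 = y.
  by rewrite -powR_mulrn ?ltW// -powRrM mulVf ?pnatr_eq0// powRr1// ltW.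
have ly : ln y <= 48 * s.
  rewrite -s48 lnXn// -[leLHS]mulr_natl ler_wpM2l//.
  exact: ltW (ln_sublinear s0).
have s6 : s ^+ 6 <= 13 * r.
  rewrite -(ler_pXn2r (n := 8))// ?nnegrE ?exprn_ge0 ?(ltW s0) ?mulr_ge0//.
  rewrite -exprM s48 exprMn rN /y; apply: le_trans (_ : 13 * N%:R <= _); first lra.
  rewrite ler_wpM2r// -[leLHS]expr1; apply: ler_weXn2l => //; lra.
have D0 := @dirichlet_bound_ge0 R N.
have Ds : dirichlet_bound N <= 12 * 48 * s.
  rewrite /dirichlet_bound -/y -mulrA; apply: (ler_wpM2l _ ly); exact: ler0n.
have : 0 <= 12 * 48 :> R by exact: mulr_ge0 (ler0n _ 12) (ler0n _ 48).
move: (12 * 48) (dirichlet_bound N) D0 Ds => c D D0 Ds c0.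
apply: le_trans (_ : (c * s) ^+ 6 <= _).
  by rewrite ler_pXn2r ?nnegrE ?(mulr_ge0 c0 (ltW s0)).
rewrite exprMn -[leRHS]mulrA.
exact: (ler_wpM2l (exprn_ge0 6 c0) s6).
Qed.

End LatticeSum.

Opaque dirichlet_bound.

(** * Barriers *)

Section Barrier.
Context {R : realType}.
Implicit Types (x y : R * R) (t s T : R).

Lemma within_fst (B : R -> R) (b T : R) : {within `[b, T], continuous B} ->
  {within [set p : R * (R * R) | b <= p.1 <= T], continuous (fun p => B p.1)}.
Proof.
move=> cB; apply/subspace_continuousP => p /= pA U nU.
have pI : `[b, T]%classic p.1 by rewrite /= in_itv.
have := (subspace_continuousP _ _).1 cB p.1 pI U nU.
rewrite /nbhs /= /within /= => h.
have : nbhs p (fst @^-1` [set s | `[b, T]%classic s -> U (B s)]) by exact: cvg_fst.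
by apply: filterS => q /= hq qA; apply: hq; rewrite /= in_itv.
Qed.

Variables (N : nat) (f : R * R -> R) (w : R -> R * R -> R).
Hypothesis (sol : solution N (fourier_proj N f) w).

(** [c] is 1 or -1. The barrier depends on time alone, so the spatial critical points of c w - B are
    those of w, where the transport term vanishes. *)
Lemma barrier_signed (c b T : R) (B dB : R -> R) : 0 <= b -> c ^+ 2 = 1 ->
  {within `[b, T], continuous B} -> (forall t, b < t <= T -> drv B t (dB t)) ->
  (forall t x, b < t <= T -> `|defect N (coefs w t) x| <= dB t) ->
  (forall x, c * w b x <= B b) -> forall t x, b <= t <= T -> c * w t x <= B t.
Proof.
move=> b0 c1 cB dBt dle init t x tI.
have pos s : b < s <= T -> 0 < s by move=> /andP[h _]; exact: le_lt_trans b0 h.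
have nonneg s : b <= s <= T -> 0 <= s by move=> /andP[h _]; exact: le_trans b0 h.
have cn0 : c != 0 by apply: contraTneq (ltr01 (R := R)) => e; rewrite -c1 e expr0n /= ltxx.
pose F t x := c * w t x - B t.
have D1 (g : R * R -> R) (e : R) : (forall y, derivable (fun s : R => g (s, y.2)) y.1 1) ->
    (forall y, drv (fun s : R => c * g (s, y.2) - e) y.1 (c * d1 g y)).
  move=> dg y; have := drvB (drvZ c (drvP (dg y))) (drv_cst y.1 e).
  by rewrite subr0 -d1E.
have D2 (g : R * R -> R) (e : R) : (forall y, derivable (fun s : R => g (y.1, s)) y.2 1) ->
    (forall y, drv (fun s : R => c * g (y.1, s) - e) y.2 (c * d2 g y)).
  move=> dg y; have := drvB (drvZ c (drvP (dg y))) (drv_cst y.2 e).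
  by rewrite subr0 -d2E.
have dF1 s : 0 < s -> d1 (F s) = (fun y => c * d1 (w s) y - 0).
  move=> s0; apply/funext => y; have [[_ g1 _ _ _] _ _] := solution_C2 sol s0.
  by rewrite subr0 d1E (drv_derive1 (D1 _ (B s) g1 y)).
have dF2 s : 0 < s -> d2 (F s) = (fun y => c * d2 (w s) y - 0).
  move=> s0; apply/funext => y; have [[_ _ g2 _ _] _ _] := solution_C2 sol s0.
  by rewrite subr0 d2E (drv_derive1 (D2 _ (B s) g2 y)).
suff : F t x <= 0 by rewrite /F subr_le0.
apply: (@parabolic_max_principle R F b T 0 _ _ _ _ _ _ t x tI).
- have cw : {within [set p : R * (R * R) | b <= p.1 <= T],
      continuous (fun p : R * (R * R) => w p.1 p.2)}.
    apply: continuous_subspaceW (solution_continuous sol) => p /=; exact: nonneg.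
  have c2 : {within [set p : R * (R * R) | b <= p.1 <= T], continuous (fun=> c)}.
    by apply: continuous_subspaceT => p; exact: cvg_cst.
  have c3 := within_fst cB.
  move=> p; exact: (cvgB (cvgM (c2 p) (cw p)) (c3 p)).
- move=> s /nonneg s0 y; have := solution_periodic sol s0 y.
  by rewrite /F => -[-> ->].
- move=> s y sI; have := drvB (drvZ c (drv_solution sol y (pos s sI))) (dBt s sI).
  exact: drv_derivable.
- move=> s /pos s0; have [[_ g1 g2 _ _] [_ g11 _ _ _] [_ _ g22 _ _]] := solution_C2 sol s0.
  split=> y.
  + exact: drv_derivable (D1 _ (B s) g1 y).
  + exact: drv_derivable (D2 _ (B s) g2 y).
  + by rewrite dF1//; exact: drv_derivable (D1 _ 0 g11 y).
  + by rewrite dF2//; exact: drv_derivable (D2 _ 0 g22 y).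
- move=> s y sI; have s0 := pos s sI.
  rewrite {1}dF1// {1}dF2// !subr0 => /eqP; rewrite mulf_eq0 (negbTE cn0) /= => /eqP e1.
  move=> /eqP; rewrite mulf_eq0 (negbTE cn0) /= => /eqP e2.
  have [_ [_ g11 _ _ _] [_ _ g22 _ _]] := solution_C2 sol s0.
  have -> : laplacian (F s) y = c * laplacian (w s) y.
    rewrite /laplacian dF1// dF2// (d1E (fun y => c * d1 (w s) y - 0)) (d2E (fun y => c * d2 (w s) y - 0)).
    by rewrite (drv_derive1 (D1 _ 0 g11 y)) (drv_derive1 (D2 _ 0 g22 y)) mulrDr.
  rewrite /dt (drv_derive1 (drvB (drvZ c (drv_solution sol y s0)) (dBt s sI))).
  rewrite (solution_critical sol s0 e1 e2) mulrDr.
  have h : c * defect N (coefs w s) y <= dB s.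
    apply: le_trans (ler_norm _) _; rewrite normrM.
    have -> : `|c| = 1.
      by apply/eqP; rewrite -(@eqrXn2 _ 2)// expr1n real_normK ?num_real// c1.
    by rewrite mul1r dle.
  by move: h; move: (c * defect _ _ _) (c * laplacian _ _) (dB s) => u v e; lra.
- by move=> y; rewrite /F subr_le0.
Qed.

Lemma barrier (b T : R) (B dB : R -> R) : 0 <= b ->
  {within `[b, T], continuous B} -> (forall t, b < t <= T -> drv B t (dB t)) ->
  (forall t x, b < t <= T -> `|defect N (coefs w t) x| <= dB t) ->
  (forall x, `|w b x| <= B b) -> forall t x, b <= t <= T -> `|w t x| <= B t.
Proof.
move=> b0 cB dBt dle init t x tI.
have p y : 1 * w b y <= B b by rewrite mul1r; move: (init y); rewrite ler_norml => /andP[].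
have n y : -1 * w b y <= B b by rewrite mulN1r lerNl; move: (init y); rewrite ler_norml => /andP[].
have h1 := barrier_signed b0 (expr1n _ 2) cB dBt dle p x tI.
have s1 : (-1) ^+ 2 = 1 :> R by rewrite sqrrN expr1n.
have h2 := barrier_signed b0 s1 cB dBt dle n x tI.
by rewrite ler_norml lerNl -mulN1r h2 -[w t x]mul1r h1.
Qed.

End Barrier.

(** * Growth of the sup norm over short and long times *)

Section Estimate.
Context {R : realType}.
Local Notation tm := (@torus_measure R).
Implicit Types (x y : R * R) (t s T mu : R) (k p q : int * int).

(** Linearises sqrt S, so that a bound on the time integral of S suffices without Cauchy-Schwarz in
    time; mu is tuned later to the time range. *)
Lemma amgm (mu S : R) : 0 < mu -> 0 <= S -> S <= (mu * S + (4 * mu)^-1) ^+ 2.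
Proof.
move=> mu0 S0; rewrite -subr_ge0.
have -> : (mu * S + (4 * mu)^-1) ^+ 2 - S = (mu * S - (4 * mu)^-1) ^+ 2.
  by field; rewrite gt_eqF.
exact: sqr_ge0.
Qed.

Variables (N : nat) (f : R * R -> R) (w : R -> R * R -> R) (M : R).
Hypotheses (sol : solution N (fourier_proj N f) w) (ef : essbounded f)
  (fM : {ae tm, forall y, `|f y| <= M}) (M0 : 0 <= M)
  (z00 : fourier_coef f 0 = 0) (N0 : (0 < N)%N).

Local Notation a := (coefs w).
Local Notation z := (fourier_coef f).
Local Notation D := (@dirichlet_bound R N).
Let b t k := a t k - heat z t k.
Let gal := solution_galerkin sol.

Let zM : Sob N 0 z <= M ^+ 2.
Proof.
have -> : Sob N 0 z = \sum_(k <- box N) nsq (z k).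
  by apply: eq_bigr => k _; rewrite expr0 mul1r.
exact: bessel ef fM.
Qed.

Let D0 : 0 <= D. Proof. exact: dirichlet_bound_ge0. Qed.
Let MD0 : 0 <= M * D. Proof. exact: mulr_ge0. Qed.
Let N0' : 0 < N%:R :> R. Proof. by rewrite ltr0n. Qed.

Let MLam : M ^+ 2 * Lam N <= (M * D) ^+ 2.
Proof. have -> : (M * D) ^+ 2 = M ^+ 2 * D ^+ 2 by ring.
exact: (ler_wpM2l (sqr_ge0 M) (Lam_le N)). Qed.

Let veloa t : 0 <= t -> velo N (a t) <= M * D.
Proof.
move=> t0; rewrite -(ler_pXn2r (n := 2))// ?nnegrE ?velo_ge0//.
exact: le_trans (galerkin_velo gal zM t0) MLam.
Qed.

Let veloz : velo N z <= M * D.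
Proof.
rewrite -(ler_pXn2r (n := 2))// ?nnegrE ?velo_ge0//.
by apply: le_trans (velo_le N z) (le_trans _ MLam); rewrite ler_wpM2r ?Lam_ge0.
Qed.

Let abE t : a t = (fun k => heat z t k + b t k).
Proof. by apply/funext => k; rewrite /b addrCA subrr addr0. Qed.

(** The gradient of [b] costs sqrt (S_2(b)) by [gradl1_le], linearised by [amgm]; the heat flow
    costs t^(-1/2), integrable at 0. *)
Lemma defect_short mu t x : 0 < mu -> 0 < t -> `|defect N (a t) x| <=
  M * D ^+ 2 * (mu * Sob N 2 (b t) + (4 * mu)^-1) + 2 * (M * D) * (M * D ^+ 2) / Num.sqrt t.
Proof.
move=> mu0 t0; rewrite defect_interaction {2}abE interactionD.
have h1 := heat_interaction N (a t) x ef fM M0 t0.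
have h2 := interaction_le N (a t) (b t) x.
have v0 := velo_ge0 N (a t); have v1 := veloa (ltW t0); have g0 := gradl1_ge0 N (b t).
have S0 := Sob_ge0 N 2 (b t).
have st0 : 0 < Num.sqrt t by rewrite sqrtr_gt0.
have MD2 : 0 <= M * D ^+ 2 by rewrite mulr_ge0 ?sqr_ge0.
have h3 : velo N (a t) * gradl1 N (b t) <= M * D ^+ 2 * (mu * Sob N 2 (b t) + (4 * mu)^-1).
  have r0 : 0 <= mu * Sob N 2 (b t) + (4 * mu)^-1.
    by rewrite (addr_ge0 (mulr_ge0 (ltW mu0) S0))// invr_ge0 (mulr_ge0 (ler0n _ 4) (ltW mu0)).
  rewrite -(ler_pXn2r (n := 2))// ?nnegrE ?(mulr_ge0 v0 g0) ?(mulr_ge0 MD2 r0)//.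
  rewrite [leLHS]exprMn [leRHS](_ : _ = M ^+ 2 * (D ^+ 2) ^+ 2 * (mu * Sob N 2 (b t) + (4 * mu)^-1) ^+ 2);
    last by ring.
  apply: le_trans (_ : (M * D) ^+ 2 * (Sob N 2 (b t) * D ^+ 2) <= _).
    apply: ler_pM; rewrite ?sqr_ge0//.
      by rewrite ler_pXn2r ?nnegrE.
    apply: le_trans (gradl1_le N (b t)) _; exact: ler_wpM2l (Lam_le N).
  have -> : (M * D) ^+ 2 * (Sob N 2 (b t) * D ^+ 2) = M ^+ 2 * (D ^+ 2) ^+ 2 * Sob N 2 (b t) by ring.
  by apply: ler_wpM2l (amgm mu0 S0); rewrite mulr_ge0 ?sqr_ge0.
apply: le_trans (ler_normD _ _) _; rewrite addrC; apply: lerD (le_trans h2 h3) _.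
apply: le_trans h1 _.
have -> : 2 * (M * D) * (M * D ^+ 2) / Num.sqrt t = M * D * (2 * M * D ^+ 2 / Num.sqrt t) by ring.
apply: (ler_wpM2r _ v1); apply: (divr_ge0 _ (ltW st0)); rewrite -mulrA.
exact: (mulr_ge0 (ler0n _ 2) MD2).
Qed.

(** [amgm] is used with parameter mu t e^t, the weight of [energy2]. Then e^t >= sqrt t turns the
    remainder into t^(-3/2), whose primitive is explicit. *)
Lemma defect_long mu t x : 0 < mu -> 0 < t -> `|defect N (a t) x| <=
  4 * (M * D ^+ 2) / N%:R * (mu * (t * expR t * Sob N 3 (b t)) + (4 * mu * (t * Num.sqrt t))^-1)
  + (M * D) ^+ 2 / (16 * N%:R ^+ 2 * t ^+ 2).
Proof.
move=> mu0 t0; have h0 := defect_high N (a t) x.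
have st0 : 0 < Num.sqrt t by rewrite sqrtr_gt0.
have v0 := velo_ge0 N (a t); have v1 := veloa (ltW t0).
have S0 := Sob_ge0 N 3 (b t).
have MD2 : 0 <= M * D ^+ 2 by rewrite mulr_ge0 ?sqr_ge0.
have hl := highl1_heat z N0 t0; have hb := highl1_Sob (b t) N0.
have hD : highl1 N (a t) <= highl1 N (heat z t) + highl1 N (b t).
  by rewrite {1}abE; exact: highl1D.
have hb0 : 0 <= highl1 N (b t).
  by apply: sumr_ge0 => k _; rewrite mulr_ge0 ?kn_ge0 ?cabs_ge0.
have te0 : 0 < t * expR t by rewrite mulr_gt0 ?expR_gt0.
have nu0 : 0 < mu * (t * expR t) by exact: mulr_gt0.
have C0 : 0 <= 4 * (M * D ^+ 2) / N%:R := divr_ge0 (mulr_ge0 (ler0n _ 4) MD2) (ltW N0').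
have e1 : velo N (a t) * highl1 N (heat z t) <= M * D * ((32 * N%:R ^+ 2 * t ^+ 2)^-1 * (M * D)).
  have q0 : 0 <= (32 * N%:R ^+ 2 * t ^+ 2)^-1.
    by rewrite invr_ge0 (mulr_ge0 (mulr_ge0 (ler0n _ 32) (sqr_ge0 _)) (sqr_ge0 _)).
  apply: le_trans (ler_wpM2l v0 (le_trans hl (ler_wpM2l q0 veloz))) _.
  by apply: ler_wpM2r v1; exact: mulr_ge0 q0 MD0.
have e2 : 2 * (velo N (a t) * highl1 N (b t)) <=
    4 * (M * D ^+ 2) / N%:R * (mu * (t * expR t) * Sob N 3 (b t) + (4 * (mu * (t * expR t)))^-1).
  have r0 : 0 <= mu * (t * expR t) * Sob N 3 (b t) + (4 * (mu * (t * expR t)))^-1.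
    by rewrite addr_ge0 ?invr_ge0 ?(mulr_ge0 _ S0) ?(mulr_ge0 _ (ltW nu0))// ltW.
  rewrite -(ler_pXn2r (n := 2))// ?nnegrE; last 2 first.
  - exact: mulr_ge0 (ler0n _ 2) (mulr_ge0 v0 hb0).
  - exact: mulr_ge0 C0 r0.
  rewrite [leRHS]exprMn; apply: le_trans (_ : (4 * (M * D ^+ 2) / N%:R) ^+ 2 * Sob N 3 (b t) <= _).
    apply: le_trans (_ : 4 * ((M * D) ^+ 2 * (Sob N 3 (b t) * (4 / N%:R ^+ 2 * D ^+ 2))) <= _).
      rewrite exprMn [2 ^+ 2](_ : _ = 4); last by ring.
      apply: ler_wpM2l => //; rewrite exprMn; apply: ler_pM; rewrite ?sqr_ge0//.
        by rewrite ler_pXn2r ?nnegrE.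
      apply: le_trans hb _; apply: ler_wpM2l => //; apply: ler_wpM2l (Lam_le N).
      by rewrite divr_ge0 ?sqr_ge0.
    rewrite le_eqVlt; apply/orP; left; apply/eqP.
    by move: (Sob _ _ _) => S; field; rewrite gt_eqF.
  by apply: ler_wpM2l (amgm nu0 S0); exact: sqr_ge0.
have e3 : (4 * (mu * (t * expR t)))^-1 <= (4 * mu * (t * Num.sqrt t))^-1.
  rewrite -mulrA lef_pV2 ?posrE; last 2 first.
  - by rewrite mulr_gt0.
  - by rewrite !mulr_gt0.
  rewrite ler_pM2l// ler_pM2l// ler_pM2l// -[leRHS]ger0_norm ?expR_ge0// -sqrtr_sqr ler_wsqrtr//.
  have := expR_ge1Dx t; have := expR_ge0 t; have := expR_ge1Dx t.
  move: (expR t) => e h1 h2 h3; rewrite expr2; apply: le_trans (_ : 1 * e <= _); first lra.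
  by apply: ler_wpM2r => //; lra.
apply: le_trans h0 _; apply: le_trans (ler_wpM2l (ler0n _ 2) (ler_wpM2l v0 hD)) _.
rewrite mulrDr mulrDr addrC; apply: lerD.
  apply: le_trans e2 _; apply: ler_wpM2l => //.
  by rewrite -mulrA; exact: lerD.
apply: le_trans (ler_wpM2l (ler0n _ 2) e1) _.
rewrite le_eqVlt; apply/orP; left; apply/eqP.
by field; rewrite !gt_eqF.
Qed.

Lemma sup_short (A mu T : R) : 0 < mu -> (forall x, `|w 0 x| <= A) ->
  forall t x, 0 <= t <= T -> `|w t x| <=
  A + M * D ^+ 2 * (mu * (M ^+ 4 * D ^+ 2) + T / (4 * mu)) + 4 * (M * D) * (M * D ^+ 2) * Num.sqrt T.
Proof.
move=> mu0 wA t x /andP[t0 tT].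
have MD2 : 0 <= M * D ^+ 2 by rewrite mulr_ge0 ?sqr_ge0.
have [Phi [dPhi [cPhi hPhi Phi0 Phi00]]] := energy1 gal z00 zM.
(* A primitive of the bound of [defect_short], with the decrease of [Phi] in place of the integral
   of S_2(b). *)
pose B s := A + M * D ^+ 2 * (mu * (Phi 0 - Phi s) + s * (4 * mu)^-1)
  + 4 * (M * D) * (M * D ^+ 2) * Num.sqrt s.
pose dB s := M * D ^+ 2 * (mu * (0 - dPhi s) + (4 * mu)^-1)
  + 4 * (M * D) * (M * D ^+ 2) * (1 / (2 * Num.sqrt s)).
have key : `|w t x| <= B t.
  have tt : 0 <= t <= t by rewrite t0 lexx.
  apply: (barrier sol (dB := dB) (lexx 0) _ _ _ _ x tt).
  - have c1 : cont0 (fun s => Phi 0 - Phi s) := cont0B (@cont0_cst R (Phi 0)) cPhi.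
    have c2 : cont0 (fun s : R => s * (4 * mu)^-1).
      by apply: cont0_drv => s; exact: drvM (drv_id s) (drv_cst s _).
    have c3 : cont0 (@Num.sqrt R) by apply: cont0_continuous; exact: sqrt_continuous.
    exact: (cont0D (cont0D (@cont0_cst R A) (cont0M (@cont0_cst R _)
      (cont0D (cont0M (@cont0_cst R mu) c1) c2))) (cont0M (@cont0_cst R _) c3)).
  - move=> s /andP[s0 _]; have [dP _] := hPhi s s0.
    apply: drv_eq (drvD (drvD (drv_cst s A) (drvZ (M * D ^+ 2) (drvD (drvZ mu
      (drvB (drv_cst s (Phi 0)) dP)) (drvM (drv_id s) (drv_cst s (4 * mu)^-1)))))
      (drvZ (4 * (M * D) * (M * D ^+ 2)) (drv_sqrt s0 (drv_id s)))) _.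
    by rewrite add0r mulr0 addr0 mul1r.
  - move=> s y /andP[s0 _]; have [_ dle] := hPhi s s0.
    apply: le_trans (defect_short y mu0 s0) _; rewrite /dB; apply: lerD.
      rewrite ler_wpM2l// lerD2r ler_wpM2l ?(ltW mu0)// sub0r lerNr; exact: dle.
    rewrite le_eqVlt; apply/orP; left; apply/eqP.
    by field; rewrite gt_eqF// sqrtr_gt0.
  - by move=> y; rewrite /B subrr mulr0 mul0r sqrtr0 !(mulr0, addr0).
apply: le_trans key _; rewrite /B -!addrA lerD2l; apply: lerD; last first.
  by rewrite ler_wpM2l ?ler_wsqrtr// mulr_ge0// mulr_ge0.
rewrite ler_wpM2l//; apply: lerD.
  rewrite ler_wpM2l ?(ltW mu0)//; apply: le_trans (_ : Phi 0 <= _).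
    by rewrite gerBl Phi0.
  apply: le_trans Phi00 _.
  have -> : M ^+ 4 * D ^+ 2 = (M * D) ^+ 2 * M ^+ 2 by ring.
  exact: (ler_wpM2r (sqr_ge0 M) MLam).
by rewrite ler_wpM2r// invr_ge0 mulr_ge0// ltW.
Qed.

Lemma sup_long (A mu d : R) : 0 < mu -> 0 < d -> (forall x, `|w d x| <= A) ->
  forall t x, d <= t -> `|w t x| <=
  A + 4 * (M * D ^+ 2) / N%:R * (mu * (((M * D) ^+ 2 + 4 * (M * D) ^+ 2 * (1 + (M * D) ^+ 2)) * M ^+ 2)
     + (2 * mu * Num.sqrt d)^-1) + (M * D) ^+ 2 / (16 * N%:R ^+ 2 * d).
Proof.
move=> mu0 d0 wA t x dt_.
have MD2 : 0 <= M * D ^+ 2 by rewrite mulr_ge0 ?sqr_ge0.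
have C0 : 0 <= 4 * (M * D ^+ 2) / N%:R := divr_ge0 (mulr_ge0 (ler0n _ 4) MD2) (ltW N0').
have E0 : 0 <= (M * D) ^+ 2 / (16 * N%:R ^+ 2).
  by rewrite divr_ge0 ?sqr_ge0 ?(mulr_ge0 (ler0n _ 16) (sqr_ge0 _)).
have [Phi [dPhi [cPhi hPhi Phi0 Phi00]]] := energy2 gal z00 zM.
have sd0 : 0 < Num.sqrt d by rewrite sqrtr_gt0.
(* Similarly for [defect_long]: t^(-3/2) and t^-2 integrate to differences of t^(-1/2) and t^-1,
   bounded by their values at [d] for all later times. *)
pose B s := A + 4 * (M * D ^+ 2) / N%:R * (mu * (Phi d - Phi s)
    + (2 * mu)^-1 * ((Num.sqrt d)^-1 - (Num.sqrt s)^-1))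
  + (M * D) ^+ 2 / (16 * N%:R ^+ 2) * (d^-1 - s^-1).
pose dB s := 4 * (M * D ^+ 2) / N%:R * (mu * (0 - dPhi s)
    + (2 * mu)^-1 * (0 - - (1 / (2 * Num.sqrt s)) / Num.sqrt s ^+ 2))
  + (M * D) ^+ 2 / (16 * N%:R ^+ 2) * (0 - - 1 / s ^+ 2).
have drvB_ s : 0 < s -> drv B s (dB s).
  move=> s0; have [dP _] := hPhi s s0.
  have ss0 : Num.sqrt s != 0 by rewrite gt_eqF// sqrtr_gt0.
  have sn0 : s != 0 by rewrite gt_eqF.
  apply: drv_eq (drvD (drvD (drv_cst s A) (drvZ (4 * (M * D ^+ 2) / N%:R) (drvD (drvZ mu
      (drvB (drv_cst s (Phi d)) dP)) (drvZ (2 * mu)^-1 (drvB (drv_cst s (Num.sqrt d)^-1)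
      (drv_inv ss0 (drv_sqrt s0 (drv_id s))))))))
      (drvZ ((M * D) ^+ 2 / (16 * N%:R ^+ 2)) (drvB (drv_cst s d^-1) (drv_inv sn0 (drv_id s))))) _.
  by rewrite add0r.
have key : `|w t x| <= B t.
  have tt : d <= t <= t by rewrite dt_ lexx.
  apply: (barrier sol (dB := dB) (ltW d0) _ _ _ _ x tt).
  - apply: continuous_in_subspaceT => s; rewrite inE /= in_itv/= => /andP[ds _].
    exact: drv_continuous (drvB_ s (lt_le_trans d0 ds)).
  - by move=> s /andP[ds _]; exact/drvB_/(lt_trans d0).
  - move=> s y /andP[ds _]; have s0 := lt_trans d0 ds; have [_ dle] := hPhi s s0.
    have ss0 : 0 < Num.sqrt s by rewrite sqrtr_gt0.
    apply: le_trans (defect_long y mu0 s0) _; rewrite /dB; apply: lerD.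
      apply: ler_wpM2l => //; apply: lerD.
        rewrite ler_wpM2l ?(ltW mu0)// sub0r lerNr; exact: dle.
      rewrite sqr_sqrtr ?(ltW s0)// le_eqVlt; apply/orP; left; apply/eqP.
      by field; rewrite !gt_eqF.
    rewrite le_eqVlt; apply/orP; left; apply/eqP.
    by field; rewrite !gt_eqF.
  - by move=> y; rewrite /B !subrr !(mulr0, addr0).
have PhiK : Phi d <= ((M * D) ^+ 2 + 4 * (M * D) ^+ 2 * (1 + (M * D) ^+ 2)) * M ^+ 2.
  apply: le_trans (_ : Phi 0 <= _).
    have dr s : 0 < s < d -> drv Phi s (dPhi s) by move=> /andP[s0 _]; exact: (hPhi s s0).1.
    have := @drv_le R Phi (fun=> 0) dPhi (fun=> 0) 0 d (ltW d0) (cPhi d) (@cont0_cst R 0 d) dr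
      (fun s _ => drv_cst s 0).
    rewrite subrr subr_le0; apply => s /andP[s0 _]; apply: le_trans (hPhi s s0).2 _.
    by rewrite oppr_le0 mulr_ge0 ?Sob_ge0// mulr_ge0 ?expR_ge0// ltW.
  apply: le_trans Phi00 _; rewrite ler_wpM2r ?sqr_ge0//.
  have K0 : 0 <= M ^+ 2 * Lam N by rewrite mulr_ge0 ?sqr_ge0 ?Lam_ge0.
  move: MLam K0; move: (M ^+ 2 * _) ((M * D) ^+ 2) => u v uv u0; nra.
have t0 := lt_le_trans d0 dt_.
apply: le_trans key _; rewrite /B -!addrA lerD2l; apply: lerD.
  apply: ler_wpM2l => //; apply: lerD.
    rewrite ler_wpM2l ?(ltW mu0)//; apply: le_trans PhiK.
    by rewrite gerBl Phi0// ltW.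
  rewrite [(_ * Num.sqrt d)^-1]invfM ler_wpM2l ?invr_ge0 ?mulr_ge0 ?(ltW mu0)//.
  by rewrite gerBl invr_ge0 sqrtr_ge0.
rewrite [leRHS](_ : _ = (M * D) ^+ 2 / (16 * N%:R ^+ 2) * d^-1); last first.
  by rewrite invfM mulrA.
by rewrite ler_wpM2l// gerBl invr_ge0 ltW.
Qed.

(** The first two terms come from times before the splitting, the third from the remainder [b] after
    it, the last from the heat flow after it. Every monomial has degree at most 6 in D. *)
Definition estimate_const (M D : R) : R :=
  M * D ^+ 2 * (M ^+ 4 * D ^+ 2 + 4^-1) + 4 * (M * D) * (M * D ^+ 2) +
  4 * (M * D ^+ 2) * (((M * D) ^+ 2 + 4 * (M * D) ^+ 2 * (1 + (M * D) ^+ 2)) * M ^+ 2 + 2^-1) +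
  (M * D) ^+ 2 / 16.

(* Here r = N^(1/8) and the time is split at r^-10 = N^(-5/4). *)
Lemma sup_solution (A r : R) : 1 <= r -> r ^+ 8 = N%:R -> (forall x, `|w 0 x| <= A) ->
  forall t x, 0 <= t -> `|w t x| <= A + estimate_const M D / r ^+ 5.
Proof.
move=> r1 rN wA t x t0.
have r0 : 0 < r by lra.
have q0 : 0 < r^-1 by rewrite invr_gt0.
have q1 : r^-1 <= 1 by rewrite invf_le1.
pose d := r^-1 ^+ 10.
have d0 : 0 < d by rewrite exprn_gt0.
have sd : Num.sqrt d = r^-1 ^+ 5.
  by rewrite /d (exprM _ 5 2) sqrtr_sqr ger0_norm// exprn_ge0// ltW.
(* Short range: mu = sqrt d balances mu against d / mu. *)
have mu10 : 0 < r^-1 ^+ 5 by rewrite exprn_gt0.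
have MD2 : 0 <= M * D ^+ 2 by rewrite mulr_ge0 ?sqr_ge0.
have K0 : 0 <= ((M * D) ^+ 2 + 4 * (M * D) ^+ 2 * (1 + (M * D) ^+ 2)) * M ^+ 2.
  have s0 := sqr_ge0 (M * D); apply: mulr_ge0 (sqr_ge0 _).
  by move: (_ ^+ 2) s0 => u u0; nra.
have short s y : 0 <= s <= d -> `|w s y| <=
    A + (M * D ^+ 2 * (M ^+ 4 * D ^+ 2 + 4^-1) + 4 * (M * D) * (M * D ^+ 2)) / r ^+ 5.
  move=> sI; apply: le_trans (sup_short mu10 wA y sI) _.
  rewrite sd le_eqVlt /d; apply/orP; left; apply/eqP.
  by field; rewrite gt_eqF.
rewrite /estimate_const.
set G1 := M * D ^+ 2 * _ + _ in short *; set G2 := 4 * (M * D ^+ 2) * _; set G3 := _ / 16.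
have G30 : 0 <= G3 by rewrite /G3 divr_ge0 ?sqr_ge0.
have r50 : 0 <= (r ^+ 5)^-1 by rewrite invr_ge0 exprn_ge0 ?ltW.
have [td|dt_] := leP t d.
  apply: le_trans (short t x _) _; first by rewrite t0.
  rewrite lerD2l ler_wpM2r// -addrA lerDl addr_ge0// /G2.
  exact: mulr_ge0 (mulr_ge0 (ler0n _ 4) MD2) (addr_ge0 K0 _).
(* Long range: with mu = r^2, the terms mu / N and 1 / (N mu sqrt d) are r^-6 and r^-5; the heat
   flow contributes 1 / (N^2 d) = r^-6. *)
have r20 : 0 < r ^+ 2 by rewrite exprn_gt0.
have h : forall y, `|w d y| <= A + G1 / r ^+ 5.
  by move=> y; apply: short; rewrite lexx ltW.
apply: le_trans (sup_long r20 d0 h x (ltW dt_)) _.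
have -> : A + (G1 + G2 + G3) / r ^+ 5 = A + G1 / r ^+ 5 + G2 / r ^+ 5 + G3 / r ^+ 5.
  by rewrite !mulrDl !addrA.
rewrite sd -rN /d; apply: lerD; first apply: lerD (lexx _) _.
  rewrite /G2; set K := _ * M ^+ 2 in K0 *.
  have -> : 4 * (M * D ^+ 2) / r ^+ 8 * (r ^+ 2 * K + (2 * r ^+ 2 * r^-1 ^+ 5)^-1) =
    4 * (M * D ^+ 2) * (r^-1 * K + 2^-1) / r ^+ 5 by field; rewrite gt_eqF.
  apply: (ler_wpM2r r50); apply: (ler_wpM2l (mulr_ge0 (ler0n _ 4) MD2)); rewrite lerD2r.
  by rewrite -[leRHS]mul1r ler_wpM2r.
rewrite /G3 (_ : _ / (_ * _ * _) = r^-1 * ((M * D) ^+ 2 / 16 / r ^+ 5)); last first.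
  by field; rewrite gt_eqF.
by rewrite -[leRHS]mul1r ler_wpM2r// divr_ge0// ?divr_ge0 ?sqr_ge0// exprn_ge0// ltW.
Qed.

End Estimate.

(** * The essential supremum norm and the final constants *)

Section SupNorm.
Context {R : realType}.
Local Notation tm := (@torus_measure R).
Implicit Types (g : R * R -> R).

Lemma norm_infE g : norm_inf g = ess_sup tm (abse \o (EFin \o g)).
Proof. by rewrite /norm_inf unlock /Lnorm torus_measureT lte01. Qed.

Lemma norm_inf_le g (C : R) : (forall x, `|g x| <= C) -> (norm_inf g <= C%:E)%E.
Proof.
by move=> gC; rewrite norm_infE; apply/ess_supP; apply: nearW => x /=; rewrite lee_fin.
Qed.

Lemma norm_inf_fin g : (norm_inf g < +oo)%E ->
  [/\ norm_inf g = (fine (norm_inf g))%:E, 0 <= fine (norm_inf g) &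
      {ae tm, forall x, `|g x| <= fine (norm_inf g)}].
Proof.
move=> goo; have g0 : (0 <= norm_inf g)%E by exact: Lnorm_ge0.
have gE : norm_inf g = (fine (norm_inf g))%:E by rewrite fineK// ge0_fin_numE.
split; [exact: gE|exact: fine_ge0|].
have h := ess_sup_ge tm (abse \o (EFin \o g)).
apply: ae_imply h => x /=; by rewrite -norm_infE gE lee_fin.
Qed.

Lemma Linfty_essbounded g : Linfty g ->
  essbounded g /\ norm_inf g = (fine (norm_inf g))%:E.
Proof.
move=> [_ gL]; have goo : (norm_inf g < +oo)%E.
  by move: gL; rewrite inE => /andP[_]; rewrite inE.
have [gE _ gae] := norm_inf_fin goo; split => //; split; last by exists (fine (norm_inf g)).
by move: gL; rewrite inE => /andP[]; rewrite inE.
Qed.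

Lemma norm_inf_pointwise g : continuous g -> Defs.periodic g ->
  norm_inf g = (fine (norm_inf g))%:E /\ forall x, `|g x| <= fine (norm_inf g).
Proof.
move=> cg pg; have [C _ gC] := periodic_bounded cg pg.
have goo : (norm_inf g < +oo)%E by apply: le_lt_trans (norm_inf_le gC) _; rewrite ltry.
have [gE _ gae] := norm_inf_fin goo; split => //.
apply: (@ae_everywhere R (fun x => `|g x|)) => //.
- by move=> x; apply: (continuous_comp (f := g) (g := fun s : R => `|s|)); [exact: cg|exact: norm_continuous].
- by move=> x; split; rewrite ?(pg x).1 ?(pg x).2.
Qed.

Lemma estimate_const_ge0 (M D : R) : 0 <= M -> 0 <= D -> 0 <= estimate_const M D.
Proof.
move=> M0 D0; have D2 := sqr_ge0 D; have M2 := sqr_ge0 M.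
have q : 0 <= (M * D) ^+ 2 by exact: sqr_ge0.
have M4 : 0 <= M ^+ 4 by exact: exprn_ge0.
rewrite /estimate_const; move: (D ^+ 2) (M ^+ 2) ((M * D) ^+ 2) (M ^+ 4) D2 M2 q M4.
move=> d m k n d0 m0 k0 n0.
by rewrite !(addr_ge0, mulr_ge0, invr_ge0, ler0n).
Qed.

Lemma estimate_const_le (M D : R) : 0 <= M -> 1 <= D ->
  estimate_const M D <= estimate_const M 1 * D ^+ 6.
Proof.
move=> M0 D1; have D0 : 0 <= D by lra.
have le6 j : (j <= 6)%N -> D ^+ j <= D ^+ 6 by move=> j6; exact: ler_weXn2l.
have h i j : (j <= 6)%N -> M ^+ i * D ^+ j <= M ^+ i * D ^+ 6.
  by move=> j6; exact: (ler_wpM2l (exprn_ge0 i M0) (le6 j j6)).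
have h1 := h 1%N 2%N isT; have h2 := h 2%N 3%N isT; have h3 := h 5%N 4%N isT.
have h4 := h 2%N 2%N isT.
by rewrite /estimate_const; lra.
Qed.

End SupNorm.

Theorem theorem1p12 (R : realType) :
  exists alpha : R -> R, (forall M : R, 0 < alpha M) /\
    forall (f : R * R -> R) (N : nat) (w : R -> R * R -> R),
      Linfty f -> mean_zero f -> (2 <= N)%N ->
      solution N (fourier_proj N f) w ->
      (ereal_sup [set norm_inf (w t) | t in [set t : R | (0 <= t)%R]] <=
        norm_inf (fourier_proj N f)
        + (alpha (fine (norm_inf f)) * N%:R `^ (- 2^-1))%:E)%E.
Proof.
pose C : R := (12 * 48) ^+ 6 * 13.
have C0 : 0 <= C.
  rewrite /C; have c0 : 0 <= 12 * 48 :> R by exact: (mulr_ge0 (ler0n _ 12) (ler0n _ 48)).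
  by move: (12 * 48) c0 => c c0; exact: (mulr_ge0 (exprn_ge0 6 c0) (ler0n _ 13)).
(* The absolute value and the summand 1 make the constant positive for every real M, including
   negative ones. *)
exists (fun M => 1 + estimate_const `|M| 1 * C); split.
  move=> M; have h := mulr_ge0 (estimate_const_ge0 (normr_ge0 M) ler01) C0.
  by move: (_ * C) h => u u0; lra.
move=> f N w fL f0 N2 sol; set M := fine (norm_inf f).
have [ef fE] := Linfty_essbounded fL.
have foo : (norm_inf f < +oo)%E by rewrite fE ltry.
have [_ M0 fM] := norm_inf_fin foo.
have N0 : (0 < N)%N by exact: leq_trans N2.
have N1 : 1 <= N%:R :> R by rewrite -[1]/(1%:R) ler_nat.
pose r : R := N%:R `^ (8%:R^-1).
have r8 : r ^+ 8 = N%:R.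
  by rewrite -powR_mulrn ?powR_ge0// -powRrM mulVf ?pnatr_eq0// powRr1.
have r0 : 0 < r by rewrite powR_gt0// (lt_le_trans ltr01).
have r1 : 1 <= r.
  by rewrite -(ler_pXn2r (n := 8))// ?nnegrE ?(ltW r0)// expr1n r8.
have r4 : N%:R `^ (- 2^-1) = r^-1 ^+ 4.
  rewrite exprVn powRN; congr (_^-1).
  by rewrite -powR_mulrn ?(ltW r0)// -powRrM; congr (_ `^ _); field.
have gE : fourier_proj N f = tpoly (box N) (fourier_coef f).
  by apply/funext => x; rewrite fourier_proj_tpoly.
have [AE wA] : norm_inf (fourier_proj N f) = (fine (norm_inf (fourier_proj N f)))%:E /\
    forall x, `|fourier_proj N f x| <= fine (norm_inf (fourier_proj N f)).
  by rewrite gE; apply: norm_inf_pointwise; [exact: continuous_tpoly|exact: periodic_tpoly].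
have w0A x : `|w 0 x| <= fine (norm_inf (fourier_proj N f)).
  by rewrite (solution_init sol x).
have D1 : 1 <= dirichlet_bound N :> R.
  apply: le_trans (dirichlet_bound_ge1 N); rewrite lerDl mulr_ge0// ln_ge0//; lra.
rewrite AE -EFinD; apply: ge_ereal_sup => _ [t t0 <-].
apply: norm_inf_le => x.
apply: le_trans (sup_solution sol ef fM M0 (mean_zero_coef f0) N0 r1 r8 w0A x t0) _.
rewrite lerD2l r4 -/M (ger0_norm M0).
have e0 := estimate_const_ge0 M0 ler01.
have e1 : estimate_const M (dirichlet_bound N) <= estimate_const M 1 * (C * r).
  apply: le_trans (estimate_const_le M0 D1) _; apply: (ler_wpM2l e0).
  exact: (dirichlet_bound_pow N0 (ltW r0) r8).
have q0 : 0 < r^-1 ^+ 5 by rewrite exprn_gt0// invr_gt0.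
rewrite -exprVn; apply: le_trans (ler_wpM2r (ltW q0) e1) _.
have q1 : 0 <= r^-1 ^+ 4 by rewrite exprn_ge0// invr_ge0 ltW.
(* One of the five factors r^-1 is spent on the sixth power of [dirichlet_bound N]; the other four
   are N^(-1/2). *)
have rE (e c : R) : e * (c * r) * r^-1 ^+ 5 = e * c * r^-1 ^+ 4.
  by field; rewrite gt_eqF.
rewrite rE; by apply: (ler_wpM2r q1); rewrite lerDr.
Qed.
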